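(* Let $F$ be the function field of $\mathbb P^1$ over $\mathbb F_q$, let $n\ge2$, and let $E=\mathbb F_{q^n}F$ be the constant field extension of $F$ of degree $n$. Then $\mathcal A_{tor}(E)=\{0\}$ and, therefore, $\mathcal A_{tor}=\{0\}$, for every $n\ge2$.
   Context: Let $\mathbb A$ be the adele ring of $F$, $\mathcal O_{\mathbb A}=\prod_x\widehat{\mathcal O}_x$ its maximal compact subring, and $Z$ the center of $\mathrm{GL}_n$. $\mathcal A$ denotes the space of unramified automorphic forms for $\mathrm{PGL}_n$ over $F$, i.e. functions $f:\mathrm{GL}_n(F)Z(\mathbb A)\backslash\mathrm{GL}_n(\mathbb A)/\mathrm{GL}_n(\mathcal O_{\mathbb A})\to\mathbb C$ that are automorphic forms in the usual sense: of moderate growth, and satisfying the admissibility condition that the translates of $f$ under the unramified Hecke algebra span a finite-dimensional space. For a separable field extension $E/F$ of degree $n$, choosing an $F$-basis of $E$ gives an embedding $E^*\subseteq\mathrm{GL}_n(F)$ and a non-split maximal torus $T\subseteq\mathrm{GL}_n$ with $T(F)=E^*$ and $T(\mathbb A)=\mathbb A_E^*$ ($\mathbb A_E$ the adele ring of $E$); $T$ is said to be associated with $E/F$. Endow $T(\mathbb A)$ and $T(F)Z(\mathbb A)$ with Haar measures and $T(F)Z(\mathbb A)\backslash T(\mathbb A)$ (which is compact) with the quotient measure. For $f\in\mathcal A$ the toroidal integral of $f$ along $T$ is $f_T(g):=\int_{T(F)Z(\mathbb A)\backslash T(\mathbb A)}f(tg)\,dt$. The space of $E$-toroidal automorphic forms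 is $\mathcal A_{tor}(E):=\{f\in\mathcal A\mid f_T(g)=0\text{ for all }g\in\mathrm{GL}_n(\mathbb A)\}$ (independent of the choice of basis), and the space of toroidal automorphic forms is $\mathcal A_{tor}:=\bigcap_{E/F}\mathcal A_{tor}(E)$, where $E/F$ runs over the separable extensions of degree $n$. *)

(* Defs.v *)
From HB Require Import structures.
From mathcomp Require Import all_boot all_order all_algebra all_field.
From mathcomp Require Import all_classical all_reals all_analysis.
From mathcomp Require Import finmap complex ring.

Set Implicit Arguments.
Unset Strict Implicit.
Unset Printing Implicit Defensive.

Import Order.TTheory GRing.Theory Num.Theory.
Import numFieldNormedType.Exports.
Local Open Scope classical_set_scope.
Local Open Scope ring_scope.

(* Places of a function field with finite constant field, as normalized
   discrete valuations; on such a field a discrete valuation is automatically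
   trivial on constants.  The value +oo at 0 makes the representation unique. *)
Record place (F : fieldType) := Place {
  pval :> F -> \bar int;
  pval_eqy : forall a, (pval a == +oo%E) = (a == 0);
  pvalM : forall a b, pval (a * b) = (pval a + pval b)%E;
  pvalD : forall a b, (Order.min (pval a) (pval b) <= pval (a + b)%R)%E;
  pval_surj : exists a, pval a = 1%E }.

HB.instance Definition _ (F : fieldType) := gen_eqMixin (place F).
HB.instance Definition _ (F : fieldType) := gen_choiceMixin (place F).

Section PlaceTheory.
Variables (F : fieldType) (x : place F).

Lemma pval0 : x 0 = +oo%E.
Proof. by apply/eqP; rewrite pval_eqy. Qed.

Lemma pval_neqNy a : x a != -oo%E.
Proof.
apply/eqP => xa; have := pvalM x a 0; rewrite mulr0 pval0 xa.
by [].
Qed.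

Lemma pval1 : x 1 = 0%E.
Proof.
have := pvalM x 1 1; have := pval_eqy x 1; have := pval_neqNy 1.
rewrite mulr1 oner_eq0; case: (x 1) => //= r _ _ [] /eqP.
by rewrite -subr_eq0 opprD addrA subrr sub0r oppr_eq0 => /eqP ->.
Qed.

Lemma pvalN a : x (- a) = x a.
Proof.
suff xN1 : x (-1) = 0%E by rewrite -mulN1r pvalM xN1 add0e.
have := pvalM x (-1) (-1); rewrite mulrNN mulr1 pval1.
case: (x (-1)) => //= r [] /esym/eqP.
by rewrite -mulr2n mulrn_eq0 /= => /eqP ->.
Qed.

Lemma pval_leD (N : int) a b :
  (N%:E <= x a)%E -> (N%:E <= x b)%E -> (N%:E <= x (a + b)%R)%E.
Proof. by move=> Na Nb; apply: le_trans (pvalD x a b); rewrite le_min Na. Qed.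

Lemma pval_leM (N P : int) a b :
  (N%:E <= x a)%E -> (P%:E <= x b)%E -> ((N + P)%:E <= x (a * b)%R)%E.
Proof. by move=> Na Pb; rewrite pvalM EFinD; apply: leeD. Qed.

Lemma pval_stable (N : int) a b :
  (x a < N%:E)%E -> (N%:E <= x (b - a)%R)%E -> x b = x a.
Proof.
move=> aN Nba; apply/eqP; rewrite eq_le; apply/andP; split.
- have := pvalD x b (- (b - a)); rewrite opprB [b + _]addrC subrK.
  rewrite -[a - b]opprB pvalN ge_min => /orP[//|].
  by move=> /(le_trans Nba); rewrite leNgt aN.
- have := pvalD x (b - a) a; rewrite subrK ge_min => /orP[|//].
  by move=> /(le_trans Nba) /(lt_le_trans aN) /ltW.
Qed.

Definition residue_card : nat :=
  (#|` fset_set [set [set (a + m)%R | m in [set m | (0 < x m)%E]]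
               | a in [set a | (0 <= x a)%E]] |)%fset.

End PlaceTheory.

Section Completion.
Variables (F : fieldType) (x : place F).

Definition is_cauchy : {pred nat -> F} := fun u => `[< forall N : int,
  exists M, forall i j, (M <= i)%N -> (M <= j)%N ->
    (N%:E <= x (u i - u j)%R)%E >].

Lemma cauchy_bound u : u \in is_cauchy ->
  exists B : int, \forall i \near \oo, (B%:E <= x (u i))%E.
Proof.
move=> /asboolP /(_ 0) [M uM].
have [B [B0 BM]] : exists B : int, (B%:E <= 0%:E)%E /\ (B%:E <= x (u M))%E.
  have := pval_neqNy x (u M); case: (x (u M)) => [r _|_|//].
  - by exists (Num.min 0 r); rewrite !lee_fin ge_min lexx ge_min lexx orbT.
  - by exists 0; rewrite lexx leey.
exists B; exists M => // i /= Mi; rewrite -(subrK (u M) (u i)).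
by apply: pval_leD => //; apply: le_trans B0 _; apply: uM.
Qed.

Fact is_cauchy_subring : subring_closed is_cauchy.
Proof.
split.
- apply/asboolP => N; exists 0%N => i j _ _.
  by rewrite subrr pval0 leey.
- move=> u w /asboolP uC /asboolP wC; apply/asboolP => N.
  have [M uM] := uC N; have [P wP] := wC N.
  exists (maxn M P) => i j; rewrite !geq_max => /andP[Mi Pi] /andP[Mj Pj].
  have -> : (u - w) i - (u - w) j = (u i - u j) + (w j - w i).
    have E (a b c d : F) : a - b - (c - d) = (a - c) + (d - b) by ring.
    exact: E.
  by apply: pval_leD; [apply: uM | apply: wP].
- move=> u w uC wC; apply/asboolP => N.
  have [B [m _ uB]] := cauchy_bound uC; have [C [p _ wB]] := cauchy_bound wC.
  have [M uM] := asboolP _ uC (N - C).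
  have [P wP] := asboolP _ wC (N - B).
  exists (maxn (maxn m p) (maxn M P)) => i j.
  rewrite !geq_max => /andP[/andP[mi pi] /andP[Mi Pi]].
  move=> /andP[/andP[mj pj] /andP[Mj Pj]].
  have -> : (u * w) i - (u * w) j = u i * (w i - w j) + (u i - u j) * w j.
    have E (a b c d : F) : a * b - c * d = a * (b - d) + (a - c) * d by ring.
    exact: E.
  apply: pval_leD.
  + by rewrite -[N](subrK B) addrC; apply: pval_leM; [exact: uB | exact: wP].
  + by rewrite -[N](subrK C); apply: pval_leM; [exact: uM | exact: wB].
Qed.
HB.instance Definition _ :=
  GRing.isSubringClosed.Build (nat -> F) is_cauchy is_cauchy_subring.

Record cauchy := Cauchy { cseq :> nat -> F; _ : cseq \in is_cauchy }.
HB.instance Definition _ := [isSub for cseq].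
HB.instance Definition _ := [Choice of cauchy by <:].
HB.instance Definition _ := [SubChoice_isSubComNzRing of cauchy by <:].

Definition is_null : {pred cauchy} := fun u =>
  `[< forall N : int, \forall i \near \oo, (N%:E <= x (u i))%E >].

Fact is_null_idealr : idealr_closed is_null.
Proof.
split.
- by apply/asboolP => N; apply: nearW => i; rewrite pval0 leey.
- apply/negP => /asboolP /(_ 1) [M _ /(_ M (leqnn M))].
  by rewrite [X in x X]/(1 : F) pval1.
- move=> a u w /asboolP uN /asboolP wN; apply/asboolP => N.
  have [B aB] := cauchy_bound (valP a).
  apply: filterS3 aB (uN (N - B)) (wN N) => i aB uNB wNi.
  apply: pval_leD wNi.
  by rewrite -[N](subrK B) addrC; apply: pval_leM.
Qed.
HB.instance Definition _ := isIdealr.Build cauchy is_null is_null_idealr.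

Definition completion := {ideal_quot is_null}.
HB.instance Definition _ := GRing.ComNzRing.on completion.

Fact const_cauchy_subproof (a : F) : (fun=> a) \in is_cauchy.
Proof. by apply/asboolP => N; exists 0%N => i j _ _; rewrite subrr pval0 leey. Qed.

Definition completion_emb (a : F) : completion :=
  (\pi_completion (Cauchy (const_cauchy_subproof a)))%qT.

Fact completion_emb_is_zmod_morphism : zmod_morphism completion_emb.
Proof. by move=> a b; rewrite -rmorphB; congr (\pi_completion _)%qT; apply/val_inj. Qed.
HB.instance Definition _ := GRing.isZmodMorphism.Build F completion
  completion_emb completion_emb_is_zmod_morphism.

Fact completion_emb_is_monoid_morphism : monoid_morphism completion_emb.
Proof.
split; first by rewrite -(rmorph1 \pi_completion%qT); congr (\pi_completion _)%qT; apply/val_inj.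
by move=> a b; rewrite -rmorphM; congr (\pi_completion _)%qT; apply/val_inj.
Qed.
HB.instance Definition _ := GRing.isMonoidMorphism.Build F completion
  completion_emb completion_emb_is_monoid_morphism.

(* The valuation of xi : if the Cauchy sequence u represents xi, then the
   sequence x (u i) is eventually constant, unless u tends to 0. *)
Definition cval (xi : completion) : \bar int :=
  xget +oo%E [set m | \forall i \near \oo, x ((repr xi : cauchy) i) = m].

Lemma le_cval (N : int) (xi : completion) :
  (N%:E <= cval xi)%E <->
  \forall i \near \oo, (N%:E <= x ((repr xi : cauchy) i))%E.
Proof.
rewrite /cval; set u : cauchy := repr xi; case: xgetP => [m _ um|noval].
  split=> [Nm|]; first by apply: filterS um => i ->.
  by move=> uN; have [i [<- //]] := filter_ex (filterI um uN).
split=> // _; last by rewrite leey.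
have [M uM] := asboolP _ (valP u) N.
have [[i Mi uiN]|] := pselect (exists2 i, (M <= i)%N & (x (u i) < N%:E)%E).
  case: (noval (x (u i))); exists M => // j /= Mj.
  exact: pval_stable uiN (uM _ _ Mj Mi).
by move=> noi; exists M => // i /= Mi; rewrite leNgt; apply/negP => uiN; apply: noi; exists i.
Qed.

Lemma le_cval_pi (N : int) (u : cauchy) :
  (N%:E <= cval (\pi_completion u)%qT)%E <->
  \forall i \near \oo, (N%:E <= x (u i))%E.
Proof.
rewrite le_cval; set w : cauchy := repr _.
have /asboolP wu : w - u \in is_null.
  by rewrite Quotient.idealrBE; apply/eqP; rewrite reprK.
split; apply: filterS2 (wu N) => i wui ?.
- rewrite -[u i](subKr (w i)); apply: pval_leD => //.
  by rewrite pvalN; exact: wui.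
- by rewrite -[w i](subrK (u i)); apply: pval_leD => //; exact: wui.
Qed.

Definition cint : {pred completion} := fun xi => (0 <= cval xi)%E.

Fact cint_subring : subring_closed cint.
Proof.
split.
- rewrite -(rmorph1 \pi_completion%qT); apply/le_cval_pi; apply: nearW => i.
  by rewrite [X in x X]/(1 : F) pval1.
- move=> xi eta; rewrite -[xi]reprK -[eta]reprK -rmorphB.
  move=> /le_cval_pi xi0 /le_cval_pi eta0; apply/le_cval_pi.
  apply: filterS2 xi0 eta0 => i xi0 eta0; apply: pval_leD => //.
  by rewrite pvalN.
- move=> xi eta; rewrite -[xi]reprK -[eta]reprK -rmorphM.
  move=> /le_cval_pi xi0 /le_cval_pi eta0; apply/le_cval_pi.
  apply: filterS2 xi0 eta0 => i xi0 eta0.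
  by rewrite -[0](addr0 0); apply: pval_leM.
Qed.
HB.instance Definition _ :=
  GRing.isSubringClosed.Build completion cint cint_subring.

Definition cabs (R : realType) (xi : completion) : R :=
  if cval xi is m%:E then (residue_card x)%:R ^ (- m) else 0.

End Completion.

Definition full_adele (F : fieldType) : Type := forall x : place F, completion x.

Section Adeles.
Variable F : fieldType.
Local Notation P := (full_adele F).

HB.instance Definition _ := Choice.on P.

Fact full_addA : associative (fun a b : P => (fun x => a x + b x) : P).
Proof. by move=> a b c; apply: functional_extensionality_dep => x; rewrite addrA. Qed.
Fact full_addC : commutative (fun a b : P => (fun x => a x + b x) : P).
Proof. by move=> a b; apply: functional_extensionality_dep => x; rewrite addrC. Qed.
Fact full_add0 : left_id ((fun=> 0) : P) (fun a b : P => (fun x => a x + b x) : P).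
Proof. by move=> a; apply: functional_extensionality_dep => x; rewrite add0r. Qed.
Fact full_addN : left_inverse ((fun=> 0) : P) (fun a : P => (fun x => - a x) : P)
  (fun a b : P => (fun x => a x + b x) : P).
Proof. by move=> a; apply: functional_extensionality_dep => x; rewrite addNr. Qed.
HB.instance Definition _ :=
  GRing.isZmodule.Build P full_addA full_addC full_add0 full_addN.

Fact full_mulA : associative (fun a b : P => (fun x => a x * b x) : P).
Proof. by move=> a b c; apply: functional_extensionality_dep => x; rewrite mulrA. Qed.
Fact full_mulC : commutative (fun a b : P => (fun x => a x * b x) : P).
Proof. by move=> a b; apply: functional_extensionality_dep => x; rewrite mulrC. Qed.
Fact full_mul1 : left_id ((fun=> 1) : P) (fun a b : P => (fun x => a x * b x) : P).
Proof. by move=> a; apply: functional_extensionality_dep => x; rewrite mul1r. Qed.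
Fact full_mulDl : left_distributive
  (fun a b : P => (fun x => a x * b x) : P) (fun a b : P => a + b).
Proof. by move=> a b c; apply: functional_extensionality_dep => x; rewrite mulrDl. Qed.
HB.instance Definition _ := GRing.Zmodule_isComPzRing.Build P
  full_mulA full_mulC full_mul1 full_mulDl.

Definition full_diag (c : F) : P := fun x => completion_emb x c.

Fact full_diag_is_zmod_morphism : zmod_morphism full_diag.
Proof. by move=> a b; apply: functional_extensionality_dep => x; rewrite /full_diag rmorphB. Qed.
HB.instance Definition _ :=
  GRing.isZmodMorphism.Build F P full_diag full_diag_is_zmod_morphism.

Fact full_diag_is_monoid_morphism : monoid_morphism full_diag.
Proof.
split=> [|a b]; apply: functional_extensionality_dep => x.
  by rewrite /full_diag rmorph1.
by rewrite /full_diag rmorphM.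
Qed.
HB.instance Definition _ :=
  GRing.isMonoidMorphism.Build F P full_diag full_diag_is_monoid_morphism.

Definition is_adele : {pred P} := fun a =>
  `[< finite_set [set x | a x \notin @cint F x] >].

Fact is_adele_subring : subring_closed is_adele.
Proof.
split.
- apply/asboolP; rewrite (_ : [set _ | _] = set0) //.
  by apply/seteqP; split=> x //=; rewrite rpred1.
- move=> a b /asboolP aA /asboolP bA; apply/asboolP.
  apply: sub_finite_set (_ : finite_set (_ `|` _)); last first.
    by rewrite finite_setU; split; [exact: aA | exact: bA].
  move=> x /= abx; apply: contrapT => /not_orP[/negP/negPn ax /negP/negPn bx].
  by move: abx; rewrite [(a - b) x]/(a x - b x) rpredB.
- move=> a b /asboolP aA /asboolP bA; apply/asboolP.
  apply: sub_finite_set (_ : finite_set (_ `|` _)); last first.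
    by rewrite finite_setU; split; [exact: aA | exact: bA].
  move=> x /= abx; apply: contrapT => /not_orP[/negP/negPn ax /negP/negPn bx].
  by move: abx; rewrite [(a * b) x]/(a x * b x) rpredM.
Qed.
HB.instance Definition _ :=
  GRing.isSubringClosed.Build P is_adele is_adele_subring.

Record adele := Adele { adele_val : P; _ : adele_val \in is_adele }.
Local Notation A := adele.

HB.instance Definition _ := [isSub for adele_val].
HB.instance Definition _ := [Choice of A by <:].
HB.instance Definition _ :=
  GRing.SubChoice_isSubComPzRing.Build P is_adele A is_adele_subring.

(* The restricted product topology: a fundamental system of neighborhoods of 0
   is given by the products over x of the N x-th powers of the maximal ideals
   of the local rings of integers, with N x = 0 for almost all x. *)
Definition adele_open (U : set A) := forall a, U a -> exists N : place F -> nat,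
  finite_set [set x | N x != 0%N] /\
  forall b, (forall x, ((N x)%:Z%:E <= cval (adele_val b x - adele_val a x)%R)%E) -> U b.

Fact adele_openT : adele_open setT.
Proof.
move=> a _; exists (fun=> 0%N); split=> //.
rewrite (_ : [set _ | _] = set0) //.
by apply/seteqP; split=> x //=; rewrite eqxx.
Qed.

Fact adele_openI : setI_closed adele_open.
Proof.
move=> U V Uo Vo a [/Uo [N [Nfin NU]] /Vo [M [Mfin MV]]].
exists (fun x => maxn (N x) (M x)); split.
  apply: sub_finite_set (_ : finite_set (_ `|` _)); last first.
    by rewrite finite_setU; split; [exact: Nfin | exact: Mfin].
  move=> x /= NMx; apply: contrapT => /not_orP[/negP/negPn/eqP Nx /negP/negPn/eqP Mx].
  by move: NMx; rewrite Nx Mx.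
move=> b ab; split; [apply: NU | apply: MV] => x; apply: le_trans (ab x);
  by rewrite lee_fin lez_nat ?leq_maxl ?leq_maxr.
Qed.

Fact adele_open_bigU (I : Type) (f : I -> set A) :
  (forall i, adele_open (f i)) -> adele_open (\bigcup_i f i).
Proof.
move=> fo a [i _ /fo [N [Nfin Nf]]]; exists N; split=> // b /Nf fib.
by exists i.
Qed.
HB.instance Definition _ :=
  isOpenTopological.Build A adele_openT adele_openI adele_open_bigU.

End Adeles.

(* the function field of the projective line over k *)
Notation ratfun k := {fraction {poly k}}.

Lemma frac_numden (R : idomainType) (a : {fraction R}) :
  exists n d : R, d != 0 /\ a * tofrac d = tofrac n.
Proof.
have [r ->] : exists r : {ratio R}, a = (\pi_(FracField.type R) r)%qT.
  by exists (repr a); rewrite reprK.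
exists (frac r).1, (frac r).2; split; first exact: denom_ratioP.
unlock tofrac; rewrite -[LHS]FracField.pi_mul; apply/eqmodP.
rewrite /= /FracField.mulf FracField.equivfE !numden_Ratio
  ?(oner_eq0, mulf_neq0, denom_ratioP) //.
by rewrite !mulr1 mulrC.
Qed.

Lemma frac_numden_neq0 (R : idomainType) (a : {fraction R}) : a != 0 ->
  exists n d : R, [/\ n != 0, d != 0 & a * tofrac d = tofrac n].
Proof.
move=> a0; have [n [d [d0 adn]]] := frac_numden a; exists n, d; split=> //.
by rewrite -tofrac_eq0 -adn mulf_neq0 // tofrac_eq0.
Qed.

Section PrincipalAdeles.
Variable k : finFieldType.
Local Notation F := (ratfun k).
Implicit Types (x y : place F) (p f g : {poly k}).

Lemma pval_fin (F0 : fieldType) (z : place F0) a :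
  a != 0 -> pval z a = (fine (pval z a))%:E.
Proof.
move=> a0; have := pval_neqNy z a; have := pval_eqy z a; rewrite (negPf a0).
by case: (pval z a).
Qed.

Local Notation w x f := (fine (pval x (tofrac f))).

Lemma poly_val x f : f != 0 -> pval x (tofrac f) = (w x f)%:E.
Proof. by move=> f0; apply: pval_fin; rewrite tofrac_eq0. Qed.

Lemma poly_valM x f g : f != 0 -> g != 0 -> w x (f * g) = w x f + w x g.
Proof.
move=> f0 g0; apply: EFin_inj; rewrite EFinD -!poly_val ?mulf_neq0//.
by rewrite tofracM pvalM.
Qed.

Lemma poly_valX x f n : f != 0 -> w x (f ^+ n) = w x f *+ n.
Proof.
move=> f0; elim: n => [|n IH]; first by rewrite expr0 tofrac1 pval1.
by rewrite exprS poly_valM ?expf_neq0// IH mulrS.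
Qed.

Lemma poly_valC x (c : k) : c != 0 -> pval x (tofrac c%:P) = 0%E.
Proof.
move=> c0; have cP0 : c%:P != 0 by rewrite polyC_eq0.
rewrite poly_val//; congr EFin; apply/eqP.
have k1 := finNzRing_gt1 k.
have /eqP := poly_valX x (#|k|.-1) cP0.
have -> : c%:P ^+ #|k|.-1 = 1.
  rewrite -rmorphXn /=; congr polyC; apply: (mulfI c0).
  by rewrite -exprS prednK ?expf_card ?mulr1 // ltnW.
rewrite tofrac1 pval1 eq_sym /= mulrn_eq0.
by case: #|k| k1 => [//|[]].
Qed.

Lemma place_eq_poly x y : (forall f, f != 0 -> w x f = w y f) -> x = y.
Proof.
move=> xy; have E : pval x = pval y.
  apply/funext => a; have [->|a0] := eqVneq a 0; first by rewrite !pval0.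
  have [n [d [n0 d0 adn]]] := frac_numden_neq0 a0.
  have ax z : fine (pval z a) = w z n - w z d.
    apply/eqP; rewrite eq_sym subr_eq; apply/eqP/EFin_inj.
    by rewrite EFinD -!poly_val // -pval_fin // -adn pvalM.
  by rewrite (pval_fin x a0) (pval_fin y a0) !ax !xy.
case: x y E {xy} => [v v1 v2 v3 v4] [v' v1' v2' v3' v4'] /= E.
by case: _ / E in v1' v2' v3' v4' *; congr Place; exact: Prop_irrelevance.
Qed.

Lemma pval_surj_poly x : exists f g, [/\ f != 0, g != 0 & w x f = w x g + 1].
Proof.
have [a xa] := pval_surj x.
have a0 : a != 0 by rewrite -(pval_eqy x) xa.
have [n [d [n0 d0 adn]]] := frac_numden_neq0 a0.
exists n, d; split=> //; apply: EFin_inj.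
by rewrite EFinD -!poly_val // -adn pvalM xa addeC.
Qed.

Lemma poly_val_ge0 x f : (0 <= pval x (tofrac 'X))%E -> (0 <= pval x (tofrac f))%E.
Proof.
move=> X0; elim/poly_ind: f => [|f c f0]; first by rewrite tofrac0 pval0 leey.
rewrite tofracD tofracM; apply: pval_leD.
  by rewrite -[0%R](addr0 0); apply: pval_leM.
have [->|c0] := eqVneq c 0; first by rewrite polyC0 tofrac0 pval0 leey.
by rewrite poly_valC.
Qed.

Let place_at p x := [/\ p != 0, (0 < pval x (tofrac p))%E &
  forall g, ~~ (p %| g) -> pval x (tofrac g) = 0%E].

Let place_at_inj p x y : place_at p x -> place_at p y -> x = y.
Proof.
move=> [p0 px xg] [_ py yg].
have p1 : (1 < size p)%N.
  rewrite ltnNge; apply/negP => /size1_polyC pE.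
  by move: px p0; rewrite pE polyC_eq0 => + c0; rewrite poly_valC.
have fact f : f != 0 -> exists m : nat, forall z,
    pval z (tofrac p) != 0%E -> (forall g, ~~ (p %| g) -> pval z (tofrac g) = 0%E) ->
    w z f = w z p *+ m.
  have [s] := ubnP (size f); elim: s f => // s IH f fs f0.
  have [/dvdpP[g fE]|pf] := boolP (p %| f); last first.
    by exists 0%N => z _ zg; rewrite mulr0n zg.
  have g0 : g != 0 by apply: contra_neq f0 => g0; rewrite fE g0 mul0r.
  have [|//|m Hm] := IH g.
    move: fs p1; rewrite fE size_mul //; case: (size p) => [|[|l]] // + _.
    by rewrite !addnS /= ltnS; apply: leq_trans; rewrite ltnS leq_addr.
  by exists m.+1 => z z1 z2; rewrite fE poly_valM // Hm // -mulrSr.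
have p_1 z : (0 < pval z (tofrac p))%E ->
    (forall g, ~~ (p %| g) -> pval z (tofrac g) = 0%E) -> w z p = 1.
  move=> zp zg; have zp0 : pval z (tofrac p) != 0%E by rewrite gt_eqF.
  have [f [g [f0 g0]]] := pval_surj_poly z.
  have [m ->] := fact f f0 => //; have [m' ->] := fact g g0 => //.
  move: zp; rewrite poly_val // lte_fin => zp E.
  have : (w z p %| 1)%Z.
    apply/dvdzP; exists (m%:R - m'%:R).
    by rewrite mulrBl !mulr_natl E addrC addKr.
  by rewrite dvdz1 => /eqP p1z; rewrite -[LHS]gtz0_abs // p1z.
apply: place_eq_poly => f f0; have [m Hm] := fact f f0.
by rewrite !Hm ?gt_eqF // !p_1.
Qed.

Let place_infty_inj x y : (pval x (tofrac 'X) < 0)%E ->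
  (pval y (tofrac 'X) < 0)%E -> x = y.
Proof.
have key z : (pval z (tofrac 'X) < 0)%E ->
    forall f, f != 0 -> w z f = - (size f).-1%:R.
  move=> zX.
  have zf f : f != 0 -> w z f = w z 'X *+ (size f).-1.
    elim/poly_ind: f => [|f c IH]; first by rewrite eqxx.
    have [->|f0] := eqVneq f 0.
      rewrite mul0r add0r polyC_eq0 => c0.
      by rewrite poly_valC // size_polyC c0 mulr0n.
    move=> _; have X0 : 'X != 0 :> {poly k} by rewrite polyX_eq0.
    have fX : w z (f * 'X) = w z 'X *+ size f.
      rewrite poly_valM // IH // -mulrSr prednK //.
      by rewrite size_poly_gt0.
    rewrite size_MXaddC (negPf f0) /= -fX; congr fine.
    rewrite tofracD; apply: (@pval_stable _ z 0).
      rewrite poly_val ?mulf_neq0 // fX lte_fin pmulrn_llt0 ?size_poly_gt0 //.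
      by rewrite -lte_fin -poly_val.
    rewrite addrAC subrr add0r.
    have [->|c0] := eqVneq c 0; first by rewrite polyC0 tofrac0 pval0 leey.
    by rewrite poly_valC.
  suff X1 : w z 'X = -1 by move=> f f0; rewrite zf // X1 mulNrn.
  have [f [g [f0 g0]]] := pval_surj_poly z.
  rewrite (zf f f0) (zf g g0) => E.
  move: zX; rewrite poly_val ?polyX_eq0 // lte_fin => zX.
  have : (w z 'X %| 1)%Z.
    apply/dvdzP; exists ((size f).-1%:R - (size g).-1%:R).
    by rewrite mulrBl !mulr_natl E addrC addKr.
  rewrite dvdz1 => /eqP X1; rewrite -[LHS]opprK; congr (- _).
  by rewrite -ltz0_abs // X1.
by move=> xX yX; apply: place_eq_poly => f f0; rewrite !key.
Qed.

Let finite_subsingleton (T : Type) (S : set T) :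
  (forall s t, S s -> S t -> s = t) -> finite_set S.
Proof.
move=> S1; have [[s Ss]|noS] := pselect (exists s, S s).
  by apply: sub_finite_set (finite_set1 s) => t St; apply: S1.
rewrite (_ : S = set0) //; apply/seteqP; split=> // t St.
by apply: noS; exists t.
Qed.

Lemma finite_poles (a : F) : finite_set [set x : place F | ~~ (0 <= pval x a)%E].
Proof.
have [->|a0] := eqVneq a 0.
  rewrite (_ : [set _ | _] = set0) //.
  by apply/seteqP; split=> x //=; rewrite pval0 leey.
have [n [d [n0 d0 adn]]] := frac_numden_neq0 a0.
pose small := [set p : {poly k} | (size p <= size d)%N].
have small_fin : finite_set small.
  pose s := size d.
  apply: sub_finite_set (_ : finite_set
    [set \poly_(i < s) (t 0 (inord i)) | t in [set: 'rV[k]_s.+1]]).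
    move=> p /= ps; exists (\row_i p`_i) => //.
    apply/polyP => i; rewrite coef_poly mxE; case: ltnP => [ips|spi].
      by rewrite inordK // ltnW.
    by rewrite nth_default // (leq_trans ps).
  by apply: finite_image; exact: finite_finset.
apply: sub_finite_set (_ : finite_set ([set x | (pval x (tofrac 'X) < 0)%E] `|`
  \bigcup_(p in small) [set x | place_at p x])); last first.
  rewrite finite_setU; split.
    by apply: finite_subsingleton => x y /=; exact: place_infty_inj.
  apply: bigcup_finite => // p _.
  by apply: finite_subsingleton => x y /=; exact: place_at_inj.
move=> x /= ax; have [Xx|Xx] := ltP (pval x (tofrac 'X)) 0%E; first by left.
right.
have dx : (0 < pval x (tofrac d))%E.
  rewrite lt_neqAle poly_val_ge0 // andbT; apply/eqP => dx0.
  have xan : pval x a = pval x (tofrac n) by rewrite -adn pvalM -dx0 adde0.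
  by move: ax; rewrite xan poly_val_ge0.
have ex : exists s, `[< exists p,
    [/\ p != 0, (0 < pval x (tofrac p))%E & size p = s] >].
  by exists (size d); apply/asboolP; exists d.
have [s /asboolP [p [p0 px ps]] smin] := ex_minnP ex.
exists p; first by rewrite /small /= ps; apply: smin; apply/asboolP; exists d.
split=> // g pg; have r0 : g %% p != 0 by [].
have rx : pval x (tofrac (g %% p)) = 0%E.
  apply/eqP; rewrite eq_le poly_val_ge0 // andbT leNgt; apply/negP => rx.
  have /smin : `[< exists q, [/\ q != 0, (0 < pval x (tofrac q))%E
      & size q = size (g %% p)] >] by apply/asboolP; exists (g %% p).
  by rewrite leqNgt -ps ltn_modp p0.
rewrite -rx; apply: (@pval_stable _ x 1); first by rewrite rx lte_fin.
rewrite -tofracB {1}(divp_eq g p) addrK tofracM -[1%R](add0r 1).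
apply: pval_leM; first exact: poly_val_ge0.
by move: px; rewrite poly_val // lte_fin lee_fin -gtz0_ge1.
Qed.

Fact diag_subproof (c : F) : full_diag c \in @is_adele F.
Proof.
apply/asboolP; apply: sub_finite_set (finite_poles c) => x /=.
apply: contra => c0; apply/le_cval_pi; exact: nearW.
Qed.

Definition diag (c : F) : adele F := Adele (diag_subproof c).

Fact diag_is_zmod_morphism : zmod_morphism diag.
Proof. by move=> a b; apply/val_inj; rewrite /= rmorphB. Qed.
HB.instance Definition _ :=
  GRing.isZmodMorphism.Build F (adele F) diag diag_is_zmod_morphism.

Fact diag_is_monoid_morphism : monoid_morphism diag.
Proof. by split=> [|a b]; apply/val_inj; rewrite /= (rmorph1, rmorphM). Qed.
HB.instance Definition _ :=
  GRing.isMonoidMorphism.Build F (adele F) diag diag_is_monoid_morphism.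

End PrincipalAdeles.

(* GL_n(A), with the topology induced by g |-> (g, g^-1) from M_n(A) x M_n(A) *)
Record GLA (F : fieldType) (n : nat) := MkGLA {
  glmx : 'M[adele F]_n;
  glinv : 'M[adele F]_n;
  glmxV : glmx *m glinv = 1%:M;
  glVmx : glinv *m glmx = 1%:M }.

Section AdelicGroup.
Variables (F : fieldType) (n : nat).
Local Notation A := (adele F).
Local Notation G := (GLA F n).

HB.instance Definition _ := gen_eqMixin G.
HB.instance Definition _ := gen_choiceMixin G.

Lemma glmx_inj : injective (@glmx F n).
Proof.
move=> [g g' gV Vg] [h h' hV Vh] /= gh.
have gh' : g' = h' by rewrite -[g']mulmx1 -hV -gh mulmxA Vg mul1mx.
by case: _ / gh in hV Vh *; case: _ / gh' in hV Vh *; congr MkGLA;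
  exact: Prop_irrelevance.
Qed.

Definition gl1 : G := MkGLA (mulmx1 1%:M) (mulmx1 1%:M).

Definition glV (g : G) : G := MkGLA (glVmx g) (glmxV g).

Fact glM_subproof (g h : G) :
  glmx g *m glmx h *m (glinv h *m glinv g) = 1%:M /\
  glinv h *m glinv g *m (glmx g *m glmx h) = 1%:M.
Proof.
by split; rewrite mulmxA; [rewrite -(mulmxA (glmx g)) glmxV mulmx1 glmxV
  | rewrite -(mulmxA (glinv h)) glVmx mulmx1 glVmx].
Qed.

Definition glM (g h : G) : G :=
  MkGLA (proj1 (glM_subproof g h)) (proj2 (glM_subproof g h)).

Fact glMA : associative glM.
Proof. by move=> g h k; apply: glmx_inj; rewrite /= mulmxA. Qed.
Fact gl1M : left_id gl1 glM.
Proof. by move=> g; apply: glmx_inj; rewrite /= mul1mx. Qed.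
Fact glM1 : right_id gl1 glM.
Proof. by move=> g; apply: glmx_inj; rewrite /= mulmx1. Qed.
Fact glVM : left_inverse gl1 glV glM.
Proof. by move=> g; apply: glmx_inj; rewrite /= glVmx. Qed.
Fact glMV : right_inverse gl1 glV glM.
Proof. by move=> g; apply: glmx_inj; rewrite /= glmxV. Qed.
HB.instance Definition _ := isGroup.Build G glMA gl1M glM1 glVM glMV.

HB.instance Definition _ := isPointed.Build G gl1.

Definition gl_pair (g : G) : 'M[A]_n * 'M[A]_n := (glmx g, glinv g).
HB.instance Definition _ := Topological.copy G (initial_topology gl_pair).

End AdelicGroup.

Lemma glinvE (F : fieldType) (n : nat) (g : GLA F n) (M : 'M[adele F]_n) : M *m glmx g = 1%:M -> glinv g = M.
Proof. by move=> Mg; rewrite -[glinv g]mul1mx -Mg -mulmxA glmxV mulmx1. Qed.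

Section Center.
Variables (F : fieldType) (n : nat).
Local Notation G := (GLA F n).

(* Z(A) *)
Definition center_pts : set G := [set g | exists a : adele F, glmx g = a%:M].

Lemma center_ptsV (g : G) : center_pts g -> center_pts (g^-1)%g.
Proof.
move=> [a ga]; rewrite /center_pts /=.
case: n g ga => [|m] g ga; first by exists 0; rewrite [RHS]flatmx0 [LHS]flatmx0.
exists (glinv g ord0 ord0); change (glinv g = (glinv g ord0 ord0)%:M);
  apply: glinvE; rewrite ga -scalar_mxM.
have := congr1 (fun M : 'M[adele F]_m.+1 => M ord0 ord0) (glVmx g).
by rewrite ga mul_mx_scalar !mxE mulrC => ->.
Qed.

End Center.

Section Subgroups.
Variables (F : fieldType) (n : nat).
Local Notation G := (GLA F n).

Record subgroup := Subgroup {
  sgset :> set G;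
  sg1 : sgset 1%g;
  sgM : forall g h, sgset g -> sgset h -> sgset (g * h)%g;
  sgV : forall g, sgset g -> sgset (g^-1)%g }.

Definition sgtype (S : subgroup) : Type := set_type (sgset S).

Section SubgroupType.
Variable S : subgroup.
HB.instance Definition _ := Topological.copy (sgtype S) (set_type (sgset S)).
HB.instance Definition _ :=
  isPointed.Build (sgtype S) (exist _ 1%g (mem_set (sg1 S)) : sgtype S).
Definition sgval (s : sgtype S) : G := set_val (s : set_type (sgset S)).
End SubgroupType.

Definition sgcoset (H : subgroup) (t : G) : set G := [set (h * t)%g | h in H].

(* H\S, with the quotient topology *)
Record sgquot (H S : subgroup) := SgQuot {
  sgquot_set :> set G;
  sgquot_setP : exists2 t, sgset S t & sgquot_set = sgcoset H t }.

Section SubgroupQuotient.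
Variables H S : subgroup.
Local Notation Q := (sgquot H S).

HB.instance Definition _ := gen_eqMixin Q.
HB.instance Definition _ := gen_choiceMixin Q.
HB.instance Definition _ := isPointed.Build Q
  (SgQuot (ex_intro2 _ _ 1%g (sg1 S) (erefl (sgcoset H 1%g)))).

Definition sgproj (t : sgtype S) : Q :=
  SgQuot (ex_intro2 _ _ (sgval t) (set_valP t) (erefl (sgcoset H (sgval t)))).

Definition sgrepr (c : Q) : G := xget 1%g (sgquot_set c).

Definition sgquot_open (U : set Q) := open (sgproj @^-1` U).

Fact sgquot_openT : sgquot_open setT.
Proof. by rewrite /sgquot_open preimage_setT; exact: openT. Qed.
Fact sgquot_openI : setI_closed sgquot_open.
Proof. by move=> U V Uo Vo; rewrite /sgquot_open preimage_setI; exact: openI. Qed.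
Fact sgquot_open_bigU (I : Type) (f : I -> set Q) :
  (forall i, sgquot_open (f i)) -> sgquot_open (\bigcup_i f i).
Proof.
move=> fo; rewrite /sgquot_open preimage_bigcup.
by apply: bigcup_open => i _; exact: fo.
Qed.
HB.instance Definition _ :=
  isOpenTopological.Build Q sgquot_openT sgquot_openI sgquot_open_bigU.

End SubgroupQuotient.
End Subgroups.

Definition borel (T : ptopologicalType) := g_sigma_algebraType (@open T).

Section Haar.
Variables (R : realType) (F : fieldType) (n : nat).
Implicit Types H S : @subgroup F n.

(* S is second countable and locally compact whenever this is used, so that
   finiteness on compact sets entails regularity. *)
Definition is_haar S (mu : {measure set (borel (sgtype S)) -> \bar R}) :=
  [/\ forall s (B : set (borel (sgtype S))), sgset S s -> measurable B ->
        mu [set t | exists2 b, B b & sgval t = (s * sgval b)%g] = mu B,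
      forall C : set (sgtype S), compact C -> (mu C < +oo)%E
    & forall U : set (sgtype S), open U -> U !=set0 -> (0 < mu U)%E].

(* Weil's formula *)
Definition is_quotient_measure H S
    (muS : {measure set (borel (sgtype S)) -> \bar R})
    (muH : {measure set (borel (sgtype H)) -> \bar R})
    (mu : {measure set (borel (sgquot H S)) -> \bar R}) :=
  forall phi : GLA F n -> R,
    continuous (phi \o @sgval F n S : sgtype S -> R) ->
    compact (closure [set s : sgtype S | phi (sgval s) != 0]) ->
    (\int[muS]_s (phi (sgval s))%:E =
     \int[mu]_c \int[muH]_h (phi (sgval h * sgrepr c)%g)%:E)%E.

End Haar.

Section Torus.
Variables (k : finFieldType) (E : fieldExtType (ratfun k)) (n : nat).
Variables (b : n.-tuple E) (bE : basis_of {:E} b).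
Local Notation F := (ratfun k).
Local Notation G := (GLA F n).

(* the matrix of multiplication by e, acting on column vectors *)
Definition regmx (e : E) : 'M[F]_n := \matrix_(i, j) coord b i (e * b`_j).

Lemma regmx1 : regmx 1 = 1%:M.
Proof.
by apply/matrixP => i j; rewrite !mxE mul1r coord_free ?(basis_free bE) 1?eq_sym.
Qed.

Lemma regmxM e f : regmx (e * f) = regmx e *m regmx f.
Proof.
apply/matrixP => i j; rewrite !mxE.
rewrite -mulrA {1}(coord_basis bE (memvf (f * b`_j))) mulr_sumr linear_sum.
by apply: eq_bigr => l _; rewrite !mxE -scalerAr linearZ /= mulrC.
Qed.

Lemma regmx_coord e : regmx e = \sum_l coord b l e *: regmx b`_l.
Proof.
apply/matrixP => i j; rewrite !mxE summxE.
rewrite {1}(coord_basis bE (memvf e)) mulr_suml linear_sum.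
by apply: eq_bigr => l _; rewrite !mxE -scalerAl linearZ.
Qed.

(* the image of A (x)_F E in M_n(A) *)
Definition regalg : set 'M[adele F]_n :=
  [set M | exists a : 'I_n -> adele F,
           M = \sum_l a l *: map_mx (@diag k) (regmx b`_l)].

Lemma regalg_sum (I : Type) (r : seq I) (M : I -> 'M[adele F]_n) :
  (forall i, regalg (M i)) -> regalg (\sum_(i <- r) M i).
Proof.
move=> MP; elim/big_ind: _ => //.
  by exists (fun=> 0); rewrite big1 // => l _; rewrite scale0r.
move=> _ _ [a ->] [a' ->]; exists (fun l => a l + a' l).
by rewrite -big_split; apply: eq_bigr => l _; rewrite scalerDl.
Qed.

Lemma regalgZ a M : regalg M -> regalg (a *: M).
Proof.
move=> [c ->]; exists (fun l => a * c l).
by rewrite scaler_sumr; apply: eq_bigr => l _; rewrite scalerA.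
Qed.

Lemma regalg_diag e : regalg (map_mx (@diag k) (regmx e)).
Proof.
exists (fun l => diag (coord b l e)).
rewrite {1}regmx_coord; apply/matrixP => i j; rewrite !mxE !summxE rmorph_sum.
by apply: eq_bigr => l _; rewrite !mxE rmorphM.
Qed.

Lemma regalgM M N : regalg M -> regalg N -> regalg (M *m N).
Proof.
move=> [a ->] [c ->]; rewrite mulmx_suml; apply: regalg_sum => l.
rewrite mulmx_sumr; apply: regalg_sum => m.
rewrite -scalemxAl -scalemxAr -map_mxM -regmxM.
by do 2 apply: regalgZ; exact: regalg_diag.
Qed.

(* T(A), as the unit group of the algebra A (x)_F E *)
Definition torus_pts : set G := [set g | regalg (glmx g) /\ regalg (glinv g)].

(* T(F), which is the image of E^* *)
Definition torus_rat : set G :=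
  [set g | exists2 e : E, e != 0 & glmx g = map_mx (@diag k) (regmx e)].

Definition torus_rat_center : set G :=
  [set (g * z)%g | g in torus_rat & z in @center_pts F n].

Fact torus_pts1 : torus_pts 1%g.
Proof.
have : regalg 1%:M by rewrite -(map_mx1 (@diag k)) -regmx1; exact: regalg_diag.
by split.
Qed.
Fact torus_ptsM g h : torus_pts g -> torus_pts h -> torus_pts (g * h)%g.
Proof. by move=> [g1 g2] [h1 h2]; split; exact: regalgM. Qed.
Fact torus_ptsV g : torus_pts g -> torus_pts (g^-1)%g.
Proof. by case. Qed.
Definition torus : subgroup F n := Subgroup torus_pts1 torus_ptsM torus_ptsV.

Fact torus_rat_center1 : torus_rat_center 1%g.
Proof.
exists 1%g; first by exists 1; rewrite ?oner_neq0 // regmx1 map_mx1.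
by exists 1%g; [exists 1 | rewrite mulg1].
Qed.
Fact torus_rat_centerM g h : torus_rat_center g -> torus_rat_center h ->
  torus_rat_center (g * h)%g.
Proof.
move=> [t [e e0 te] [z [a za] <-]] [t' [e' e'0 te'] [z' [a' za'] <-]].
exists (t * t')%g.
  by exists (e * e'); rewrite ?mulf_neq0 //= te te' regmxM map_mxM.
exists (z * z')%g; first by exists (a * a'); rewrite /= za za' scalar_mxM.
apply: glmx_inj; rewrite /= za za' -!mulmxA; congr (_ *m _).
by rewrite !mulmxA; congr (_ *m _); rewrite scalar_mxC.
Qed.
Fact torus_rat_centerV g : torus_rat_center g -> torus_rat_center (g^-1)%g.
Proof.
move=> [t [e e0 te] [z Zz <-]].
exists (t^-1)%g.
  exists e^-1; rewrite ?invr_eq0 //; apply: glinvE.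
  by rewrite te -map_mxM -regmxM mulVf // regmx1 map_mx1.
exists (z^-1)%g; first exact: center_ptsV.
have [c zc] := center_ptsV Zz.
by apply: glmx_inj; rewrite /= (zc : glinv z = _) scalar_mxC.
Qed.
Definition torus_cent : subgroup F n :=
  Subgroup torus_rat_center1 torus_rat_centerM torus_rat_centerV.

End Torus.

(* An F-basis of E, with Haar measures on T(A) and T(F)Z(A) and the quotient
   measure on T(F)Z(A)\T(A). *)
Record torus_datum (R : realType) (k : finFieldType) (n : nat)
    (E : fieldExtType (ratfun k)) := TorusDatum {
  td_basis : n.-tuple E;
  td_basisP : basis_of {:E} td_basis;
  td_haarT : {measure set (borel (sgtype (torus td_basisP))) -> \bar R};
  td_haarTP : is_haar td_haarT;
  td_haarZ : {measure set (borel (sgtype (torus_cent td_basisP))) -> \bar R};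
  td_haarZP : is_haar td_haarZ;
  td_mu : {measure set (borel (sgquot (torus_cent td_basisP)
                                      (torus td_basisP))) -> \bar R};
  td_muP : is_quotient_measure td_haarT td_haarZ td_mu }.

Section Automorphic.
Variables (R : realType) (k : finFieldType) (n : nat).
Local Notation F := (ratfun k).
Local Notation G := (GLA F n).
Implicit Types (f : G -> R[i]) (g h : G).

Definition gl_rat : set G :=
  [set g | exists2 M : 'M[F]_n, M \in unitmx & glmx g = map_mx (@diag k) M].

Definition gl_int : set G := [set g | forall i j (x : place F),
  adele_val (glmx g i j) x \in @cint F x /\
  adele_val (glinv g i j) x \in @cint F x].

Definition pgl_invariant f := forall g0 z g h,
  gl_rat g0 -> center_pts z -> gl_int h -> f (g0 * z * g * h)%g = f g.

Definition height (g : G) : R :=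
  (\big[*%R/1]_(x \in [set: place F])
    \big[Num.max/0]_(i < n) \big[Num.max/0]_(j < n)
      Num.max (cabs R (adele_val (glmx g i j) x))
              (cabs R (adele_val (glinv g i j) x)))%R.

Definition moderate_growth f := exists (c : R) (N : nat),
  forall g, complex.Re `|f g| <= c * height g ^+ N.

Definition hecke_algebra : set (G -> R[i]) := [set Phi |
  (forall h g h', gl_int h -> gl_int h' -> Phi (h * g * h')%g = Phi g) /\
  compact (closure [set g | Phi g != 0])].

(* (Phi f)(g), the integral over h in GL_n(A) of Phi(h) f(gh), for the Haar
   measure giving volume 1 to K = GL_n(O_A); since the integrand is right
   K-invariant, it is a sum over GL_n(A)/K. *)
Definition hecke_act (Phi f : G -> R[i]) : G -> R[i] := fun g =>
  \sum_(C \in [set [set (h * u)%g | u in gl_int] | h in [set: G]])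
    Phi (xget 1%g C) * f (g * xget 1%g C)%g.

Definition admissible f := exists (m : nat) (v : 'I_m -> G -> R[i]),
  forall Phi, hecke_algebra Phi -> exists a : 'I_m -> R[i],
    forall g, hecke_act Phi f g = \sum_(i < m) a i * v i g.

Definition automorphic : set (G -> R[i]) :=
  [set f | [/\ pgl_invariant f, moderate_growth f & admissible f]].

Definition toroidal_integral (E : fieldExtType F) (D : torus_datum R n E)
    f (g : G) : R[i] :=
  (\int[td_mu D]_c complex.Re (f (sgrepr c * g)%g) +i*
   \int[td_mu D]_c complex.Im (f (sgrepr c * g)%g))%C.

Definition A_tor_ext (E : fieldExtType F) (D : torus_datum R n E) :
  set (G -> R[i]) :=
  [set f | automorphic f /\ forall g, toroidal_integral D f g = 0].

Definition torus_data := forall E : fieldExtType F,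
  separable 1 {:E} -> \dim {:E} = n -> torus_datum R n E.

Definition A_tor (D : torus_data) : set (G -> R[i]) :=
  [set f | forall (E : fieldExtType F) (sepE : separable 1 {:E})
                  (dimE : \dim {:E} = n), A_tor_ext (D E sepE dimE) f].

(* E is the composite of F and a field with #|k| ^ n elements. *)
Definition const_ext (E : fieldExtType F) := \dim {:E} = n /\
  exists (L : finFieldType) (iota : {rmorphism L -> E}),
    #|L| = (#|k| ^ n)%N /\ <<1 & [seq iota c | c : L]>>%VS = {:E}%VS.

End Automorphic.

(* Main.v *)
From HB Require Import structures.
From mathcomp Require Import fingroup perm.
From mathcomp Require Import all_boot all_order all_algebra all_field.
From mathcomp Require Import all_classical all_reals all_analysis.
From mathcomp Require Import complex ring zify.
Require Import Defs.

(** Write [K = GL_n(O_A)] and let [twist^lam] be the diagonal matrix with entries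
    [X^(- lam_i)] at the infinite place and 1 at the others.  A minimal basis of
    the lattice attached to [g] (Grothendieck's splitting of vector bundles on the
    projective line) shows that [g] lies in [GL_n(F) twist^mu K] for some [mu].
    If [g = t twist^lam] with [t] in [K], then [mu] is more balanced than [lam],
    strictly so unless [mu] is a permutation of [lam].

    As [E] has a basis over [F] with constant structure constants, the same
    reduction inside [E] gives [T(A) = T(F) Z(A) V] with [V] the intersection of
    [T(A)] and [p K p^-1] for some [p] in [GL_n(F)].  Hence the values of [f] on
    [T(A) p twist^lam] are values on [K twist^lam]; by induction on [lam] each of
    them is 0 or [f (twist^lam)], so the toroidal integral at [p twist^lam] is
    [f (twist^lam)] times the volume of a set that is open, nonempty and
    relatively compact.  So [f] vanishes at every [twist^lam], thus everywhere. *)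

Set Implicit Arguments.
Unset Strict Implicit.
Unset Printing Implicit Defensive.

Import Order.TTheory GRing.Theory Num.Theory.
Import numFieldNormedType.Exports.
Local Open Scope classical_set_scope.
Local Open Scope ring_scope.

(** * Places of the rational function field *)

Section PlacesOfRationalFunctions.
Variable k : finFieldType.
Local Notation F := (ratfun k).
Implicit Types (x y : place F) (p f g : {poly k}).

Local Notation w x f := (fine (pval x (tofrac f))).

(** The integrand takes only the values 0 and [f (twist^lam)], so nothing can cancel: once the set
    where it is nonzero has positive finite measure, a vanishing integral forces
    [f (twist^lam) = 0]. The quotient measure is known only through Weil's formula for continuous
    functions of compact support; therefore the set is pulled back to T(A) and cut with the clopen
    group [V], which makes its indicator a legitimate test function. The induction is well founded
    because the center shifts [lam] to natural numbers, and because the sums of max(0, z - lam_i),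
    for z up to a fixed bound, decrease weakly and determine [lam] up to permutation. The basis in a
    torus datum is arbitrary, whereas structure constants lie in the finite field only for special
    bases; [p] is the change of basis, and [f] ignores it on the left since it is rational.
    Compactness comes from ultrafilters: limits exist at each place because the residue rings are
    finite, and integrality at all places at once assembles them into adeles. *)

Lemma size_gt0 f : f != 0 -> (0 < size f)%N.
Proof. by rewrite size_poly_gt0. Qed.

Lemma size_mulE h f g : f != 0 -> g != 0 -> h = f * g ->
  [/\ size h = (size f + size g).-1, (0 < size f)%N & (0 < size g)%N].
Proof. by move=> f0 g0 ->; rewrite size_mul // !size_poly_gt0. Qed.

Lemma dvdp_size_le f g : f %| g -> g != 0 -> (size f <= size g)%N.
Proof. by move=> fg /dvdp_leq; apply. Qed.

Lemma dvdp_ex p f : p %| f -> exists q : {poly k}, f = q * p.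
Proof. by move=> /dvdpP. Qed.

Lemma intMn (v : int) m : v *+ m = v * m%:Z.
Proof. by rewrite -mulr_natr natz. Qed.

Lemma num_neq0 (b : F) d f : b != 0 -> d != 0 -> b * tofrac d = tofrac f -> f != 0.
Proof.
move=> b0 d0 E; apply: contra_neq b0 => f0; have : b * tofrac d = 0.
  by rewrite E f0 tofrac0.
by move=> /eqP; rewrite mulf_eq0 tofrac_eq0 (negPf d0) orbF => /eqP.
Qed.

(** A fraction receives the difference of the values at a chosen numerator and denominator;
    multiplicativity of [v] makes this independent of the choice. *)
Lemma place_of_poly_val (v : {poly k} -> int) :
  (forall f g, f != 0 -> g != 0 -> v (f * g) = v f + v g) ->
  (forall f g, f != 0 -> g != 0 -> f + g != 0 -> Num.min (v f) (v g) <= v (f + g)) ->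
  (exists f g, [/\ f != 0, g != 0 & v f = v g + 1]) ->
  exists x : place F, forall f, f != 0 -> pval x (tofrac f) = (v f)%:E.
Proof.
move=> vM vD [f1 [g1 [f10 g10 vS]]].
have numden (a : F) : exists nd : {poly k} * {poly k},
    a != 0 -> [/\ nd.1 != 0, nd.2 != 0 & a * tofrac nd.2 = tofrac nd.1].
  have [->|a0] := eqVneq a 0; first by exists (0, 0).
  by have [m [d H]] := frac_numden_neq0 a0; exists (m, d).
have [nd ndP] := choice numden.
pose val (a : F) : \bar int := if a == 0 then +oo%E else (v (nd a).1 - v (nd a).2)%:E.
have valE (a : F) m d : m != 0 -> d != 0 -> a * tofrac d = tofrac m ->
    val a = (v m - v d)%:E.
  move=> m0 d0 adm; have a0 : a != 0.
    by apply: contra_neq m0 => a0; apply/eqP; rewrite -tofrac_eq0 -adm a0 mul0r.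
  rewrite /val (negPf a0); have [m'0 d'0 adm'] := ndP _ a0.
  congr EFin; apply/eqP; rewrite subr_eq addrAC eq_sym subr_eq -!vM //.
  apply/eqP; congr (v _); apply/eqP; rewrite -tofrac_eq; apply/eqP; rewrite !tofracM -adm -adm'.
  by rewrite mulrAC.
have val0 a : (val a == +oo%E) = (a == 0) by rewrite /val; case: ifP.
have valM a b : val (a * b) = (val a + val b)%E.
  have [->|a0] := eqVneq a 0.
    rewrite mul0r {1 2}/val eqxx addye //.
    by rewrite /val; case: ifP.
  have [->|b0] := eqVneq b 0.
    rewrite mulr0 {1 3}/val eqxx addey //.
    by rewrite /val; case: ifP.
  have [m0 d0 E] := ndP _ a0; have [m0' d0' E'] := ndP _ b0.
  rewrite (valE _ _ _ m0 d0 E) (valE _ _ _ m0' d0' E') -EFinD.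
  rewrite (valE _ ((nd a).1 * (nd b).1) ((nd a).2 * (nd b).2)) ?mulf_neq0 //.
    by rewrite !vM //; congr EFin; ring.
  by rewrite !tofracM -E -E' mulrACA.
have valD a b : (Order.min (val a) (val b) <= val (a + b)%R)%E.
  have [->|a0] := eqVneq a 0; first by rewrite add0r ge_min lexx orbT.
  have [->|b0] := eqVneq b 0; first by rewrite addr0 ge_min lexx.
  have [ab0|ab0] := eqVneq (a + b) 0; first by rewrite {3}/val ab0 eqxx leey.
  have [m0 d0 E] := ndP _ a0; have [m0' d0' E'] := ndP _ b0.
  set m := (nd a).1 in m0 E *; set d := (nd a).2 in d0 E *.
  set m' := (nd b).1 in m0' E' *; set d' := (nd b).2 in d0' E' *.
  have Eab : (a + b) * tofrac (d * d') = tofrac (m * d' + m' * d).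
    rewrite tofracD !tofracM -E -E'; ring.
  have s0 : m * d' + m' * d != 0.
    exact: num_neq0 ab0 (mulf_neq0 d0 d0') Eab.
  rewrite (valE _ _ _ m0 d0 E) (valE _ _ _ m0' d0' E').
  rewrite (valE _ _ _ s0 _ Eab) ?mulf_neq0 //.
  have := vD _ _ (mulf_neq0 m0 d0') (mulf_neq0 m0' d0) s0.
  rewrite (vM _ _ m0 d0') (vM _ _ m0' d0) (vM _ _ d0 d0') 2!ge_min !lee_fin.
  have arith (i i' j j' l : int) : (i + j' <= l) || (i' + j <= l) ->
    (i - j <= l - (j + j')) || (i' - j' <= l - (j + j')) by lia.
  exact: arith.
have valS : exists a, val a = 1%E.
  exists (tofrac f1 / tofrac g1); rewrite (valE _ f1 g1) //.
    by rewrite vS addrAC subrr add0r.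
  by rewrite divfK // tofrac_eq0.
exists (Place val0 valM valD valS) => f f0 /=.
rewrite (valE _ f 1) ?oner_neq0 ?tofrac1 ?mulr1 //.
have := vM 1 1 (oner_neq0 _) (oner_neq0 _); rewrite mulr1 => /eqP.
by rewrite eq_sym -subr_eq0 addrK => /eqP ->; rewrite subr0.
Qed.

Lemma infinite_place_exists : exists x, (pval x (tofrac 'X) < 0)%E.
Proof.
have [||| x xE] := @place_of_poly_val (fun f => - ((size f).-1)%:Z).
- by move=> f g f0 g0; have [->] := size_mulE f0 g0 erefl; lia.
- move=> f g f0 g0 fg0; have := size_polyD f g.
  by have := (size_gt0 f0, size_gt0 g0, size_gt0 fg0) => -[[]]; lia.
- exists 1, 'X; rewrite oner_neq0 polyX_eq0; split=> //.
  by rewrite size_poly1 size_polyX.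
by exists x; rewrite xE ?polyX_eq0 // size_polyX.
Qed.

Lemma polyX_multP p f : (1 < size p)%N -> f != 0 ->
  exists mg : nat * {poly k}, f = p ^+ mg.1 * mg.2 /\ ~~ (p %| mg.2).
Proof.
move=> p1; have p0 : p != 0 by rewrite -size_poly_gt0 ltnW.
have [s] := ubnP (size f); elim: s f => // s IH f fs f0.
have [/dvdp_ex[g fE]|pf] := boolP (p %| f); last first.
  by exists (0%N, f); rewrite /= expr0 mul1r.
have g0 : g != 0 by apply: contra_neq f0 => g0; rewrite fE g0 mul0r.
have [|//|[m h] /= [gE ph]] := IH g.
  by have [] := size_mulE g0 p0 fE; move: fs p1; lia.
by exists (m.+1, h); rewrite /= exprS -mulrA -gE mulrC.
Qed.

(* [p] is a prime polynomial generating the maximal ideal of [x]. *)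
Definition place_gen x p := [/\ (1 < size p)%N, pval x (tofrac p) = 1%E &
  forall g, ~~ (p %| g) -> pval x (tofrac g) = 0%E].

(** The place is the [p]-adic valuation, with exponents read off a chosen factorization
    [p ^+ m * h]. By Euclid's lemma [p] does not divide a product of two such cofactors, so
    exponents add. *)
Lemma irreducible_place p : irreducible_poly p ->
  exists2 x, place_gen x p & (0 <= pval x (tofrac 'X))%E.
Proof.
move=> pI; have p0 := irredp_neq0 pI; have p1 : (1 < size p)%N by case: pI.
have mgex f : exists mg : nat * {poly k},
    f != 0 -> f = p ^+ mg.1 * mg.2 /\ ~~ (p %| mg.2).
  have [->|f0] := eqVneq f 0; first by exists (0%N, 0).
  by have [mg H] := polyX_multP p1 f0; exists mg.
have [mg mgP] := choice mgex.
have dvdN f g : ~~ (p %| f) -> ~~ (p %| g) -> ~~ (p %| f * g).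
  by move=> pf pg; rewrite Gauss_dvdpr // irreducible_poly_coprime.
have dvdX m h (j : nat) : ~~ (p %| h) -> (p ^+ j %| p ^+ m * h) -> (j <= m)%N.
  move=> ph; rewrite leqNgt; apply: contraL => mj; apply: contra ph.
  rewrite -(subnK mj) addnS exprS exprD mulrA [p ^+ m * h]mulrC.
  rewrite dvdp_mul2r ?expf_neq0 //.
  by apply: dvdp_trans; rewrite dvdp_mulr.
have uniqm f m h : f != 0 -> f = p ^+ m * h -> ~~ (p %| h) -> (mg f).1 = m.
  move=> f0 fE ph; have [fE' ph'] := mgP f f0; apply/eqP; rewrite eqn_leq.
  apply/andP; split.
    by apply: (dvdX m h _ ph); apply/dvdpP; exists (mg f).2; rewrite -fE mulrC.
  by apply: (dvdX (mg f).1 (mg f).2 _ ph'); apply/dvdpP; exists h; rewrite -fE' mulrC.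
have [||| x xE] := @place_of_poly_val (fun f => ((mg f).1)%:Z).
- move=> f g f0 g0; have [fE pf] := mgP f f0; have [gE pg] := mgP g g0.
  rewrite (uniqm _ ((mg f).1 + (mg g).1)%N ((mg f).2 * (mg g).2)) ?mulf_neq0 //.
    by rewrite {1}fE {1}gE exprD mulrACA.
  exact: dvdN.
- move=> f g f0 g0 fg0; have [fE pf] := mgP f f0; have [gE pg] := mgP g g0.
  have [fgE pfg] := mgP _ fg0; rewrite ge_min !lez_nat -geq_min.
  apply: (dvdX _ _ _ pfg); rewrite -fgE; apply: dvdp_add.
    by rewrite [X in _ %| X]fE dvdp_mulr // dvdp_exp2l // geq_minl.
  by rewrite [X in _ %| X]gE dvdp_mulr // dvdp_exp2l // geq_minr.
- exists p, 1; rewrite p0 oner_neq0; split=> //.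
  rewrite (uniqm p 1%N 1) ?(uniqm 1 0%N 1) ?oner_neq0 ?expr1 ?mulr1 //;
  by rewrite dvdp1 gtn_eqF.
have xg g : ~~ (p %| g) -> pval x (tofrac g) = 0%E.
  move=> pg; have g0 : g != 0 by apply: contra pg => /eqP ->; rewrite dvdp0.
  by rewrite xE // (uniqm g 0%N g) ?expr0 ?mul1r.
exists x; last by rewrite xE ?polyX_eq0 // lee_fin.
split=> //; rewrite xE // (uniqm p 1%N 1) ?expr1 ?mulr1 //.
by rewrite dvdp1 gtn_eqF.
Qed.

Lemma place_gen_ge0 x p : place_gen x p -> (0 <= pval x (tofrac 'X))%E.
Proof.
move=> [p1 xp xg]; have [pX|/xg -> //] := boolP (p %| 'X).
have p0 : p != 0 by rewrite -size_poly_gt0 ltnW.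
have /dvdp_ex [q XE] := pX.
have pq : ~~ (p %| q).
  apply: contraTN isT => pq.
  have q0 : q != 0 by apply: contra_eqN XE => /eqP ->; rewrite mul0r polyX_eq0.
  have := dvdp_size_le pq q0; have [] := size_mulE q0 p0 XE.
  by rewrite size_polyX; move: p1; lia.
by rewrite XE [tofrac _]tofracM pvalM xp (xg _ pq).
Qed.

Lemma place_gen_le0 x p f : place_gen x p -> (0 < pval x (tofrac f))%E -> p %| f.
Proof. by move=> [_ _ xg]; apply: contraTT => /xg ->; rewrite ltxx. Qed.

(** Take [p] of least size among the polynomials of positive valuation: a nonzero remainder modulo
    [p] then has valuation 0. The valuation of [p] divides all values, and since 1 is attained it
    equals 1. *)
Lemma finite_place_gen x : (0 <= pval x (tofrac 'X))%E -> exists p, place_gen x p.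
Proof.
move=> xX.
have [f [g [f0 g0 fg]]] := pval_surj_poly x.
have wg g' : g' != 0 -> 0 <= w x g'.
  by move=> g'0; rewrite -lee_fin -poly_val //; exact: poly_val_ge0.
have ex : exists s, `[< exists p,
    [/\ p != 0, (0 < pval x (tofrac p))%E & size p = s] >].
  exists (size f); apply/asboolP; exists f; split=> //.
  by rewrite poly_val // lte_fin fg; have := wg g g0; lia.
have [s /asboolP [p [p0 px ps]] smin] := ex_minnP ex.
have xg h : ~~ (p %| h) -> pval x (tofrac h) = 0%E.
  move=> ph; have r0 : h %% p != 0 by [].
  have rx : pval x (tofrac (h %% p)) = 0%E.
    apply/eqP; rewrite eq_le poly_val_ge0 // andbT leNgt; apply/negP => rx.
    have /smin : `[< exists q, [/\ q != 0, (0 < pval x (tofrac q))%E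
        & size q = size (h %% p)] >] by apply/asboolP; exists (h %% p).
    by rewrite leqNgt -ps ltn_modp p0.
  rewrite -rx; apply: (@pval_stable _ x 1); first by rewrite rx lte_fin.
  rewrite -tofracB {1}(divp_eq h p) addrK tofracM -[1%R](add0r 1).
  apply: pval_leM; first exact: poly_val_ge0.
  by move: px; rewrite poly_val // lte_fin lee_fin -gtz0_ge1.
have p1 : (1 < size p)%N.
  rewrite ltnNge; apply/negP => /size1_polyC pE.
  by move: px p0; rewrite pE polyC_eq0 => + c0; rewrite poly_valC.
exists p; split=> //.
have fact h : h != 0 -> exists m : nat, w x h = w x p *+ m.
  move=> h0; have [[m l] /= [-> pl]] := polyX_multP p1 h0; exists m.
  have l0 : l != 0 by apply: contra pl => /eqP ->; rewrite dvdp0.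
  by rewrite poly_valM ?expf_neq0 // poly_valX // (xg _ pl) addr0.
move: px fg; rewrite poly_val // lte_fin.
have [m ->] := fact f f0; have [m' ->] := fact g g0.
move: (w x p) => v; rewrite 2!intMn => v0 E; congr EFin.
have vm : v * (m%:Z - m'%:Z) = 1 by rewrite mulrBr E; ring.
have : (v %| 1)%Z by apply/dvdzP; exists (m%:Z - m'%:Z); rewrite mulrC.
by rewrite dvdz1 => /eqP; move: v0; clear; lia.
Qed.

Lemma place_gen_inj x y p : place_gen x p ->
  (0 <= pval y (tofrac 'X))%E -> (0 < pval y (tofrac p))%E -> y = x.
Proof.
move=> xp y0 yp; have [p' yp'] := finite_place_gen y0.
have [p1 xp1 xg] := xp; have [p'1 yp'1 yg] := yp'.
have /dvdp_ex [q pE] := place_gen_le0 yp' yp.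
have p0 : p != 0 by rewrite -size_poly_gt0 ltnW.
have p'0 : p' != 0 by rewrite -size_poly_gt0 ltnW.
have q0 : q != 0 by apply: contra_neq p0 => q0; rewrite pE q0 mul0r.
have pq : ~~ (p %| q).
  apply/negP => /dvdp_size_le/(_ q0); have [] := size_mulE q0 p'0 pE.
  by move: p'1; lia.
have xp'1 : pval x (tofrac p') = 1%E.
  by rewrite -xp1 pE tofracM pvalM (xg _ pq) add0e.
have pp' : p %| p' by apply: (place_gen_le0 xp); rewrite xp'1.
have p'p : p' %| p by rewrite pE dvdp_mull.
apply: place_eq_poly => f f0; have [[m h] /= [-> ph]] := polyX_multP p'1 f0.
have h0 : h != 0 by apply: contra ph => /eqP ->; rewrite dvdp0.
rewrite !poly_valM ?expf_neq0 // !poly_valX // xp'1 yp'1 (yg _ ph) xg //.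
by apply: contra ph; exact: dvdp_trans.
Qed.

(** As ['X] has a pole at [x], the top degree term dominates the others, so all values are multiples
    of that of ['X]; surjectivity makes the latter -1. *)
Lemma infinite_place_val x f : (pval x (tofrac 'X) < 0)%E -> f != 0 ->
  pval x (tofrac f) = (- ((size f).-1)%:Z)%:E.
Proof.
move=> xX f0; have X0 : 'X != 0 :> {poly k} by rewrite polyX_eq0.
have v0 : w x 'X < 0 by rewrite -lte_fin -poly_val.
have key h : h != 0 -> w x h = w x 'X *+ (size h).-1.
  elim/poly_ind: h => [|h c IH]; first by rewrite eqxx.
  have [->|h0] := eqVneq h 0.
    rewrite mul0r add0r polyC_eq0 => c0.
    by rewrite poly_valC // size_polyC c0 mulr0n.
  move=> _; have hX : w x (h * 'X) = w x 'X *+ size h.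
    by rewrite poly_valM // IH // -mulrSr prednK // size_poly_gt0.
  rewrite size_MXaddC (negPf h0) /= -hX; congr fine.
  rewrite tofracD; apply: (@pval_stable _ x 0).
    by rewrite poly_val ?mulf_neq0 // hX lte_fin pmulrn_llt0 ?size_poly_gt0.
  rewrite addrAC subrr add0r.
  have [->|c0] := eqVneq c 0; first by rewrite polyC0 tofrac0 pval0 leey.
  by rewrite poly_valC.
have [g [h [g0 h0]]] := pval_surj_poly x.
rewrite (poly_val _ f0) (key _ f0) (key _ g0) (key _ h0).
move: (w x 'X) v0 => v v0; rewrite 3!intMn.
set a := (size g).-1; set b := (size h).-1 => E; congr EFin.
have vab : v * (a%:Z - b%:Z) = 1 by rewrite mulrBr E; ring.
have : (v %| 1)%Z by apply/dvdzP; exists (a%:Z - b%:Z); rewrite mulrC.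
move=> v1; suff -> : v = -1 by rewrite mulN1r.
by move: v1 v0; rewrite dvdz1 => /eqP; clear; lia.
Qed.

Lemma infinite_place_uniq x y : (pval x (tofrac 'X) < 0)%E ->
  (pval y (tofrac 'X) < 0)%E -> x = y.
Proof.
move=> xX yX; apply: place_eq_poly => f f0.
by rewrite (infinite_place_val xX f0) (infinite_place_val yX f0).
Qed.

(** An irreducible factor [p] of the denominator defines a finite place, at which integrality forces
    [p] to divide the numerator as well; cancel it and repeat. *)
Lemma integral_is_poly (a : F) :
  (forall x, (0 <= pval x (tofrac 'X))%E -> (0 <= pval x a)%E) ->
  exists f, a = tofrac f.
Proof.
move=> aI; have [m [d [d0]]] := frac_numden a.
have [s] := ubnP (size d); elim: s m d d0 => // s IH m d d0 ds adm.
have [d1|] := leqP (size d) 1.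
  have dE := size1_polyC d1; have c0 : d`_0 != 0 by rewrite -polyC_eq0 -dE.
  exists ((d`_0)^-1 *: m); apply: (@mulIf _ (tofrac d)); rewrite ?tofrac_eq0 //.
  rewrite adm -tofracM; congr tofrac.
  by rewrite [X in _ * X]dE mulrC mul_polyC scalerA mulfV // scale1r.
move=> d1.
have [p [p1 pd pI]] : exists p, [/\ (1 < size p)%N, p %| d & irreducible_poly p].
  (* A nonconstant divisor of least size is irreducible. Row vectors encode the polynomials of
     bounded size, which makes the search a boolean statement. *)
  have ex : exists s, [exists q : 'rV[k]_(size d), (1 < size (rVpoly q))%N
      && (rVpoly q %| d) && (size (rVpoly q) == s)].
    exists (size d); apply/existsP; exists (poly_rV d).
    by rewrite poly_rV_K // d1 dvdpp eqxx.
  have [j /existsP[q /andP[/andP[q1 qd] /eqP qs]] jmin] := ex_minnP ex.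
  exists (rVpoly q); split=> //; split=> // r r1 rq.
  have rd : r %| d by apply: dvdp_trans qd.
  have q0 : rVpoly q != 0 by rewrite -size_poly_gt0 ltnW.
  have r0 : r != 0 by apply: contraTneq rq => ->; rewrite dvd0p.
  rewrite -dvdp_size_eqp // eqn_leq dvdp_leq // qs jmin //.
  apply/existsP; exists (poly_rV r); rewrite poly_rV_K ?dvdp_leq //.
  by rewrite rd eqxx !andbT; move: r1 r0; rewrite -size_poly_gt0; case: size => [|[]].
have [x xp xX] := irreducible_place pI.
have p0 : p != 0 := irredp_neq0 pI.
have pm : p %| m.
  apply: (place_gen_le0 xp); rewrite -adm pvalM.
  have [q dE] := dvdpP _ _ pd; have [_ xp1 _] := xp.
  rewrite dE tofracM pvalM xp1; apply: (@lt_le_trans _ _ (0 + (0 + 1))%E).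
    by rewrite !add0e.
  by apply: leeD; [exact: aI | apply: leeD => //; exact: poly_val_ge0].
have /dvdp_ex [m' mE] := pm; have /dvdp_ex [d' dE] := pd.
have d'0 : d' != 0 by apply: contra_neq d0 => d'0; rewrite dE d'0 mul0r.
apply: (IH m' d') => //.
  have [E _ _] := size_mulE d'0 p0 dE; move: ds p1; rewrite E.
  by clear; case: (size p) => [//|[//|j]]; rewrite addnS; move: (size d'); lia.
apply: (@mulIf _ (tofrac p)); first by rewrite tofrac_eq0.
by rewrite -mulrA -!tofracM -dE -mE.
Qed.

(** The part [d'] of the denominator prime to [p] is inverted modulo [p] by a Bezout relation; this
    makes [a] congruent to a polynomial, which is then reduced modulo [p]. *)
Lemma residue_finite_place x p a : place_gen x p -> (0 <= pval x a)%E ->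
  exists r : {poly k}, (size r < size p)%N /\ (1 <= pval x (a - tofrac r))%E.
Proof.
move=> xp; have [p1 xp1 xg] := xp; have xX := place_gen_ge0 xp.
have p0 : p != 0 by rewrite -size_poly_gt0 ltnW.
have [->|a0] := eqVneq a 0.
  by exists 0; rewrite size_poly0 tofrac0 subr0 pval0 leey ltnW.
have [m [d [m0 d0 adm]]] := frac_numden_neq0 a0.
have [[i m'] /= [mE pm']] := polyX_multP p1 m0.
have [[j d'] /= [dE pd']] := polyX_multP p1 d0.
move=> xa0.
have ij : (j <= i)%N.
  have := congr1 (pval x) adm; rewrite pvalM mE dE !tofracM !pvalM.
  rewrite (xg _ pm') (xg _ pd') !adde0 !tofracXn.
  have valp l : pval x (tofrac p ^+ l) = (l%:Z)%:E.
    rewrite -tofracXn poly_val ?expf_neq0 // poly_valX // xp1 /= ?natz //.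
  rewrite !valp; move: xa0; rewrite (pval_fin x a0) lee_fin => xa0 [] E.
  by move: xa0; rewrite -lez_nat -E; lia.
(* [place_gen] does not record irreducibility, so coprimality is drawn from valuations: the gcd has
   valuation 0, hence its cofactor in [p] has valuation 1 and is divisible by [p], which leaves a
   constant gcd. *)
have co : coprimep p d'.
  have : size (gcdp p d') == 1.
    have gp := dvdp_gcdl p d'; have gd := dvdp_gcdr p d'.
    set g := gcdp p d' in gp gd *.
    have d'0 : d' != 0 by apply: contra pd' => /eqP ->; rewrite dvdp0.
    have xg0 : pval x (tofrac g) = 0%E.
      apply/eqP; rewrite eq_le poly_val_ge0 // andbT.
      have /dvdp_ex [q E] := gd; rewrite -(xg _ pd') E tofracM pvalM.
      by rewrite leeDr // poly_val_ge0.
    have /dvdp_ex [q E] := gp.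
    have xq : pval x (tofrac q) = 1%E.
      by rewrite -xp1 E tofracM pvalM xg0 adde0.
    have pq : p %| q by apply: (place_gen_le0 xp); rewrite xq.
    have q0 : q != 0 by apply: contra_neq p0 => q0; rewrite E q0 mul0r.
    have g0 : g != 0 by apply: contra_neq p0 => g0; rewrite E g0 mulr0.
    have := dvdp_size_le pq q0; have [] := size_mulE q0 g0 E.
    by clear; case: (size g) => [//|[//|j]]; rewrite addnS => ->; move: (size q); lia.
  by [].
have [[u v] /= uv] := Bezout_eq1_coprimepP _ _ co.
have d'F : tofrac d' != 0 :> F.
  by rewrite tofrac_eq0; apply: contra pd' => /eqP ->; rewrite dvdp0.
have aE : a = tofrac (p ^+ (i - j) * m') / tofrac d'.
  apply: (@mulIf _ (tofrac d)); first by rewrite tofrac_eq0.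
  rewrite adm dE mE -{1}(subnK ij) exprD !tofracM.
  have fieldE (K : fieldType) (A B C D : K) : D != 0 ->
      A * B * C = A * C / D * (B * D) by move=> ?; field.
  exact: fieldE.
set h := p ^+ (i - j) * m' * v.
exists (h %% p); rewrite ltn_modp p0; split=> //.
rewrite -(subrK (tofrac h) a) -addrA; apply: pval_leD.
  have -> : a - tofrac h = tofrac (p ^+ (i - j) * m' * (u * p)) / tofrac d'.
    rewrite aE /h; apply: (@mulIf _ (tofrac d')) => //.
    rewrite mulrBl !divfK // -tofracM -tofracB; congr tofrac.
    have BezoutE (R : comPzRingType) (A B C D E : R) : C * D + B * E = 1 ->
      A - A * B * E = A * (C * D) by move=> H; rewrite -[X in X - _]mulr1 -H; ring.
    exact: BezoutE.
  have xd' : pval x (tofrac d')^-1 = 0%E.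
    have := pvalM x (tofrac d') (tofrac d')^-1.
    by rewrite mulfV // pval1 (xg _ pd') add0e.
  rewrite pvalM xd' adde0 tofracM pvalM (tofracM u p) (pvalM x (tofrac u)) xp1.
  apply: (@le_trans _ _ (0 + (0 + 1))%E); first by rewrite !add0e.
  by apply: leeD; [|apply: leeD => //]; exact: poly_val_ge0.
rewrite -tofracB {1}(divp_eq h p) addrK tofracM pvalM xp1.
apply: (@le_trans _ _ (0 + 1)%E); first by rewrite add0e.
by apply: leeD => //; exact: poly_val_ge0.
Qed.

Lemma residue_infinite_place x a : (pval x (tofrac 'X) < 0)%E ->
  (0 <= pval x a)%E -> exists c : k, (1 <= pval x (a - tofrac c%:P))%E.
Proof.
move=> xX; have [->|a0] := eqVneq a 0.
  by exists 0; rewrite polyC0 tofrac0 subr0 pval0 leey.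
have [m [d [m0 d0 adm]]] := frac_numden_neq0 a0 => xa.
have md : (size m <= size d)%N.
  have := congr1 (pval x) adm.
  rewrite pvalM (infinite_place_val xX m0) (infinite_place_val xX d0).
  move: xa; rewrite (pval_fin x a0) lee_fin => xa [].
  have le_of (v : int) (i j : nat) : (0 < i)%N -> (0 < j)%N -> 0 <= v ->
    v + - (j.-1)%:Z = - (i.-1)%:Z -> (i <= j)%N by lia.
  exact: le_of (size_gt0 m0) (size_gt0 d0) xa.
(* The value of [a] at infinity: subtracting [c *: d] removes the coefficient of [m] in the degree
   of [d], and this coefficient is 0 when [m] has smaller degree. *)
pose c := m`_(size d).-1 / lead_coef d; exists c.
have [->|ac0] := eqVneq (a - tofrac c%:P) 0; first by rewrite pval0 leey.
have E : (a - tofrac c%:P) * tofrac d = tofrac (m - c *: d).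
  by rewrite mulrBl adm -tofracM mul_polyC tofracB.
have r0 : m - c *: d != 0.
  exact: num_neq0 ac0 d0 E.
have := congr1 (pval x) E.
rewrite pvalM (infinite_place_val xX r0) (infinite_place_val xX d0).
rewrite (pval_fin x ac0) lee_fin => -[].
have : (size (m - c *: d)%R < size d)%N.
  rewrite -[X in (_ < X)%N]prednK ?size_poly_gt0 // ltnS.
  apply/leq_sizeP => j; rewrite leq_eqVlt => /orP[/eqP <-|jd].
    by rewrite coefB coefZ /c divfK ?lead_coef_eq0 // subrr.
  rewrite coefB coefZ !nth_default ?mulr0 ?subr0 //.
    by rewrite -(prednK (n := size d)) // size_poly_gt0.
  by rewrite (leq_trans md) // -(prednK (n := size d)) // size_poly_gt0.
have arith (v : int) (i j : nat) : (0 < i)%N -> (i < j)%N ->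
  v + - (j.-1)%:Z = - (i.-1)%:Z -> 1 <= v by lia.
exact: arith (size_gt0 r0).
Qed.

End PlacesOfRationalFunctions.

(** * Completions and limits along ultrafilters *)

Section LocalFields.
Variables (F : fieldType) (x : place F).
Implicit Types (a b : F) (xi eta : completion x) (N P : int).

Definition vge N xi : Prop := (N%:E <= cval xi)%E.

Lemma vge_le N P xi : P <= N -> vge N xi -> vge P xi.
Proof. by move=> PN; apply: le_trans; rewrite lee_fin. Qed.

Lemma vge_piE N (u : cauchy x) :
  vge N (\pi_(completion x) u)%qT <-> \forall i \near \oo, (N%:E <= x (u i))%E.
Proof. exact: le_cval_pi. Qed.

Lemma vge_emb N a : vge N (completion_emb x a) <-> (N%:E <= x a)%E.
Proof.
rewrite /completion_emb vge_piE; split=> [H|H]; last exact: nearW.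
by case: (filter_ex H).
Qed.

Lemma vge0 N : vge N 0.
Proof. by rewrite -(rmorph0 (completion_emb x)); apply/vge_emb; rewrite pval0 leey. Qed.

Lemma vgeD N xi eta : vge N xi -> vge N eta -> vge N (xi + eta).
Proof.
rewrite -[xi]reprK -[eta]reprK -rmorphD => /vge_piE H1 /vge_piE H2.
by apply/vge_piE; apply: filterS2 H1 H2 => i; exact: pval_leD.
Qed.

Lemma vgeN N xi : vge N (- xi) <-> vge N xi.
Proof.
have H eta : vge N eta -> vge N (- eta).
  rewrite -[eta]reprK -rmorphN => /vge_piE H; apply/vge_piE.
  by apply: filterS H => i; rewrite /= pvalN.
by split=> [/H|/H//]; rewrite opprK.
Qed.

Lemma vgeB N xi eta : vge N xi -> vge N eta -> vge N (xi - eta).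
Proof. by move=> ? ?; apply: vgeD => //; apply/vgeN. Qed.

Lemma vgeM N P xi eta : vge N xi -> vge P eta -> vge (N + P) (xi * eta).
Proof.
rewrite -[xi]reprK -[eta]reprK -rmorphM => /vge_piE H1 /vge_piE H2.
by apply/vge_piE; apply: filterS2 H1 H2 => i; exact: pval_leM.
Qed.

Lemma vgeMl P xi eta : vge 0 xi -> vge P eta -> vge P (xi * eta).
Proof. by rewrite -{2}[P]add0r; exact: vgeM. Qed.

Lemma vgeMr P xi eta : vge P xi -> vge 0 eta -> vge P (xi * eta).
Proof. by rewrite -{2}[P]addr0; exact: vgeM. Qed.

Lemma vge1 : vge 0 1.
Proof. by rewrite -(rmorph1 (completion_emb x)); apply/vge_emb; rewrite pval1. Qed.

Lemma vge_sum (I : Type) (r : seq I) (Q : pred I) (xi_ : I -> completion x) N :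
  (forall i, Q i -> vge N (xi_ i)) -> vge N (\sum_(i <- r | Q i) xi_ i).
Proof. by move=> H; elim/big_ind: _ => //; [exact: vge0 | exact: vgeD]. Qed.

Lemma vge_prod (I : Type) (r : seq I) (xi_ : I -> completion x) (N_ : I -> int) :
  (forall i, vge (N_ i) (xi_ i)) -> vge (\sum_(i <- r) N_ i) (\prod_(i <- r) xi_ i).
Proof.
by move=> H; elim/big_ind2: _ => //; [exact: vge1 | move=> *; exact: vgeM].
Qed.

Lemma vge_eq0 xi : (forall N, vge N xi) -> xi = 0.
Proof.
move=> H; suff : (repr xi : cauchy x) \in @is_null F x.
  move=> u0; rewrite -[xi]reprK -(rmorph0 \pi_(completion x)%qT).
  by apply/eqP; rewrite -Quotient.idealrBE subr0.
apply/asboolP => N; apply/vge_piE.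
by rewrite reprK.
Qed.

Lemma vge_approx N xi : exists a, vge N (xi - completion_emb x a).
Proof.
have [M uM] := asboolP _ (valP (repr xi : cauchy x)) N.
exists ((repr xi : cauchy x) M); rewrite -{1}[xi]reprK /completion_emb -rmorphB.
by apply/vge_piE; exists M => // i /= Mi; exact: uM.
Qed.

Lemma vge_bounded xi : exists N, vge N xi.
Proof.
have [a ha] := vge_approx 0 xi; have [->|a0] := eqVneq xi 0.
  by exists 0; exact: vge0.
have [b ab] : exists N, vge N (completion_emb x a).
  have := pval_neqNy x a; case E : (x a) => [r| |] // _.
    by exists r; apply/vge_emb; rewrite E.
  by exists 0; apply/vge_emb; rewrite E leey.
exists (Num.min 0 b); rewrite -(subrK (completion_emb x a) xi); apply: vgeD.
  by apply: vge_le ha; rewrite ge_min lexx.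
by apply: vge_le ab; rewrite ge_min lexx orbT.
Qed.

(** The completion carries only a ring structure; the direct implication divides by [a] inside
    [F]. *)
Lemma vge_embM a (m : int) N xi : x a = m%:E ->
  vge N (completion_emb x a * xi) <-> vge (N - m) xi.
Proof.
move=> xa; have a0 : a != 0 by rewrite -(pval_eqy x) xa.
have xV : vge (- m) (completion_emb x a^-1).
  apply/vge_emb; have := pvalM x a a^-1; rewrite mulfV // pval1 xa.
  by have := pval_neqNy x a^-1; case: (x a^-1) => [r _ [rE]|_|//] //; rewrite lee_fin; lia.
split=> [H|H].
  have := vgeM xV H; rewrite mulrA -rmorphM mulVf // rmorph1 mul1r.
  by apply: vge_le; rewrite addrC.
rewrite -[N](subrK m) addrC; apply: vgeM => //.
by apply/vge_emb; rewrite xa.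
Qed.

Lemma vge_complete (u : nat -> F) :
  (forall N, exists M, forall i j, (M <= i)%N -> (M <= j)%N ->
     (N%:E <= x (u i - u j)%R)%E) ->
  exists xi, forall N, exists M, forall i, (M <= i)%N ->
    vge N (xi - completion_emb x (u i)).
Proof.
move=> uC; have uP : u \in @is_cauchy F x by exact/asboolP.
exists (\pi_(completion x) (Cauchy uP))%qT => N.
have [M uM] := uC N; exists M => i Mi.
rewrite /completion_emb -rmorphB; apply/vge_piE; exists M => // j /= Mj.
exact: uM.
Qed.

End LocalFields.

(** Pigeonhole principle: an ultrafilter that contains a finite union contains one of its
    members. *)
Lemma ultra_seq (T : Type) (U : set_system T) (I : eqType) (s : seq I)
    (Q : I -> set T) : UltraFilter U ->
  U [set t | exists2 i, i \in s & Q i t] -> exists2 i, i \in s & U (Q i).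
Proof.
move=> UU; elim: s => [|i s IH] Us.
  by have [t []] := filter_ex Us.
have [Ui|Ui] := in_ultra_setVsetC (Q i) UU; first by exists i; rewrite ?mem_head.
have [|j js Uj] := IH; last by exists j; rewrite // inE js orbT.
apply: filterS2 Us Ui => t [j]; rewrite inE => /orP[/eqP -> //|js Qj _].
by exists j.
Qed.

(** * Finite residue rings and compactness of the local rings of integers *)

Section ResidueRings.
Variables (k : finFieldType) (x : place (ratfun k)).
Local Notation F := (ratfun k).

Lemma residue_seq : exists s : seq F, forall a, (0 <= x a)%E ->
  exists2 r, r \in s & (1 <= x (a - r)%R)%E.
Proof.
have [xX|xX] := ltP (x (tofrac 'X)) 0%E.
  exists [seq tofrac c%:P | c : k] => a /(residue_infinite_place xX) [c xc].
  by exists (tofrac c%:P) => //; apply/mapP; exists c; rewrite ?mem_enum.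
have [p xp] := finite_place_gen xX.
exists [seq tofrac (rVpoly v) | v : 'rV[k]_(size p)] => a.
move=> /(residue_finite_place xp) [r [rp xr]]; exists (tofrac r) => //.
have rE : r = rVpoly (poly_rV r : 'rV[k]_(size p)) by rewrite poly_rV_K // ltnW.
by apply/mapP; exists (poly_rV r : 'rV[k]_(size p)); rewrite ?mem_enum // -rE.
Qed.

(** Representatives are built digit by digit along the powers of a uniformizer. *)
Lemma residue_pow_seq (N : nat) : exists s : seq F, forall a, (0 <= x a)%E ->
  exists2 r, r \in s & (N%:Z%:E <= x (a - r)%R)%E.
Proof.
have [pi xpi] := pval_surj x; have [s1 s1P] := residue_seq.
have pi0 : pi != 0 by rewrite -(pval_eqy x) xpi.
have xpiX M : x (pi ^+ M) = (M%:Z)%:E.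
  elim: M => [|M IH]; first by rewrite expr0 pval1.
  by rewrite exprS pvalM xpi IH -EFinD intS.
have xpiV M : x (pi ^- M) = (- (M%:Z))%:E.
  have := pvalM x (pi ^+ M) (pi ^- M); rewrite mulfV ?expf_neq0 // pval1 xpiX.
  by case: (x (pi ^- M)) => // r [rE]; congr EFin; lia.
elim: N => [|N [s sP]].
  by exists [:: 0] => a xa; exists 0; rewrite ?mem_head // subr0.
exists [seq r + pi ^+ N * r' | r <- s, r' <- s1] => a /sP [r rs xr].
have [|r' r's xr'] := s1P (pi ^- N * (a - r)).
  by rewrite pvalM xpiV; have := leeD (lexx (- (N%:Z))%:E) xr; rewrite -EFinD addNr.
exists (r + pi ^+ N * r'); first by apply: allpairs_f.
have -> : a - (r + pi ^+ N * r') = pi ^+ N * (pi ^- N * (a - r) - r').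
  by rewrite mulrBr mulrA mulfV ?expf_neq0 // mul1r opprD addrA.
rewrite pvalM xpiX; have := leeD (lexx (N%:Z)%:E) xr'.
by rewrite -EFinD -PoszD addn1.
Qed.

(** Compactness of the ring of integers. Modulo each power of the maximal ideal the ultrafilter
    selects one of finitely many residues [c N]; any two of the selected sets meet, so [c] is a
    Cauchy sequence, and its limit is the limit of [a]. *)
Lemma ultra_cvg_integral (T : Type) (U : set_system T) (a : T -> completion x) :
  UltraFilter U -> U [set t | vge 0 (a t)] ->
  exists xi, vge 0 xi /\ forall N, U [set t | vge N (a t - xi)].
Proof.
move=> UU Ua.
have ex (N : nat) : exists c : F, U [set t | vge N%:Z (a t - completion_emb x c)].
  have [s sP] := residue_pow_seq N.
  have [|c _ Uc] := @ultra_seq T U _ s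
    (fun c => [set t | vge N%:Z (a t - completion_emb x c)]) UU; last by exists c.
  apply: filterS Ua => t at0; have [b ab] := vge_approx N%:Z (a t).
  have xb : (0 <= x b)%E.
    apply/vge_emb; rewrite -[completion_emb x b](subKr (a t)); apply: vgeB => //.
    by apply: vge_le ab.
  have [r rs xr] := sP b xb; exists r => //=.
  rewrite -(subrK (completion_emb x b) (a t)) -addrA -rmorphB.
  by apply: vgeD => //; apply/vge_emb.
have [c cP] := choice ex.
have [|xi xiP] := @vge_complete F x c.
  move=> N; exists `|N|%N => i j Ni Nj; apply/vge_emb.
  have [t [ti tj]] := filter_ex (filterI (cP i) (cP j)).
  have -> : completion_emb x (c i - c j) =
      (a t - completion_emb x (c j)) - (a t - completion_emb x (c i)).
    by rewrite rmorphB; ring.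
  by apply: vgeB; [apply: vge_le tj | apply: vge_le ti]; lia.
have Uxi N : U [set t | vge N (a t - xi)].
  have [M MP] := xiP N; apply: filterS (cP (maxn M `|N|)) => t /= ti.
  rewrite -(subrK (completion_emb x (c (maxn M `|N|))) (a t)) -addrA.
  apply: vgeD; first by apply: vge_le ti; lia.
  by rewrite -opprB; apply/vgeN; apply: MP; rewrite leq_maxl.
exists xi; split=> //.
have [t [t0 ti]] := filter_ex (filterI Ua (Uxi 0)).
by rewrite -(subKr (a t) xi); apply: vgeB.
Qed.

End ResidueRings.

(** * Lattices and reduced bases *)

Section LocalComponents.
Variables (F : fieldType) (x : place F).

Definition loc (a : adele F) : completion x := adele_val a x.

Fact loc_is_zmod_morphism : zmod_morphism loc.
Proof. by []. Qed.
HB.instance Definition _ :=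
  GRing.isZmodMorphism.Build (adele F) (completion x) loc loc_is_zmod_morphism.

Fact loc_is_monoid_morphism : monoid_morphism loc.
Proof. by []. Qed.
HB.instance Definition _ :=
  GRing.isMonoidMorphism.Build (adele F) (completion x) loc loc_is_monoid_morphism.

Definition mxge (m p : nat) (N : int) (M : 'M[completion x]_(m, p)) :=
  forall i j, vge N (M i j).

Lemma mxgeM (m p q : nat) (N P : int) (A : 'M[completion x]_(m, p))
    (B : 'M[completion x]_(p, q)) :
  mxge N A -> mxge P B -> mxge (N + P) (A *m B).
Proof.
by move=> NA PB i j; rewrite mxE; apply: vge_sum => l _; exact: vgeM.
Qed.

Lemma mxge_bounded (m p : nat) (M : 'M[completion x]_(m, p)) : exists N, mxge N M.
Proof.
have [N_ NP] := choice (fun ij : 'I_m * 'I_p => vge_bounded (M ij.1 ij.2)).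
exists (- \sum_ij `|N_ ij|) => i j; apply: vge_le (NP (i, j)).
rewrite (bigD1 (i, j)) //= opprD -[leRHS]addr0; apply: lerD.
  by rewrite lerNl -normrN ler_norm.
by rewrite oppr_le0 sumr_ge0.
Qed.

End LocalComponents.

Lemma adele_eqP (F : fieldType) (a b : adele F) : (forall x, loc x a = loc x b) -> a = b.
Proof. by move=> ab; apply/val_inj; exact: functional_extensionality_dep. Qed.

Lemma glmxM (F : fieldType) (n : nat) (g h : GLA F n) :
  glmx (g * h)%g = glmx g *m glmx h.
Proof. by []. Qed.

Lemma glinvM (F : fieldType) (n : nat) (g h : GLA F n) :
  glinv (g * h)%g = glinv h *m glinv g.
Proof. by []. Qed.

Lemma gl_int_vge (k : finFieldType) (n : nat) (g : GLA (ratfun k) n) :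
  gl_int g <-> forall x, mxge 0 (map_mx (loc x) (glmx g)) /\
                         mxge 0 (map_mx (loc x) (glinv g)).
Proof.
split=> [gI x|gI i j x].
  by split=> i j; rewrite mxE; have [] := gI i j x.
by have [/(_ i j) + /(_ i j)] := gI x; rewrite !mxE.
Qed.

Lemma replace_col_unitmx (K : fieldType) (n : nat) (c : 'cV[K]_n) i :
  c i ord0 != 0 -> exists2 C : 'M[K]_n, C \in unitmx &
    forall (M : 'M[K]_n) j, col j (M *m C) = if j == i then M *m c else col j M.
Proof.
move=> ci0; pose ei : 'cV[K]_n := delta_mx i ord0.
pose C : 'M[K]_n := 1%:M + (c - ei) *m ei^T.
have eiT m (v : 'M[K]_(n, m)) : ei^T *m v = row i v.
  by rewrite trmx_delta -rowE.
exists C => [|M j].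
  (* [C] is the identity with column [i] replaced by [c], a perturbation of rank one; this is its
     inverse by the Sherman-Morrison formula. *)
  have : C *m (1%:M - (c i ord0)^-1 *: ((c - ei) *m ei^T)) = 1%:M.
    rewrite /C mulmxDl mul1mx mulmxBr mulmx1 -scalemxAr -!mulmxA (mulmxA ei^T) eiT.
    rewrite [row i _]mx11_scalar !mxE !eqxx mul_scalar_mx -scalemxAr scalerA.
    set N := (c - ei) *m ei^T; rewrite -[X in _ + (X - _)]scale1r -scalerBl -addrA.
    rewrite -scaleNr -scalerDl [X in X *: N](_ : _ = 0) ?scale0r ?addr0 //.
    change (- (c i ord0)^-1 + (1 - (c i ord0)^-1 * (c i ord0 - 1)) = 0).
    by field.
  by case/mulmx1_unit.
rewrite !colE -mulmxA mulmxDl mul1mx -mulmxA eiT [row i _]mx11_scalar !mxE eqxx.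
rewrite andbT eq_sym mul_mx_scalar; case: eqP => [->|_]; last by rewrite scale0r addr0.
by rewrite scale1r addrC subrK.
Qed.

Section RationalPoints.
Variables (k : finFieldType) (n : nat).
Local Notation F := (ratfun k).
Local Notation G := (GLA F n).

Fact rat_mxV (M : 'M[F]_n) : M \in unitmx ->
  map_mx (@diag k) M *m map_mx (@diag k) (invmx M) = 1%:M.
Proof. by move=> MU; rewrite -map_mxM mulmxV // map_mx1. Qed.
Fact rat_Vmx (M : 'M[F]_n) : M \in unitmx ->
  map_mx (@diag k) (invmx M) *m map_mx (@diag k) M = 1%:M.
Proof. by move=> MU; rewrite -map_mxM mulVmx // map_mx1. Qed.

Definition rat_pt (M : 'M[F]_n) (MU : M \in unitmx) : G :=
  MkGLA (rat_mxV MU) (rat_Vmx MU).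

Lemma rat_ptP (M : 'M[F]_n) (MU : M \in unitmx) : gl_rat (rat_pt MU).
Proof. by exists M. Qed.

Lemma map_loc_diag x (m p : nat) (M : 'M[F]_(m, p)) :
  map_mx (loc x) (map_mx (@diag k) M) = map_mx (completion_emb x) M.
Proof. by apply/matrixP => i j; rewrite !mxE. Qed.

Definition inf (x : place F) : bool := (pval x (tofrac 'X) < 0)%E.

Lemma inf_X x (m : int) : inf x -> pval x (tofrac 'X ^ m) = (- m)%:E.
Proof.
move=> xI; have X0 : tofrac 'X != 0 :> F by rewrite tofrac_eq0 polyX_eq0.
have nat_case (j : nat) : pval x (tofrac 'X ^+ j) = (- (j%:Z))%:E.
  rewrite -tofracXn (infinite_place_val xI) ?expf_neq0 ?polyX_eq0 //.
  by rewrite size_polyXn.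
case: m => j; first exact: nat_case.
have := pvalM x (tofrac 'X ^+ j.+1) (tofrac 'X ^- j.+1).
rewrite mulfV ?expf_neq0 // pval1 nat_case NegzE.
change (tofrac 'X ^ (- j.+1%:Z)) with (tofrac 'X ^- j.+1 : F).
by case: (x (tofrac 'X ^- j.+1)) => // r [rE]; congr EFin; lia.
Qed.

Fact twist_subproof (m : int) :
  (fun x : place F => if inf x then completion_emb x (tofrac 'X ^ (- m)) else 1)
    \in @is_adele F.
Proof.
apply/asboolP; apply: sub_finite_set (finite_poles (tofrac 'X : F)) => x /=.
by apply: contra; rewrite leNgt -/(inf x) => /negPf ->; exact: vge1.
Qed.

(* the idele with component [X^-m] at the infinite place and 1 elsewhere *)
Definition twist m : adele F := Adele (twist_subproof m).

Lemma loc_twist x m :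
  loc x (twist m) = if inf x then completion_emb x (tofrac 'X ^ (- m)) else 1.
Proof. by []. Qed.

Lemma twistD m m' : twist m * twist m' = twist (m + m').
Proof.
apply: adele_eqP => x; change (loc x (twist m) * loc x (twist m') = loc x (twist (m + m'))).
rewrite 3!loc_twist; case: ifP => _.
  by rewrite -rmorphM opprD expfzDr // tofrac_eq0 polyX_eq0.
by rewrite mulr1.
Qed.

Lemma twist0 : twist 0 = 1.
Proof.
by apply: adele_eqP => x; rewrite loc_twist rmorph1; case: ifP => //; rewrite oppr0 expr0z rmorph1.
Qed.

Fact twist_mxV (d : 'I_n -> int) :
  diag_mx (\row_i twist (d i)) *m diag_mx (\row_i twist (- d i)) = 1%:M.
Proof.
apply/matrixP => i j; rewrite mul_diag_mx !mxE; case: eqP => [->|_].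
  by rewrite !mulr1n twistD addrN twist0.
by rewrite !mulr0n mulr0.
Qed.
Fact twist_Vmx (d : 'I_n -> int) :
  diag_mx (\row_i twist (- d i)) *m diag_mx (\row_i twist (d i)) = 1%:M.
Proof.
apply/matrixP => i j; rewrite mul_diag_mx !mxE; case: eqP => [->|_].
  by rewrite !mulr1n twistD addNr twist0.
by rewrite !mulr0n mulr0.
Qed.
Definition twist_pt (d : 'I_n -> int) : G := MkGLA (twist_mxV d) (twist_Vmx d).

(** At each of the finitely many finite places where [a] is not integral, a power of the generator
    suffices, and the factors coming from the other places are integral there. *)
Lemma clear_denominator (a : adele F) : exists2 D : {poly k}, D != 0 &
  forall x, ~~ inf x -> vge 0 (completion_emb x (tofrac D) * loc x a).
Proof.
have polyge x f : ~~ inf x -> vge 0 (completion_emb x (tofrac f)).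
  by move=> xF; apply/vge_emb/poly_val_ge0; rewrite leNgt.
have loc_clear x : exists2 D : {poly k}, D != 0 &
    ~~ inf x -> vge 0 (completion_emb x (tofrac D) * loc x a).
  have [xI|xF] := boolP (inf x); first by exists 1; rewrite ?oner_neq0.
  have [p xp] : exists p, place_gen x p.
    by apply: finite_place_gen; rewrite leNgt.
  have [p1 xp1 _] := xp; have p0 : p != 0 by rewrite -size_poly_gt0 ltnW.
  have [N aN] := vge_bounded (loc x a).
  exists (p ^+ `|N|%N); first by rewrite expf_neq0.
  move=> _; apply: (vge_le (N := `|N|%N%:Z + N)); first by lia.
  apply: vgeM => //; apply/vge_emb.
  by rewrite poly_val ?expf_neq0 // poly_valX // xp1 /= natz.
have /choice [D_ DP] : forall x, exists D : {poly k}, D != 0 /\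
    (~~ inf x -> vge 0 (completion_emb x (tofrac D) * loc x a)).
  by move=> x; have [D] := loc_clear x; exists D.
have /finite_seqP [s sE] := asboolP _ (valP a).
exists (\prod_(x <- s) D_ x) => [|x xF].
  by rewrite prodf_seq_neq0; apply/allP => x _; have [] := DP x.
have [xs|xs] := boolP (x \in s); last first.
  apply: vgeMl; first exact: polyge.
  suff : x \notin [set` s] by rewrite -sE notin_setE /= => /negP; rewrite negbK.
  by rewrite notin_setE /=; apply/negP.
rewrite (big_rem x) //= tofracM rmorphM mulrAC; apply: vgeMr; last exact: polyge.
by have [_] := DP x; apply.
Qed.

Lemma clear_denominators (m p : nat) (M : 'M[adele F]_(m, p)) :
  exists2 D : {poly k}, D != 0 & forall x, ~~ inf x ->
    mxge 0 (completion_emb x (tofrac D) *: map_mx (loc x) M).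
Proof.
have /choice [D_ DP] : forall ij, exists D : {poly k}, D != 0 /\ forall x,
    ~~ inf x -> vge 0 (completion_emb x (tofrac D) * loc x (M ij.1 ij.2)).
  by move=> ij; have [D D0 H] := clear_denominator (M ij.1 ij.2); exists D.
exists (\prod_ij D_ ij) => [|x xF i j].
  by apply/prodf_neq0 => ij _; have [] := DP ij.
have [_ /(_ x xF) /= H] := DP (i, j).
rewrite !mxE (bigD1 (i, j)) //= tofracM rmorphM mulrAC; apply: vgeMr => //.
by apply/vge_emb/poly_val_ge0; rewrite leNgt.
Qed.

Definition lev (d : int) (x : place F) : int := if inf x then - d else 0.

(* The lattice of [g] is [F^n], intersected with [g] times the elements that
   are integral at the finite places and have a pole of order at most [d] at
   the infinite place. *)
Definition in_lattice (g : G) (d : int) (v : 'cV[F]_n) := forall x,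
  mxge (lev d x) (map_mx (loc x) (glinv g) *m map_mx (completion_emb x) v).

Lemma lattice_degree_ge (g : G) : exists B : int, forall d v,
  v != 0 -> in_lattice g d v -> B <= d.
Proof.
have [y yI] := infinite_place_exists k.
have [D D0 DP] := clear_denominators (glmx g).
have [N NP] := mxge_bounded (map_mx (loc y) (glmx g)).
(* For a nonzero entry [v i], the product [D * v i] is a nonzero polynomial whose pole at infinity
   has order at most [deg D + d - N]; this order is a degree, hence nonnegative. *)
exists (N - ((size D).-1)%:Z) => d v v0 vL.
have [i vi0] : exists i, v i ord0 != 0.
  by apply/cV0Pn.
have vE x : map_mx (completion_emb x) v = map_mx (loc x) (glmx g) *m
    (map_mx (loc x) (glinv g) *m map_mx (completion_emb x) v).
  by rewrite mulmxA -map_mxM glmxV map_mx1 mul1mx.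
have vy : vge (N - d) (completion_emb y (v i ord0)).
  have := mxgeM NP (vL y); rewrite -vE => /(_ i ord0).
  by rewrite mxE /lev ifT.
have [f fE] : exists f, tofrac D * v i ord0 = tofrac f.
  apply: integral_is_poly => x xF.
  have xF' : ~~ inf x by rewrite /inf -leNgt.
  apply/vge_emb; rewrite rmorphM.
  have := mxgeM (DP x xF') (vL x); rewrite -scalemxAl -vE => /(_ i ord0).
  by rewrite !mxE /lev ifN.
have f0 : f != 0.
  by apply: (num_neq0 vi0 D0); rewrite -fE mulrC.
have := pvalM y (tofrac D) (v i ord0); rewrite fE.
rewrite (infinite_place_val yI f0) (infinite_place_val yI D0).
move/vge_emb: vy; rewrite (pval_fin y vi0) lee_fin => vy [].
have arith (a b N' d' : int) (j : nat) : N' - d' <= a -> - (j%:Z) = - b + a ->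
  N' - b <= d' by lia.
exact: arith.
Qed.

(** The numbers [d i] are the successive minima of the lattice: the last clause says that a vector
    of degree [e] involves only columns of degree at most [e]. Such a basis splits the vector bundle
    of [g] into the line bundles O(- d i). *)
Definition reduced_basis (g : G) (M : 'M[F]_n) (d : 'I_n -> int) :=
  [/\ M \in unitmx, forall j, in_lattice g (d j) (col j M) &
    forall (c : 'cV[F]_n) i e, c i ord0 != 0 -> in_lattice g e (M *m c) -> d i <= e].

Lemma lattice_colE (g : G) M (d : 'I_n -> int) :
  (forall j, in_lattice g (d j) (col j M)) <->
  forall x i j, vge (lev (d j) x)
    ((map_mx (loc x) (glinv g) *m map_mx (completion_emb x) M) i j).
Proof.
split=> [H x i j|H j x i j']; last first.
  by have := H x i j; rewrite !mxE; under eq_bigr do rewrite !mxE;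
     under [X in _ -> vge _ X]eq_bigr do rewrite !mxE.
by have := H j x i ord0; rewrite !mxE; under eq_bigr do rewrite !mxE;
   under [X in _ -> vge _ X]eq_bigr do rewrite !mxE.
Qed.

(* A basis of lattice vectors with minimal sum of degrees is reduced: a
   shorter vector could replace one of the basis vectors. *)
Lemma reduced_basis_exists (g : G) : exists M d, reduced_basis g M d.
Proof.
pose good (M : 'M[F]_n) (d : 'I_n -> int) := M \in unitmx /\
  forall j, in_lattice g (d j) (col j M).
have [B BP] := lattice_degree_ge g.
have col_neq0 (M : 'M[F]_n) j : M \in unitmx -> col j M != 0.
  move=> MU; apply: contraTneq MU => Mj0; rewrite unitmxE unitfE negbK.
  rewrite (expand_det_col _ j) big1 // => i _.
  by have := congr1 (fun v : 'cV_n => v i ord0) Mj0; rewrite !mxE => ->; rewrite mul0r.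
have sum_ge M d : good M d -> B *+ n <= \sum_j d j.
  move=> [MU ML]; rewrite -[n in leLHS]card_ord -sumr_const.
  by apply: ler_sum => j _; apply: BP (ML j); exact: col_neq0.
have [M0 [d0 g0]] : exists M d, good M d.
  have [D D0 DP] := clear_denominators (glinv g).
  have [y yI] := infinite_place_exists k.
  have [N NP] := mxge_bounded (completion_emb y (tofrac D) *: map_mx (loc y) (glinv g)).
  exists (tofrac D)%:M, (fun=> - N); split.
    rewrite unitmxE det_scalar unitfE expf_neq0 // tofrac_eq0 //.
  apply/lattice_colE => x i j; rewrite map_scalar_mx mul_mx_scalar /lev.
  case: ifPn => [xI|]; last by move=> /DP.
  by rewrite opprK (infinite_place_uniq xI yI).
(* By [sum_ge] the degree sum stays above [B *+ n], so its distance to this bound is a natural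
   number that can be minimized. *)
have ex : exists s : nat, `[< exists M d, good M d /\ `|((\sum_j d j) - B *+ n)%R|%N = s >].
  by exists `|((\sum_j d0 j) - B *+ n)%R|%N; apply/asboolP; exists M0, d0.
have [s /asboolP [M [d [[MU ML] sE]]] smin] := ex_minnP ex.
exists M, d; split=> // c i e ci0 cL; rewrite leNgt; apply/negP => ed.
have [C CU colC] := replace_col_unitmx ci0.
pose d' j := if j == i then e else d j.
have : good (M *m C) d'.
  split; first by rewrite unitmx_mul MU CU.
  move=> j; rewrite (colC M j) /d'; case: ifP => _; [exact: cL|exact: ML].
move=> gd'; have : (s <= `|((\sum_j d' j) - B *+ n)%R|)%N.
  by apply: smin; apply/asboolP; exists (M *m C), d'.
rewrite -sE leqNgt => /negP; apply.
have lt : \sum_j d' j < \sum_j d j.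
  rewrite (bigD1 i) //= [ltRHS](bigD1 i) //= /d' eqxx ltr_leD //.
  by apply: ler_sum => j /negPf ->.
have := sum_ge _ _ gd'; move: lt.
by clear; move: (\sum_j d j) (\sum_j d' j) (B *+ n); lia.
Qed.

Lemma in_lattice_comb (g : G) M (d : 'I_n -> int) (c : 'cV[F]_n) e x :
  (forall j, in_lattice g (d j) (col j M)) ->
  (forall j, c j ord0 != 0 -> ((lev e x - lev (d j) x)%:E <= pval x (c j ord0))%E) ->
  mxge (lev e x) (map_mx (loc x) (glinv g) *m map_mx (completion_emb x) (M *m c)).
Proof.
move=> /lattice_colE ML xc i j; rewrite map_mxM mulmxA mxE; apply: vge_sum => l _.
rewrite (ord1 j) !mxE; have [->|cl0] := eqVneq (c l ord0) 0.
  by rewrite rmorph0 mulr0; exact: vge0.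
rewrite -[lev e x](subrK (lev (d l) x)) addrC; apply: vgeM.
  by have := ML x i l; rewrite mxE.
by apply/vge_emb; exact: xc.
Qed.

Lemma argmax_coef (d : 'I_n -> int) (c : 'cV[F]_n) : c != 0 ->
  exists2 i, c i ord0 != 0 & forall j, c j ord0 != 0 -> d j <= d i.
Proof.
move=> /cV0Pn [i0 ci0].
have [i ci dmax] := @arg_maxP _ _ _ i0 (fun i => c i ord0 != 0) d ci0.
by exists i.
Qed.

(* A vector of the lattice whose coordinates in a reduced basis all lie in the
   maximal ideal of a place has to come from a shorter one. *)
Lemma reduced_basis_indep (g : G) M (d : 'I_n -> int) x (c : 'cV[completion x]_n) :
  reduced_basis g M d -> mxge 0 c ->
  mxge 1 (map_mx (loc x) (glinv g) *m map_mx (completion_emb x) M *m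
          diag_mx (\row_i loc x (twist (d i))) *m c) -> mxge 1 c.
Proof.
move=> [MU ML Mmin] c0; set Y := _ *m map_mx _ M; set W := Y *m _ => Wc.
have W0 : mxge 0 W.
  move=> i j; rewrite /W mul_mx_diag !mxE loc_twist.
  have := (lattice_colE g M d).1 ML x i j; rewrite -/Y /lev; case: ifP => xI; last first.
    by rewrite mulr1 mxE.
  rewrite !mxE => Yij; rewrite -[0](addNr (d j)); apply: vgeM => //.
  by apply/vge_emb; rewrite inf_X // opprK.
have key (r : 'cV[F]_n) : mxge 1 (c - map_mx (completion_emb x) r) ->
    mxge 1 (W *m map_mx (completion_emb x) r).
  move=> cr i j; have -> : W *m map_mx (completion_emb x) r =
      W *m c - W *m (c - map_mx (completion_emb x) r).
    by rewrite mulmxBr opprB addrCA subrr addr0.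
  rewrite [X in vge _ X]mxE [X in _ + X]mxE; apply: vgeB; first exact: Wc.
  by have := mxgeM W0 cr; rewrite add0r; apply.
have finish (r : 'cV[F]_n) : mxge 1 (c - map_mx (completion_emb x) r) -> r = 0 -> mxge 1 c.
  by move=> + r0; rewrite r0 map_mx0 subr0.
have [xI|xF] := boolP (inf x).
  have /choice [r rP] : forall i, exists r : k,
      vge 1 (c i ord0 - completion_emb x (tofrac r%:P)).
    move=> i; have [a ca] := vge_approx 1 (c i ord0).
    have xa : (0 <= pval x a)%E.
      apply/vge_emb; rewrite -[completion_emb x a](subKr (c i ord0)).
      by apply: vgeB; [exact: c0 | apply: vge_le ca].
    have [r xr] := residue_infinite_place xI xa; exists r.
    rewrite -(subrK (completion_emb x a) (c i ord0)) -addrA -rmorphB.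
    by apply: vgeD => //; apply/vge_emb.
  pose rv : 'cV[F]_n := \col_i tofrac (r i)%:P.
  have cr : mxge 1 (c - map_mx (completion_emb x) rv).
    by move=> i j; rewrite !mxE (ord1 j); exact: rP.
  apply: (finish rv cr); apply/eqP/negPn/negP => /(argmax_coef d) [i ri imax].
  (* As [d i] is maximal among the columns involved, the entries of [w] are polynomials. At infinity
     [M *m w] becomes [X ^ d i] times a vector that [key] places in the maximal ideal, so its degree
     is at most [d i - 1], against reducedness. *)
  pose w : 'cV[F]_n := \col_j (tofrac (r j)%:P * tofrac 'X ^ (d i - d j)).
  suff : in_lattice g (d i - 1) (M *m w).
    have wi : w i ord0 != 0 by rewrite mxE subrr expr0z mulr1; move: ri; rewrite mxE.
    by move=> /(Mmin w i _ wi); lia.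
  move=> y; have [yI|yF] := boolP (inf y); last first.
    apply: (in_lattice_comb ML) => j; rewrite mxE mulf_eq0 negb_or => /andP[rj _].
    have dij : d j <= d i by apply: imax; rewrite mxE.
    rewrite /lev (negPf yF) subrr -(gez0_abs (_ : 0 <= d i - d j)) ?subr_ge0 //.
    change (0%:E <= pval y (tofrac (r j)%:P * tofrac 'X ^+ `|(d i - d j)%R|))%E.
    by rewrite -tofracXn -tofracM; apply: poly_val_ge0; rewrite leNgt.
  rewrite -(infinite_place_uniq xI yI).
  have -> : map_mx (completion_emb x) (M *m w) = completion_emb x (tofrac 'X ^ d i) *:
      (map_mx (completion_emb x) M *m diag_mx (\row_i loc x (twist (d i))) *m
       map_mx (completion_emb x) rv).
    rewrite map_mxM -mulmxA scalemxAr; congr (_ *m _); apply/colP => j.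
    rewrite mul_diag_mx !mxE loc_twist xI -!rmorphM; congr completion_emb.
    rewrite expfzDr ?tofrac_eq0 ?polyX_eq0 //.
    by rewrite mulrC -!mulrA.
  rewrite -scalemxAr !mulmxA -/Y -/W => a b; rewrite mxE.
  apply/(vge_embM (m := - d i)); first by rewrite inf_X.
  apply: vge_le (key _ cr a b).
  by rewrite /lev xI; lia.
have [p xp] : exists p, place_gen x p by apply: finite_place_gen; rewrite leNgt.
have [p1 xp1 xg] := xp; have p0 : p != 0 by rewrite -size_poly_gt0 ltnW.
have /choice [r rP] : forall i, exists r : {poly k}, (size r < size p)%N /\
    vge 1 (c i ord0 - completion_emb x (tofrac r)).
  move=> i; have [a ca] := vge_approx 1 (c i ord0).
  have xa : (0 <= pval x a)%E.
    apply/vge_emb; rewrite -[completion_emb x a](subKr (c i ord0)).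
    by apply: vgeB; [exact: c0 | apply: vge_le ca].
  have [r [rp xr]] := residue_finite_place xp xa; exists r; split=> //.
  rewrite -(subrK (completion_emb x a) (c i ord0)) -addrA -rmorphB.
  by apply: vgeD => //; apply/vge_emb.
pose rv : 'cV[F]_n := \col_i tofrac (r i).
have cr : mxge 1 (c - map_mx (completion_emb x) rv).
  by move=> i j; rewrite !mxE (ord1 j); have [] := rP i.
apply: (finish rv cr); apply/eqP/negPn/negP => /(argmax_coef d) [i ri imax].
have pF0 : tofrac p != 0 :> F by rewrite tofrac_eq0.
have pV y v : pval y (tofrac p) = v%:E -> pval y (tofrac p)^-1 = (- v)%:E.
  have := pvalM y (tofrac p) (tofrac p)^-1; rewrite mulfV // pval1 => + yp.
  by rewrite yp; case: (pval y _) => // s [sE]; congr EFin; lia.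
(* Dividing by [p] loses one order at [x], which [key] makes up for; it gains at least one at
   infinity because [size (r j) < size p]; at the other places [p] is a unit. *)
suff : in_lattice g (d i - 1) (M *m ((tofrac p)^-1 *: rv)).
  have wi : ((tofrac p)^-1 *: rv) i ord0 != 0.
    by rewrite mxE mulf_eq0 invr_eq0 (negPf pF0) (negPf ri).
  by move=> /(Mmin _ i _ wi); lia.
move=> y; have [yI|yF] := boolP (inf y).
  apply: (in_lattice_comb ML) => j; rewrite !mxE mulf_eq0 negb_or => /andP[_ rj].
  have dij : d j <= d i by apply: imax; rewrite mxE.
  have rj0 : r j != 0 by rewrite -tofrac_eq0.
  rewrite pvalM (pV _ _ (infinite_place_val yI p0)) (infinite_place_val yI rj0).
  rewrite -EFinD lee_fin /lev yI; have [rp _] := rP j.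
  move: rp dij (size_gt0 rj0); move: (d i) (d j) (size p) (size (r j)) => a b s t.
  by clear; lia.
have [->|yx] := pselect (y = x).
  have -> : map_mx (loc x) (glinv g) *m
      map_mx (completion_emb x) (M *m ((tofrac p)^-1 *: rv)) =
      completion_emb x (tofrac p)^-1 *: (W *m map_mx (completion_emb x) rv).
    rewrite -scalemxAr map_mxZ -scalemxAr map_mxM mulmxA; congr (_ *: _).
    rewrite /W /Y -!mulmxA; congr (_ *m (_ *m _)); apply/colP => j.
    by rewrite mul_diag_mx !mxE loc_twist (negPf xF) mul1r.
  move=> a b; rewrite mxE /lev (negPf xF).
  apply/(vge_embM (m := - 1)); first by apply: pV; rewrite xp1.
  exact: key.
apply: (in_lattice_comb ML) => j _; rewrite !mxE /lev (negPf yF) subrr pvalM.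
have yX : (0 <= pval y (tofrac 'X))%E by rewrite leNgt.
have yp : pval y (tofrac p) = 0%:E.
  apply/eqP; rewrite eq_le poly_val_ge0 // andbT leNgt; apply/negP => yp.
  by apply: yx; exact: place_gen_inj xp yX yp.
by rewrite (pV _ _ yp) oppr0 add0e; exact: poly_val_ge0.
Qed.

(** Integrality restates that the columns of [M] are lattice vectors. The inverse [V] has bounded
    poles, and [reduced_basis_indep], applied to its columns multiplied by a power of a uniformizer,
    lowers the pole order one step at a time down to 0. *)
Lemma reduced_decomposition (g : G) M (d : 'I_n -> int) (MU : M \in unitmx) :
  reduced_basis g M d ->
  gl_int ((g^-1)%g * rat_pt MU * twist_pt d)%g.
Proof.
move=> red; have [_ ML _] := red; set w := (_ * _)%g.
have wE x : map_mx (loc x) (glmx w) = map_mx (loc x) (glinv g) *m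
    map_mx (completion_emb x) M *m diag_mx (\row_i loc x (twist (d i))).
  rewrite /w !glmxM !map_mxM map_loc_diag; congr (_ *m _).
  by rewrite map_diag_mx; congr diag_mx; apply/rowP => i; rewrite !mxE.
apply/gl_int_vge => x; split.
  rewrite wE => i j; rewrite mul_mx_diag !mxE loc_twist.
  have := (lattice_colE g M d).1 ML x i j; rewrite /lev; case: ifP => xI; last first.
    by rewrite mulr1 mxE.
  rewrite !mxE => Yij; rewrite -[0](addNr (d j)); apply: vgeM => //.
  by apply/vge_emb; rewrite inf_X // opprK.
set V := map_mx _ (glinv w).
have WV : map_mx (loc x) (glmx w) *m V = 1%:M by rewrite -map_mxM glmxV map_mx1.
clearbody V; have [pi xpi] := pval_surj x.
have pi0 : pi != 0 by rewrite -(pval_eqy x) xpi.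
have xpiX (m : nat) : pval x (pi ^+ m) = (m%:Z)%:E.
  elim: m => [|m IH]; first by rewrite expr0 pval1.
  by rewrite exprS pvalM xpi IH -EFinD intS.
suff [m Vm] : exists m : nat, mxge (- (m%:Z)) V.
  elim: m Vm => [|m IH] Vm; first by rewrite oppr0 in Vm.
  apply: IH => i j.
  have := @reduced_basis_indep g M d x (completion_emb x (pi ^+ m.+1) *: col j V) red.
  rewrite -wE -scalemxAr => H.
  have Vij : mxge 1 (completion_emb x (pi ^+ m.+1) *: col j V).
    apply: H => a b; rewrite !mxE.
      by apply/(vge_embM _ _ (xpiX _)); rewrite sub0r; exact: Vm.
    apply/(vge_embM _ _ (xpiX _)).
    have -> : (\sum_l map_mx (loc x) (glmx w) a l * col j V l b) =
        (map_mx (loc x) (glmx w) *m V) a j.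
      by rewrite mxE; apply: eq_bigr => l _; rewrite !mxE.
    rewrite WV mxE; apply: (vge_le (N := 0)); first by lia.
    by case: eqP => _; [exact: vge1 | exact: vge0].
  have := Vij i ord0; rewrite !mxE => /(vge_embM _ _ (xpiX _)).
  by apply: vge_le; rewrite intS; lia.
have [N VN] := mxge_bounded V; exists `|N|%N => i j; apply: vge_le (VN i j); lia.
Qed.

End RationalPoints.

(** * Dominance *)

Lemma det_vge (F : fieldType) (x : place F) (n : nat) (A : 'M[completion x]_n)
    (a : 'I_n -> 'I_n -> int) (N : int) :
  (forall i j, vge (a i j) (A i j)) ->
  (forall s : {perm 'I_n}, N <= \sum_i a i (s i)) -> vge N (\det A).
Proof.
move=> Aa Na; apply: vge_sum => s _; apply: (vge_le (Na s)).
rewrite -[X in vge X _]add0r; apply: vgeM; last by apply: vge_prod.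
have -> : (-1) ^+ s = completion_emb x ((-1) ^+ s) by rewrite rmorphXn rmorphN rmorph1.
by apply/vge_emb; case: (odd_perm s); rewrite ?expr1 ?expr0 ?pvalN pval1.
Qed.

Lemma invmx_row_neq0 (K : fieldType) (n : nat) (N : 'M[K]_n) i : N \in unitmx ->
  exists l, (invmx N *m delta_mx l ord0 : 'cV_n) i ord0 != 0.
Proof.
move=> NU; apply/existsP; rewrite -[[exists _, _]]negbK negb_exists; apply/negP => /forallP i0.
have := mulVmx NU; move=> /matrixP/(_ i i); rewrite [RHS]mxE eqxx mxE big1 => [|l _].
  by move=> /eqP; rewrite eq_sym oner_eq0.
by have := i0 l; rewrite negbK -colE mxE => /eqP ->; rewrite mul0r.
Qed.

(** Steinitz exchange: some standard vector has a nonzero coordinate along the column to be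
    replaced. *)
Lemma exchange_cols (K : fieldType) (n : nat) (M : 'M[K]_n) (s : seq 'I_n) :
  M \in unitmx -> exists2 N : 'M[K]_n, N \in unitmx &
    forall j, if j \in s then exists l, col j N = delta_mx l ord0
              else col j N = col j M.
Proof.
move=> MU; elim: s => [|i s [N NU NP]]; first by exists M.
have [l il] := invmx_row_neq0 i NU.
have [C CU NC] := replace_col_unitmx il.
exists (N *m C) => [|j]; first by rewrite unitmx_mul NU.
rewrite inE NC; case: eqP => [->|_]; last exact: NP.
by exists l; rewrite mulmxA mulmxV // mul1mx.
Qed.

Section Dominance.
Variables (k : finFieldType) (n : nat).
Local Notation F := (ratfun k).
Local Notation G := (GLA F n).

Lemma loc_twist_diag x (d : 'I_n -> int) :
  map_mx (loc x) (diag_mx (\row_i twist k (d i))) =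
  diag_mx (\row_i (if inf x then completion_emb x (tofrac 'X ^ (- d i)) else 1)).
Proof. by rewrite map_diag_mx; congr diag_mx; apply/rowP => i; rewrite !mxE. Qed.

(** The dimension over [k] of the space of vectors of degree less than [z] in a lattice with minima
    [d]. Comparing it for all [z] compares degree vectors by majorization. *)
Definition excess (d : 'I_n -> int) (z : int) : int := \sum_i Num.max 0 (z - d i).

(* Columns [j] of the reduced basis with [mu j < z], completed by standard basis
   vectors, have a nonzero polynomial determinant, which has no zero at infinity. *)
Lemma reduced_basis_excess (t : G) (lam mu : 'I_n -> int) M z :
  gl_int t -> reduced_basis (t * twist_pt k lam)%g M mu ->
  excess mu z <= excess lam z.
Proof.
move=> /gl_int_vge tI [MU ML _]; set g := (t * _)%g in ML.
have [y yI] := infinite_place_exists k.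
pose s := [seq j <- enum 'I_n | ~~ (mu j < z)].
have sE j : (j \in s) = ~~ (mu j < z) by rewrite mem_filter mem_enum andbT.
have [N NU NP] := exchange_cols s MU.
pose A x := map_mx (loc x) (glinv t) *m map_mx (completion_emb x) N.
have NE x : map_mx (completion_emb x) N = map_mx (loc x) (glmx t) *m A x.
  by rewrite mulmxA -map_mxM glmxV map_mx1 mul1mx.
have Acol x i j : mu j < z -> vge (if inf x then lam i - mu j else 0) (A x i j).
  move=> jz; have := NP j; rewrite sE jz /= => Nj.
  have : vge (lev (mu j) x)
      ((if inf x then completion_emb x (tofrac 'X ^ (- - lam i)) else 1) * A x i j).
    have := ML j x i ord0; rewrite -Nj /g glinvM map_mxM -mulmxA.
    rewrite loc_twist_diag mul_diag_mx !mxE; congr (vge _ (_ * _)).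
    by apply: eq_bigr => l _; rewrite !mxE.
  rewrite /lev; case: ifP => xI; last by rewrite mul1r.
  move=> /(vge_embM _ _ (inf_X _ xI)); rewrite opprK opprK.
  by apply: vge_le; rewrite addrC.
have A0 x i j : j \in s -> vge 0 (A x i j).
  move=> js; have := NP j; rewrite js => -[l Nj].
  have -> : A x i j = (map_mx (loc x) (glinv t) *m
      map_mx (completion_emb x) (col j N)) i ord0.
    by rewrite !mxE; apply: eq_bigr => l' _; rewrite !mxE.
  rewrite Nj; have [_ tV] := tI x.
  have : mxge 0 (map_mx (completion_emb x) (delta_mx l ord0 : 'cV[F]_n)).
    move=> a b; rewrite !mxE; apply/vge_emb; case: (_ && _); first by rewrite pval1.
    by rewrite pval0 leey.
  by move=> /(mxgeM tV); rewrite addr0; apply.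
have Aij x i j : vge (if inf x && (mu j < z) then lam i - mu j else 0) (A x i j).
  have [jz|jz] := boolP (mu j < z); last by rewrite andbF; apply: A0; rewrite sE.
  by rewrite andbT; exact: Acol.
have detE x : completion_emb x (\det N) = \det (map_mx (loc x) (glmx t)) * \det (A x).
  by rewrite -det_mulmx -NE det_map_mx.
have dett x : vge 0 (\det (map_mx (loc x) (glmx t))).
  have [t0 _] := tI x; apply: (@det_vge _ _ _ _ (fun _ _ => 0)) => // s'.
  by rewrite big1.
have [f fE] : exists f, \det N = tofrac f.
  apply: integral_is_poly => x xF; have xF' : inf x = false by rewrite /inf ltNge xF.
  apply/vge_emb; rewrite detE; apply: vgeMl; first exact: dett.
  apply: det_vge (Aij x) _ => s'; rewrite sumr_ge0 // => i _.
  by rewrite xF'.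
have N0 : \det N != 0 by rewrite -unitfE -unitmxE.
have f0 : f != 0 by apply: contra_neq N0 => f0; rewrite fE f0 tofrac0.
(* Each entry of [A y] at (i, j) has valuation at least max(0, z - mu_j) - max(0, z - lam_i): if
   mu_j < z use max(0, z - lam_i) >= z - lam_i, otherwise the first term is 0. Summing along any
   permutation yields the difference of the excesses. *)
have : vge (excess mu z - excess lam z) (completion_emb y (\det N)).
  rewrite detE; apply: vgeMl; first exact: dett.
  apply: det_vge (Aij y) _ => s'.
  rewrite /excess [X in X - _](reindex_inj (@perm_inj _ s')) -sumrB /=.
  apply: ler_sum => i _; rewrite (_ : inf y = true) //=.
  by case: ltP => H; rewrite ?lerBlDr /Order.max; case: ifP; case: ifP; move: H; lia.
move=> /vge_emb; rewrite fE (infinite_place_val yI f0) lee_fin.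
by lia.
Qed.

(** All standard vectors lie in the lattice with degree [D], and one of them has a nonzero
    coordinate along column [i]. *)
Lemma reduced_basis_le (t : G) (lam mu : 'I_n -> int) M (D : int) :
  gl_int t -> reduced_basis (t * twist_pt k lam)%g M mu ->
  (forall i, lam i <= D) -> forall i, mu i <= D.
Proof.
move=> /gl_int_vge tI [MU _ Mmin] lamD i; set g := (t * _)%g in Mmin.
have [l il] := invmx_row_neq0 i MU.
apply: (Mmin _ _ _ il); rewrite (mulKVmx MU) => x a b.
have [_ tV] := tI x.
rewrite /g glinvM map_mxM -mulmxA loc_twist_diag mul_diag_mx !mxE.
have H : mxge 0 (map_mx (completion_emb x) (delta_mx l ord0 : 'cV[F]_n)).
  move=> c d; rewrite !mxE; apply/vge_emb; case: (_ && _); first by rewrite pval1.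
  by rewrite pval0 leey.
have := mxgeM tV H a b; rewrite addr0 mxE => {}H.
rewrite /lev; case: ifP => xI; last by rewrite mul1r.
apply/(vge_embM _ _ (inf_X _ xI)); apply: vge_le H.
by have := lamD a; lia.
Qed.

End Dominance.

(** * Recovering a multiset of natural numbers from truncated sums *)

Section Counting.
Variable n : nat.
Implicit Types a b : 'I_n -> nat.

Lemma sum_subn_succ a z :
  (\sum_i (z.+1 - a i) = \sum_i (z - a i) + \sum_i (a i <= z))%N.
Proof.
rewrite -big_split; apply: eq_bigr => i _ /=.
by case: (leqP (a i) z) => H /=; lia.
Qed.

(** The first difference in z of the sum of the z - a_i counts the entries at most z, and the second
    those equal to z. Arguments up to [D.+1] suffice, since beyond [D] every entry is counted. *)
Lemma perm_of_sum_subn a b D : (forall i, a i <= D)%N -> (forall i, b i <= D)%N ->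
  (forall z, z < D.+2 -> \sum_i (z - a i) = \sum_i (z - b i))%N ->
  exists s : {perm 'I_n}, forall i, a i = b (s i).
Proof.
move=> aD bD ab.
have le_ab z : (\sum_i (a i <= z) = \sum_i (b i <= z))%N.
  have [zD|Dz] := leqP z D.
    have := ab z.+1; rewrite !sum_subn_succ (ab z) ?ltnS ?leqW // => /(_ zD).
    by move=> /addnI.
  by apply: eq_bigr => i _; rewrite !(leq_trans _ (ltnW Dz)).
have eq_le c z : (\sum_i (c i == z) + (if z is z'.+1 then \sum_i (c i <= z') else 0)
    = \sum_(i < n) (c i <= z))%N.
  case: z => [|z]; first by rewrite addn0; apply: eq_bigr => i _; rewrite leqn0.
  rewrite -big_split; apply: eq_bigr => i _ /=; rewrite [in RHS]leq_eqVlt ltnS.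
  by case: eqP => [->|//]; rewrite ltnn.
have eq_ab z : (\sum_i (a i == z) = \sum_i (b i == z))%N.
  have := le_ab z; rewrite -!eq_le; case: z => [|z]; first by rewrite !addn0.
  by rewrite le_ab => /addIn.
have countE c z : count_mem z [tuple c i | i < n] = (\sum_i (c i == z))%N.
  rewrite -sum1_count big_mkcond /= big_map enumT; apply: eq_bigr => i _.
  by rewrite /= eq_sym; case: eqP.
have /tuple_permP [s sE] : perm_eq [tuple a i | i < n] [tuple b i | i < n].
  by apply/allP => z _ /=; rewrite !countE eq_ab.
exists s => i; have := congr1 (fun u => nth 0%N u i) sE.
rewrite -!tnth_nth !tnth_mktuple //.
Qed.

End Counting.

(** * Vanishing criterion *)

Section Vanishing.
Variables (R : realType) (k : finFieldType) (n : nat).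
Local Notation F := (ratfun k).
Local Notation G := (GLA F n).
Variable f : G -> R[i].
Hypothesis f_inv : pgl_invariant f.

Lemma center1 : center_pts (1%g : G).
Proof. by exists 1. Qed.

Lemma gl_int1 : gl_int (1%g : G).
Proof.
apply/gl_int_vge => x; rewrite /= map_mx1.
by split=> i j; rewrite mxE; case: eqP => _; [exact: vge1 | exact: vge0
  |exact: vge1 | exact: vge0].
Qed.

Lemma gl_rat1 : gl_rat (1%g : G).
Proof. by exists 1%:M; rewrite ?unitmx1 //= map_mx1. Qed.

Lemma f_ratl (g0 g : G) : gl_rat g0 -> f (g0 * g)%g = f g.
Proof. by move=> g0R; have := f_inv g g0R center1 gl_int1; rewrite !mulg1. Qed.

Lemma f_centerl (z g : G) : center_pts z -> f (z * g)%g = f g.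
Proof. by move=> zC; have := f_inv g gl_rat1 zC gl_int1; rewrite mulg1 mul1g. Qed.

Lemma f_intr (g h : G) : gl_int h -> f (g * h)%g = f g.
Proof. by move=> hI; have := f_inv g gl_rat1 center1 hI; rewrite mulg1 mul1g. Qed.

Lemma gl_intV (g : G) : gl_int g -> gl_int (g^-1)%g.
Proof. by move=> gI i j x; have [] := gI i j x. Qed.

Lemma f_reduced (g : G) M d : reduced_basis g M d -> f g = f (twist_pt k d).
Proof.
move=> red; have [MU _ _] := red; have := gl_intV (reduced_decomposition MU red).
set w := (_^-1)%g => wI; rewrite -(f_intr (twist_pt k d) wI) -[RHS](f_ratl _ (rat_ptP MU)).
by congr f; rewrite /w !invgM invgK !mulKVg.
Qed.

(** A permutation matrix is both rational and integral, so [f] ignores it on either side. *)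
Lemma f_twist_perm (d : 'I_n -> int) (s : {perm 'I_n}) :
  f (twist_pt k (d \o s)) = f (twist_pt k d).
Proof.
have PU : perm_mx s \in @unitmx F n by exact: unitmx_perm.
have PV : invmx (perm_mx s) = perm_mx (s^-1)%g :> 'M[F]_n.
  by rewrite -(mulKmx PU (perm_mx (s^-1)%g)) -perm_mxM mulgV perm_mx1 mulmx1.
have PI : gl_int (rat_pt PU).
  apply/gl_int_vge => x; rewrite /= !map_loc_diag PV.
  by split=> i j; rewrite !mxE; apply/vge_emb; case: (_ == _); rewrite ?pval1 ?pval0 ?leey.
rewrite -(f_intr _ PI) -[RHS](f_ratl _ (rat_ptP PU)); congr f.
apply: glmx_inj; rewrite /= mul_diag_mx mul_mx_diag.
apply/matrixP => i j; rewrite !mxE mulrC /=.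
by case: eqP => [<-|_] //; rewrite rmorph0 !mul0r.
Qed.

Lemma f_twist_shift (d : 'I_n -> int) (c : int) :
  f (twist_pt k (fun i => d i + c)) = f (twist_pt k d).
Proof.
have cC : center_pts (twist_pt k (fun _ : 'I_n => c)).
  exists (twist k c); apply/matrixP => i j; rewrite !mxE.
  by case: eqP.
rewrite -[RHS](f_centerl _ cC); congr f; apply: glmx_inj; rewrite /= mul_diag_mx.
apply/matrixP => i j; rewrite !mxE; case: eqP => _; last by rewrite !mulr0n mulr0.
by rewrite !mulr1n twistD addrC.
Qed.

Lemma excess_nat (d : 'I_n -> nat) (z : nat) :
  excess (fun i => (d i)%:Z) z%:Z = (\sum_i (z - d i)%N)%:Z.
Proof.
rewrite /excess -[RHS]natz natr_sum; apply: eq_bigr => i _; rewrite natz /Order.max.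
by case: ifP; lia.
Qed.

Lemma vanishing_nat :
  (forall lam : 'I_n -> int, (forall t : G, gl_int t ->
     f (t * twist_pt k lam)%g = 0 \/ f (t * twist_pt k lam)%g = f (twist_pt k lam)) ->
   f (twist_pt k lam) = 0) ->
  forall lam : 'I_n -> nat, f (twist_pt k (fun i => (lam i)%:Z)) = 0.
Proof.
move=> H lam; pose D := (\max_i lam i)%N.
have : forall i, (lam i <= D)%N by move=> i; exact: leq_bigmax.
(* [D] stays fixed during the induction, as [reduced_basis_le] keeps the new exponents below it. The
   weight adds up the excesses at all z up to [D.+1], so it drops unless every one of them is
   unchanged, and then the exponents are only permuted. *)
move: D => D; pose weight (d : 'I_n -> nat) := (\sum_(z < D.+2) \sum_i (z - d i))%N.
have [m] := ubnP (weight lam); elim: m lam => // m IH lam lam_m lamD.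
apply: H => t tI; have [M [mu red]] := reduced_basis_exists (t * twist_pt k (fun i => (lam i)%:Z))%g.
have muD := reduced_basis_le tI red (fun i => (_ : (lam i)%:Z <= D%:Z)).
(* At z = 0 the excess of [lam] is 0, hence so is that of [mu], which would be positive if [mu] had
   a negative entry. *)
have mu0 i : 0 <= mu i.
  have := reduced_basis_excess 0 tI red; rewrite (excess_nat lam 0%N) /=.
  rewrite [(\sum_i (0 - lam i))%N]big1 // /excess (bigD1 i) //= => e0.
  have : Num.max 0 (0 - mu i) <= 0.
    by apply: le_trans e0; rewrite lerDl sumr_ge0 // => j _; rewrite le_max lexx.
  by rewrite ge_max lexx sub0r oppr_le0.
pose nu i := `|mu i|%N; have muE : mu = (fun i => (nu i)%:Z).
  by apply/funext => i; rewrite /nu gez0_abs.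
rewrite (f_reduced red) muE; rewrite muE in red muD.
have nuD i : (nu i <= D)%N by rewrite -lez_nat muD // => j; rewrite lez_nat.
have le_z (z : nat) : (\sum_i (z - nu i) <= \sum_i (z - lam i))%N.
  by have := reduced_basis_excess z%:Z tI red; rewrite !excess_nat lez_nat.
have le_w : (weight nu <= weight lam)%N by apply: leq_sum => z _; exact: le_z.
have [lt_w|ge_w] := ltnP (weight nu) (weight lam).
  by left; apply: IH => //; exact: leq_trans lt_w _.
right; have [|s sE] := perm_of_sum_subn nuD lamD.
  move=> z zD; apply/eqP; rewrite eqn_leq le_z leqNgt; apply/negP => ltz.
  move: ge_w; rewrite leqNgt => /negP; apply.
  rewrite /weight (bigD1 (Ordinal zD)) //= [X in (_ < X)%N](bigD1 (Ordinal zD)) //=.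
  by rewrite -addSn leq_add // leq_sum // => z' _; exact: le_z.
rewrite -[RHS](f_twist_perm _ s); congr (f (twist_pt k _)).
by apply/funext => i; rewrite sE.
Qed.

Lemma vanishing :
  (forall lam : 'I_n -> int, (forall t : G, gl_int t ->
     f (t * twist_pt k lam)%g = 0 \/ f (t * twist_pt k lam)%g = f (twist_pt k lam)) ->
   f (twist_pt k lam) = 0) -> f = (fun=> 0).
Proof.
move=> H; apply/funext => g; have [M [d /f_reduced ->]] := reduced_basis_exists g.
(* A central shift large enough to make every exponent nonnegative. *)
pose c := \sum_i `|d i|; rewrite -(f_twist_shift d c).
have -> : (fun i => d i + c) = (fun i => (`|(d i + c)%R|%N)%:Z).
  apply/funext => i; rewrite gez0_abs // /c (bigD1 i) //= addrA addr_ge0 ?sumr_ge0 //.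
  by rewrite -lerBlDl sub0r; rewrite -normrN ler_norm.
exact: vanishing_nat.
Qed.

End Vanishing.

(** * The torus of a constant extension *)

Lemma mulmx1_unitl (K : fieldType) (n : nat) (A B : 'M[K]_n) :
  A *m B = 1%:M -> A \in unitmx.
Proof. by case/mulmx1_unit. Qed.

Lemma conj_invmx (K : fieldType) (n : nat) (P A B : 'M[K]_n) : P \in unitmx ->
  A *m P = P *m B -> invmx P *m A = B *m invmx P.
Proof.
by move=> PU AP; rewrite -[LHS](mulmxK PU) -(mulmxA (invmx P)) AP (mulKmx PU).
Qed.

Section ConstantBasis.
Variables (k : finFieldType) (E : fieldExtType (ratfun k)) (n : nat).
Local Notation F := (ratfun k).

Lemma free_subfamily (K : fieldType) (V : vectType K) (Y : seq V) :
  exists Z : seq V, [/\ {subset Z <= Y}, free Z & <<Z>>%VS = <<Y>>%VS].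
Proof.
elim: Y => [|y Y [Z [ZY Zf ZE]]]; first by exists [::]; rewrite nil_free.
have [yZ|yZ] := boolP (y \in <<Z>>%VS).
  exists Z; split=> // [z /ZY zY|]; first by rewrite inE zY orbT.
  by rewrite span_cons -ZE; apply/esym/addv_idPr; rewrite -memvE.
exists (y :: Z); split; last by rewrite !span_cons ZE.
  by move=> z; rewrite !inE => /orP[->//|/ZY ->]; rewrite orbT.
by rewrite free_cons yZ.
Qed.

(* The image of [L] consists of the [q ^ n] roots of ['X^(q ^ n) - 'X], so it
   contains [k], and by counting it is spanned over [k] by any [F]-basis of [E]
   that it contains. *)
Lemma constant_basis : const_ext n E -> exists b : n.-tuple E,
  basis_of {:E} b /\ forall l i j : 'I_n, exists c : k, coord b i (b`_l * b`_j) = tofrac c%:P.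
Proof.
move=> [dimE [L [iota [cardL genL]]]].
have iotaP e : e ^+ #|L| = e -> exists l, e = iota l.
  move=> eL; have := congr1 (map_poly iota) (finField_genPoly L).
  rewrite rmorphB rmorph_prod /= map_polyXn map_polyX => /(congr1 (fun p => p.[e])).
  rewrite hornerD hornerN hornerXn hornerX eL subrr horner_prod => /esym/eqP.
  rewrite prodf_seq_eq0 => /hasP [l _ /=].
  by rewrite rmorphB /= map_polyX map_polyC hornerXsubC subr_eq0 => /eqP ->; exists l.
have iotaL l : iota l ^+ #|L| = iota l by rewrite -rmorphXn expf_card.
have constL (c : k) : exists l, ((tofrac c%:P : F)%:A : E) = iota l.
  apply: iotaP; rewrite exprZn expr1n -rmorphXn -rmorphXn; congr (tofrac _%:P *: _).
  by rewrite cardL; elim: (n) => [|m IH]; rewrite ?expr1 // expnS mulnC exprM IH expf_card.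
have imM (i j : 'I_#|L|) :
    [seq iota c | c : L]`_i * [seq iota c | c : L]`_j \in [seq iota c | c : L].
  have /mapP [c _ ->] : [seq iota c | c : L]`_i \in [seq iota c | c : L].
    by apply: mem_nth; rewrite size_map -cardE.
  have /mapP [c' _ ->] : [seq iota c | c : L]`_j \in [seq iota c | c : L].
    by apply: mem_nth; rewrite size_map -cardE.
  by apply/mapP; exists (c * c'); rewrite ?mem_enum ?rmorphM.
(* The [F]-span of the image of [L] contains 1 and is closed under products, so it already equals
   the algebra that the image generates. *)
have spanL : <<[seq iota c | c : L]>>%VS = {:E}%VS.
  set W := <<_>>%VS; apply/eqP; rewrite eqEsubv subvf /= -genL.
  have W1 : (1 <= W)%VS.
    by rewrite -memvE; apply: memv_span; apply/mapP; exists 1; rewrite ?mem_enum ?rmorph1.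
  apply: agenv_sub_modl => //; rewrite prodvDl subv_add prod1v subvv /=.
  apply/prodvP => u v uW vW.
  rewrite (coord_span uW) (coord_span vW) mulr_suml; apply: memv_suml => i _.
  rewrite mulr_sumr; apply: memv_suml => j _.
  rewrite -scalerAl -scalerAr; do 2 apply: memvZ; apply: memv_span.
  exact: imM.
have [Z [ZL Zfree ZE]] := free_subfamily [seq iota c | c : L].
have Zn : size Z == n by rewrite -dimE -spanL -ZE (eqP Zfree).
pose b : n.-tuple E := Tuple Zn.
have bE : basis_of {:E} b by rewrite /basis_of /= ZE spanL eqxx.
exists b; split=> // l i j.
have bL m : (m < n)%N -> exists c, b`_m = iota c.
  move=> mn; have /ZL/mapP [c _ ->] : b`_m \in Z by apply: mem_nth; rewrite (eqP Zn).
  by exists c.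
have /choice [phi phiE] : forall a : {ffun 'I_n -> k}, exists c,
    \sum_m (tofrac (a m)%:P : F) *: b`_m = iota c.
  move=> a; apply: (iotaP); apply: (big_ind (fun e => e ^+ #|L| = e)) => [||m _].
  - by rewrite expr0n gtn_eqF //; apply/card_gt0P; exists 0.
  - move=> u v /iotaP [c ->] /iotaP [c' ->]; rewrite -rmorphD; exact: iotaL.
  have [c bm] := bL m (ltn_ord m); have [c' cE] := constL (a m).
  by rewrite -[X in _ *: X]mul1r scalerAl cE bm -rmorphM iotaL.
have phi_inj : injective phi.
  move=> a a' aa'; apply/ffunP => m; apply: (@polyC_inj k); apply/eqP.
  rewrite -tofrac_eq -(coord_sum_free (fun m => tofrac (a m)%:P) m (basis_free bE)).
  by rewrite phiE aa' -phiE coord_sum_free // (basis_free bE).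
have [psi _ psiK] : bijective phi.
  by apply: inj_card_bij => //; rewrite card_ffun card_ord cardL.
have [c bl] := bL l (ltn_ord l); have [c' bj] := bL j (ltn_ord j).
exists (psi (c * c') i).
rewrite bl bj -rmorphM -[X in iota X]psiK -phiE.
by rewrite (coord_sum_free (fun m => tofrac (psi (c * c') m)%:P)) ?(basis_free bE).
Qed.

End ConstantBasis.

(** * Lattice reduction inside the torus *)

Section TorusDecomposition.
Variables (k : finFieldType) (E : fieldExtType (ratfun k)) (n : nat).
Local Notation F := (ratfun k).
Local Notation G := (GLA F n).
Variables (b b0 : n.-tuple E) (bE : basis_of {:E} b) (b0E : basis_of {:E} b0).
Hypothesis b0_const :
  forall l i j : 'I_n, exists c : k, coord b0 i (b0`_l * b0`_j) = tofrac c%:P.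

Definition basis_change (b1 b2 : n.-tuple E) : 'M[F]_n := \matrix_(i, j) coord b1 i b2`_j.

Lemma basis_changeK (b1 b2 : n.-tuple E) : basis_of {:E} b1 -> basis_of {:E} b2 ->
  basis_change b1 b2 *m basis_change b2 b1 = 1%:M.
Proof.
move=> b1E b2E; apply/matrixP => i j; rewrite !mxE.
rewrite eq_sym -(coord_free j i (basis_free b1E)).
rewrite [in RHS](coord_basis b2E (memvf b1`_j)) linear_sum.
by apply: eq_bigr => l _; rewrite !mxE linearZ /= mulrC.
Qed.

Lemma basis_change_unit : basis_change b b0 \in unitmx.
Proof. exact: mulmx1_unitl (basis_changeK bE b0E). Qed.

Definition coordc (e : E) : 'cV[F]_n := \col_i coord b i e.

Lemma coordc_inj0 e : (coordc e == 0) = (e == 0).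
Proof.
apply/eqP/eqP => [e0|->]; last by apply/colP => i; rewrite !mxE linear0.
rewrite (coord_basis bE (memvf e)) big1 // => i _.
by have := congr1 (fun v : 'cV_n => v i ord0) e0; rewrite !mxE => ->; rewrite scale0r.
Qed.

Lemma coordc_surj (v : 'cV[F]_n) : exists e, v = coordc e.
Proof.
exists (\sum_i v i ord0 *: b`_i); apply/colP => i.
by rewrite mxE (coord_sum_free (fun i => v i ord0)) ?(basis_free bE).
Qed.

Lemma regmx_coordc e e' : regmx b e *m coordc e' = coordc (e * e').
Proof.
apply/colP => i; rewrite !mxE [in RHS](coord_basis bE (memvf e')) mulr_sumr linear_sum.
by apply: eq_bigr => j _; rewrite !mxE -scalerAr linearZ /= mulrC.
Qed.

Lemma col_basis_change j : col j (basis_change b b0) = coordc b0`_j.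
Proof. by apply/colP => i; rewrite !mxE. Qed.

Lemma regmx_basis_change e :
  regmx b e *m basis_change b b0 = basis_change b b0 *m regmx b0 e.
Proof.
apply/matrixP => i j; transitivity (coord b i (e * b0`_j)).
  have <- : (regmx b e *m coordc b0`_j) i ord0 = coord b i (e * b0`_j).
    by rewrite regmx_coordc mxE.
  by rewrite !mxE; apply: eq_bigr => l _; rewrite !mxE.
rewrite {1}(coord_basis b0E (memvf (e * b0`_j))) linear_sum mxE.
by apply: eq_bigr => l _; rewrite !mxE linearZ /= mulrC.
Qed.

Lemma regmx_unit e : e != 0 -> regmx b e \in unitmx.
Proof.
move=> e0; have := regmxM bE e e^-1; rewrite (mulfV e0) (regmx1 bE) => /esym.
exact: mulmx1_unitl.
Qed.

Lemma regalg_comm (A : 'M[adele F]_n) e : regalg b A ->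
  A *m map_mx (@diag k) (regmx b e) = map_mx (@diag k) (regmx b e) *m A.
Proof.
move=> [a ->]; rewrite mulmx_suml mulmx_sumr; apply: eq_bigr => l _.
by rewrite -scalemxAl -scalemxAr -!map_mxM -!regmxM // mulrC.
Qed.

Let p : G := rat_pt basis_change_unit.

(** [u] commutes with [E], and conjugation by [p] turns multiplication by [b0_l] into a matrix with
    constant entries, which is integral at every place. *)
Lemma torus_lattice_stable (u : G) d (l : 'I_n) e : torus_pts b u ->
  in_lattice (u * p)%g d (coordc e) -> in_lattice (u * p)%g d (coordc (b0`_l * e)).
Proof.
move=> [_ uV] eL x; rewrite glinvM map_mxM -regmx_coordc map_mxM.
have cE : map_mx (loc x) (glinv u) *m map_mx (completion_emb x) (regmx b b0`_l) =
    map_mx (completion_emb x) (regmx b b0`_l) *m map_mx (loc x) (glinv u).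
  by rewrite -!map_loc_diag -!map_mxM regalg_comm.
have pE : map_mx (loc x) (glinv p) *m map_mx (completion_emb x) (regmx b b0`_l) =
    map_mx (completion_emb x) (regmx b0 b0`_l) *m map_mx (loc x) (glinv p).
  rewrite map_loc_diag -!map_mxM; congr map_mx.
  exact: conj_invmx basis_change_unit (regmx_basis_change _).
rewrite -mulmxA [X in _ *m X]mulmxA cE !mulmxA pE -!mulmxA -[lev d x]add0r.
apply: mxgeM; last by have := eL x; rewrite glinvM map_mxM -mulmxA.
move=> i j; rewrite !mxE; have [c ->] := b0_const l i j; apply/vge_emb.
have [->|c0] := eqVneq c 0; first by rewrite polyC0 tofrac0 pval0 leey.
by rewrite poly_valC.
Qed.

(* A nonzero [e] of minimal degree in the lattice of [u p] yields the reduced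
   basis of the [e b0_j], since this lattice is stable under the constants. *)
Lemma torus_decomposition (u : G) : (0 < n)%N -> torus_pts b u ->
  exists h w : G, [/\ torus_rat_center b h, gl_int w & (u * p = h * (p * w))%g].
Proof.
move=> n0 uT; pose g := (u * p)%g.
have [B BP] := lattice_degree_ge g.
have [M0 [d0 [M0U M0L _]]] := reduced_basis_exists g.
pose i0 : 'I_n := Ordinal n0.
have [e0 e0E] := coordc_surj (col i0 M0).
have e00 : e0 != 0.
  rewrite -coordc_inj0 -e0E; apply: contraTneq M0U => c0.
  rewrite unitmxE unitfE negbK (expand_det_col _ i0) big1 // => i _.
  by have := congr1 (fun v : 'cV_n => v i ord0) c0; rewrite !mxE => ->; rewrite mul0r.
have ex : exists s : nat, `[< exists e d,
    [/\ e != 0, in_lattice g d (coordc e) & `|(d - B)%R|%N = s] >].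
  by exists `|(d0 i0 - B)%R|%N; apply/asboolP; exists e0, (d0 i0); rewrite -e0E.
have [s /asboolP [e [d [en0 eL sE]]] smin] := ex_minnP ex.
have dmin e' d' : e' != 0 -> in_lattice g d' (coordc e') -> d <= d'.
  move=> e'0 e'L; have := smin `|(d' - B)%R|%N.
  have -> : `[< exists e d, [/\ e != 0, in_lattice g d (coordc e) &
      `|(d - B)%R|%N = `|(d' - B)%R|%N] >] by apply/asboolP; exists e', d'.
  move=> /(_ isT); rewrite -sE.
  have dB : B <= d by apply: BP eL; rewrite coordc_inj0.
  have d'B : B <= d' by apply: BP e'L; rewrite coordc_inj0.
  by move: dB d'B; clear; lia.
have MU : regmx b e *m basis_change b b0 \in unitmx.
  rewrite unitmx_mul; apply/andP; split; first exact: regmx_unit.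
  exact: basis_change_unit.
(* All degrees are equal, which makes the twist a scalar matrix: it will be absorbed in Z(A). *)
have red : reduced_basis g (regmx b e *m basis_change b b0) (fun=> d).
  split; [exact: MU|move=> j|move=> c i d' ci0 cL].
    rewrite colE -mulmxA -colE col_basis_change regmx_coordc mulrC.
    exact: torus_lattice_stable.
  have [e' e'E] := coordc_surj (regmx b e *m basis_change b b0 *m c).
  apply: (dmin e'); last by rewrite -e'E.
  rewrite -coordc_inj0 -e'E; apply: contra_neq ci0 => Mc0.
  by rewrite -[c](mulKmx MU) Mc0 mulmx0 mxE.
have wI := gl_intV (reduced_decomposition MU red); set w := (_^-1)%g in wI.
pose t : G := rat_pt (regmx_unit en0).
exists (t * twist_pt k (fun=> d))%g, w; split=> //.
  exists t; first by exists e.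
  exists (twist_pt k (fun=> d)) => //; exists (twist k d).
  by apply/matrixP => i j; rewrite !mxE; case: eqP.
have pC : (twist_pt k (fun=> d) * p = p * twist_pt k (fun=> d))%g.
  apply: glmx_inj; rewrite !glmxM /=; apply/matrixP => i j.
  by rewrite mul_diag_mx mul_mx_diag !mxE mulrC.
have gE : g = (rat_pt MU * twist_pt k (fun=> d) * w)%g.
  by rewrite /w !invgM invgK !mulgA mulgK mulgV mul1g.
have Mtp : rat_pt MU = (t * p)%g by apply: glmx_inj; rewrite glmxM /= map_mxM.
clearbody t w p; change (g = t * twist_pt k (fun=> d) * (p * w))%g; clearbody g.
by rewrite gE Mtp -!mulgA (mulgA (twist_pt _ _) p) pC -!mulgA.
Qed.

End TorusDecomposition.

(** * Topology of the adelic group *)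

Section Topology.
Variables (F : fieldType) (n : nat).
Local Notation A := (adele F).
Local Notation G := (GLA F n).
Implicit Types (N : place F -> nat) (M X : 'M[A]_n) (g : G).

Definition fin_supp N := finite_set [set x | N x != 0%N].

Definition adele_small N M := forall x, mxge (N x)%:Z (map_mx (loc x) M).

Lemma fin_suppD N N' : fin_supp N -> fin_supp N' -> fin_supp (fun x => N x + N' x)%N.
Proof.
move=> NF N'F; apply: (@sub_finite_set _ _ ([set x | N x != 0%N] `|` [set x | N' x != 0%N])).
  move=> x /=; rewrite addn_eq0 negb_and => /orP[]; [by left | by right].
by rewrite finite_setU.
Qed.

Lemma adele_nbhs (a : A) N : fin_supp N ->
  nbhs a [set b | forall x, vge (N x)%:Z (loc x b - loc x a)].
Proof.
move=> NF; apply: open_nbhs_nbhs; split; last first.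
  by move=> x; rewrite subrr; exact: vge0.
change (adele_open [set b : A | forall x, vge (N x)%:Z (loc x b - loc x a)]).
move=> b ba; exists N; split=> // c cb x.
rewrite -(subrK (loc x b) (loc x c)) -addrA; apply: vgeD => //.
exact: cb.
Qed.

Lemma adele_nbhsP (a : A) (U : set A) : nbhs a U -> exists2 N, fin_supp N &
  forall b, (forall x, vge (N x)%:Z (loc x b - loc x a)) -> U b.
Proof.
rewrite nbhsE => -[V [Vo Va] VU].
have [N [NF NV]] := (Vo : adele_open V) a Va.
by exists N => // b ba; apply: VU; apply: NV.
Qed.

Lemma mx_nbhs M N : fin_supp N -> nbhs M [set M' | adele_small N (M' - M)].
Proof.
move=> NF; exists (fun i j => [set b | forall x, vge (N x)%:Z (loc x b - loc x (M i j))]).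
  by move=> i j; exact: adele_nbhs.
by move=> M' M'M x i j; rewrite !mxE rmorphB; exact: M'M.
Qed.

Lemma mx_nbhsP M (U : set 'M[A]_n) : nbhs M U -> exists2 N, fin_supp N &
  forall M', adele_small N (M' - M) -> U M'.
Proof.
move=> [P MP PU].
have /choice [N_ NP] : forall ij : 'I_n * 'I_n, exists N, fin_supp N /\
    forall b, (forall x, vge (N x)%:Z (loc x b - loc x (M ij.1 ij.2))) -> P ij.1 ij.2 b.
  by move=> ij; have [N NF NP] := adele_nbhsP (MP ij.1 ij.2); exists N.
exists (fun x => \sum_ij N_ ij x)%N.
  apply: (@sub_finite_set _ _ (\bigcup_(ij in [set: 'I_n * 'I_n]) [set x | N_ ij x != 0%N])).
    move=> x /=; rewrite sum_nat_eq0 negb_forall => /existsP [ij ijx].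
    by exists ij => //; move: ijx; rewrite implybE /=.
  by apply: bigcup_finite => [|ij _]; [exact: finite_finset | have [] := NP ij].
move=> M' M'M; apply: PU => i j; have [_] := NP (i, j); apply => x.
have := M'M x i j; rewrite !mxE rmorphB; apply: vge_le.
by rewrite lez_nat (bigD1 (i, j)) //= leq_addr.
Qed.

Lemma adele_mx_bound M : exists2 c, fin_supp c &
  forall x, mxge (- (c x)%:Z) (map_mx (loc x) M).
Proof.
have /choice [c cP] : forall x : place F, exists c : nat,
    mxge (- c%:Z) (map_mx (loc x) M) /\ (mxge 0 (map_mx (loc x) M) -> c = 0%N).
  move=> x; have [M0|M0] := pselect (mxge 0 (map_mx (loc x) M)); first by exists 0%N.
  have [N MN] := mxge_bounded (map_mx (loc x) M).
  by exists `|N|%N; split=> // i j; apply: vge_le (MN i j); lia.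
exists c => [|x]; last by have [] := cP x.
apply: (@sub_finite_set _ _ (\bigcup_(ij in [set: 'I_n * 'I_n])
  [set x | adele_val (M ij.1 ij.2) x \notin @cint F x])).
  move=> x /= cx0; apply: contrapT => Mint; move/negP: cx0; apply; apply/eqP.
  have [_] := cP x; apply => i j; apply: contrapT => Mij; apply: Mint.
  by exists (i, j) => //=; rewrite mxE in Mij; apply/negP.
apply: bigcup_finite => [|ij _]; first exact: finite_finset.
exact: asboolP _ (valP (M ij.1 ij.2)).
Qed.

(** Continuity at 0 of X |-> M X M': the poles of [M] and [M'] have bounded order and occur at
    finitely many places. *)
Lemma adele_small_mul M M' N : fin_supp N -> exists2 N', fin_supp N' &
  forall X, adele_small N' X -> adele_small N (M *m X *m M').
Proof.
move=> NF; have [c cF cM] := adele_mx_bound M; have [c' c'F c'M'] := adele_mx_bound M'.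
exists (fun x => N x + (c x + c' x))%N; first by do 2?[apply: fin_suppD => //].
move=> X XN x; rewrite !map_mxM => i j; have := mxgeM (mxgeM (cM x) (XN x)) (c'M' x) i j.
by apply: vge_le; lia.
Qed.

Lemma gl_nbhs g N : fin_supp N ->
  nbhs g [set h : G | adele_small N (glmx h - glmx g) /\
                      adele_small N (glinv h - glinv g)].
Proof.
move=> NF; apply: (@initial_continuous _ _ (@gl_pair F n) g
  ([set M | adele_small N (M - glmx g)] `*` [set M | adele_small N (M - glinv g)])).
exists ([set M | adele_small N (M - glmx g)], [set M | adele_small N (M - glinv g)]) => //.
by split; exact: mx_nbhs.
Qed.

Lemma gl_nbhsP g (U : set G) : nbhs g U -> exists2 N, fin_supp N &
  forall h, adele_small N (glmx h - glmx g) -> adele_small N (glinv h - glinv g) -> U h.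
Proof.
move=> [_ [[W Wo <-] Wg WU]].
have : nbhs (gl_pair g) W by apply: open_nbhs_nbhs.
move=> [[W1 W2] [/= /mx_nbhsP [N NF N1] /mx_nbhsP [N' N'F N2]] W12].
exists (fun x => N x + N' x)%N; first exact: fin_suppD.
move=> h hN hN'; apply: WU; apply: W12; split=> /=.
  by apply: N1 => x i j; apply: vge_le (hN x i j); lia.
by apply: N2 => x i j; apply: vge_le (hN' x i j); lia.
Qed.

Lemma sgval_continuous (S : subgroup F n) : continuous (@sgval F n S).
Proof. exact: initial_continuous. Qed.

Lemma sg_nbhsP (S : subgroup F n) (s : sgtype S) (U : set (sgtype S)) :
  nbhs s U -> exists2 W, nbhs (sgval s) W & @sgval F n S @^-1` W `<=` U.
Proof.
move=> [_ [[W Wo <-] Ws WU]]; exists W => //.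
by apply: open_nbhs_nbhs.
Qed.

Lemma gl_small1 M : adele_small (fun=> 0%N) (M - 1%:M) -> adele_small (fun=> 0%N) M.
Proof.
move=> M1 x i j; rewrite -[M](subrK 1%:M) map_mxD mxE; apply: vgeD; first exact: M1.
by rewrite map_mx1 mxE; case: eqP => _; [exact: vge1 | exact: vge0].
Qed.

(* [X] is a union of left cosets of the open subgroup [p K p^-1]. *)
Lemma open_coset_union (p : G) (X : set G) :
  (forall g v, X g -> adele_small (fun=> 0%N) (glmx (p^-1 * v * p)%g) ->
     adele_small (fun=> 0%N) (glinv (p^-1 * v * p)%g) -> X (g * v)%g) -> open X.
Proof.
move=> Xcoset; rewrite openE => g Xg; rewrite /interior.
have F0 : fin_supp (fun _ : place F => 0%N).
  by rewrite /fin_supp (_ : [set _ | _] = set0) //; apply/seteqP; split=> x //=.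
have [N NF NP] := adele_small_mul (glinv p *m glinv g) (glmx p) F0.
have [N' N'F N'P] := adele_small_mul (glinv p) (glmx g *m glmx p) F0.
have := gl_nbhs g (fin_suppD NF N'F); apply: filterS => h [hg hg'].
rewrite -(mulKVg g h); apply: Xcoset => //.
  apply: gl_small1; have -> : glmx (p^-1 * (g^-1 * h) * p)%g - 1%:M =
      glinv p *m glinv g *m (glmx h - glmx g) *m glmx p.
    rewrite !glmxM mulmxBr mulmxBl; congr (_ - _); first by rewrite !mulmxA.
    by rewrite -[_ *m glmx g]mulmxA glVmx mulmx1 glVmx.
  by apply: NP => x i j; apply: vge_le (hg x i j); lia.
apply: gl_small1; have -> : glinv (p^-1 * (g^-1 * h) * p)%g - 1%:M =
    glinv p *m (glinv h - glinv g) *m (glmx g *m glmx p).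
  rewrite !glinvM mulmxBr mulmxBl; congr (_ - _); first by rewrite !mulmxA.
  by rewrite -mulmxA [glinv g *m _]mulmxA glVmx mul1mx glVmx.
by apply: N'P => x i j; apply: vge_le (hg' x i j); lia.
Qed.

End Topology.

(** * Limits of integral matrices along an ultrafilter *)

Section UltraLimits.
Variables (k : finFieldType) (n : nat) (T : Type) (U : set_system T).
Hypothesis UU : UltraFilter U.
Local Notation F := (ratfun k).
Implicit Types (x : place F).

(** Convergence along [U] for the valuation at [x], expressed without a topology on the
    completion. *)
Definition ulim x (a : T -> 'M[completion x]_n) (xi : 'M[completion x]_n) :=
  forall N, U [set t | mxge N (a t - xi)].

Lemma ulim_exists x (a : T -> 'M[completion x]_n) :
  U [set t | mxge 0 (a t)] -> exists2 xi, mxge 0 xi & ulim a xi.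
Proof.
move=> a0; have /choice [xi xiP] : forall ij : 'I_n * 'I_n, exists z,
    vge 0 z /\ forall N, U [set t | vge N (a t ij.1 ij.2 - z)].
  move=> ij; apply: (@ultra_cvg_integral _ _ _ U (fun t => a t ij.1 ij.2)).
  by apply: filterS a0 => t; exact.
exists (\matrix_(i, j) xi (i, j)) => [i j|N].
  by rewrite mxE; have [] := xiP (i, j).
have : U [set t | forall ij : 'I_n * 'I_n, vge N (a t ij.1 ij.2 - xi ij)].
  by apply: filter_forall => ij; have [_] := xiP ij; exact.
by apply: filterS => t H i j; rewrite !mxE; exact: (H (i, j)).
Qed.

Lemma ulim_uniq x (a : T -> 'M[completion x]_n) xi eta :
  ulim a xi -> ulim a eta -> xi = eta.
Proof.
move=> axi aeta; apply/matrixP => i j; apply/eqP; rewrite -subr_eq0; apply/eqP.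
apply: vge_eq0 => N; have [t [/(_ i j) + /(_ i j)]] := filter_ex (filterI (axi N) (aeta N)).
rewrite !mxE => H1 H2.
have -> : xi i j - eta i j = (a t i j - eta i j) - (a t i j - xi i j) by ring.
exact: vgeB.
Qed.

Lemma ulim_cst x (xi : 'M[completion x]_n) : ulim (fun=> xi) xi.
Proof.
by move=> N; apply: filterS filterT => t _ i j; rewrite subrr mxE; exact: vge0.
Qed.

Lemma ulimM x (a b : T -> 'M[completion x]_n) xi eta : U [set t | mxge 0 (a t)] ->
  mxge 0 eta -> ulim a xi -> ulim b eta -> ulim (fun t => a t *m b t) (xi *m eta).
Proof.
move=> a0 eta0 axi beta N; apply: filterS3 a0 (axi N) (beta N) => t at0 at1 bt i j.
have -> : a t *m b t - xi *m eta = a t *m (b t - eta) + (a t - xi) *m eta.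
  by rewrite mulmxBr mulmxBl addrA subrK.
rewrite mxE; apply: vgeD; first by have := mxgeM at0 bt i j; rewrite add0r.
by have := mxgeM at1 eta0 i j; rewrite addr0.
Qed.

End UltraLimits.

Lemma filter_seq_forall (T : Type) (U : set_system T) (I : eqType) (s : seq I)
    (Q : I -> set T) : Filter U -> (forall i, U (Q i)) ->
  U [set t | forall i, i \in s -> Q i t].
Proof.
move=> UF UQ; elim: s => [|i s IH]; first by apply: filterS filterT.
apply: filterS2 (UQ i) IH => t Qi IH j; rewrite inE => /orP[/eqP -> //|].
exact: IH.
Qed.

Section UltraLimitsGL.
Variables (k : finFieldType) (n : nat) (T : Type) (U : set_system T).
Hypothesis UU : UltraFilter U.
Local Notation F := (ratfun k).
Local Notation G := (GLA F n).

Lemma integral_mx_adele (z : forall x : place F, 'M[completion x]_n) :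
  (forall x, mxge 0 (z x)) -> exists Z : 'M[adele F]_n, forall x, map_mx (loc x) Z = z x.
Proof.
move=> z0; have zA i j : (fun x => z x i j : completion x) \in @is_adele F.
  apply/asboolP; rewrite (_ : [set _ | _] = set0) //.
  by apply/seteqP; split=> x //= /negP; apply; exact: z0.
exists (\matrix_(i, j) Adele (zA i j)) => x.
by apply/matrixP => i j; rewrite !mxE.
Qed.

Lemma adele_mx_eqP (Z Z' : 'M[adele F]_n) :
  (forall x, map_mx (loc x) Z = map_mx (loc x) Z') -> Z = Z'.
Proof.
move=> ZZ'; apply/matrixP => i j; apply: adele_eqP => x.
by have /matrixP/(_ i j) := ZZ' x; rewrite !mxE.
Qed.

(** Integrality is part of the notion: holding at all places simultaneously, it turns placewise
    convergence into adelic convergence, and it lets products pass to the limit. *)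
Definition adele_ulim (X : T -> 'M[adele F]_n) (Z : 'M[adele F]_n) :=
  [/\ U [set t | forall x, mxge 0 (map_mx (loc x) (X t))],
    forall x, mxge 0 (map_mx (loc x) Z) &
    forall x, ulim U (fun t => map_mx (loc x) (X t)) (map_mx (loc x) Z)].

Lemma adele_ulim_exists (X : T -> 'M[adele F]_n) :
  U [set t | forall x, mxge 0 (map_mx (loc x) (X t))] -> exists Z, adele_ulim X Z.
Proof.
move=> X0; have X0x x : U [set t | mxge 0 (map_mx (loc x) (X t))].
  by apply: filterS X0 => t; exact.
pose xi x := s2val (cid2 (ulim_exists UU (X0x x))).
have xi0 x : mxge 0 (xi x) := s2valP (cid2 (ulim_exists UU (X0x x))).
have xiL x : ulim U _ (xi x) := s2valP' (cid2 (ulim_exists UU (X0x x))).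
have [Z ZE] := integral_mx_adele xi0.
by exists Z; split=> // x; rewrite ZE.
Qed.

Lemma adele_ulim_uniq X Z Z' : adele_ulim X Z -> adele_ulim X Z' -> Z = Z'.
Proof.
move=> [_ _ XZ] [_ _ XZ']; apply: adele_mx_eqP => x.
exact: (ulim_uniq UU (XZ x) (XZ' x)).
Qed.

Lemma adele_ulimM X X' Z Z' : adele_ulim X Z -> adele_ulim X' Z' ->
  adele_ulim (fun t => X t *m X' t) (Z *m Z').
Proof.
move=> [X0 Z0 XZ] [X'0 Z'0 XZ']; split=> [|x|x].
- apply: filterS2 X0 X'0 => t X0 X'0 x; rewrite map_mxM -[0]addr0.
  exact: mxgeM.
- by rewrite map_mxM -[0]addr0; exact: mxgeM.
rewrite map_mxM (_ : (fun t => _) =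
  (fun t => map_mx (loc x) (X t) *m map_mx (loc x) (X' t))).
  by apply: (ulimM UU) => //; apply: filterS X0 => t; exact.
by apply/funext => t; rewrite map_mxM.
Qed.

Lemma adele_ulim_cst Z : (forall x, mxge 0 (map_mx (loc x) Z)) ->
  adele_ulim (fun=> Z) Z.
Proof.
move=> Z0; split=> // [|x]; last exact: (ulim_cst UU).
by apply: filterS filterT => t _.
Qed.

Lemma adele_ulim_comm X Z M : adele_ulim X Z -> (forall x, mxge 0 (map_mx (loc x) M)) ->
  (forall t, X t *m M = M *m X t) -> Z *m M = M *m Z.
Proof.
move=> XZ M0 XM; have ML := adele_ulim_cst M0.
apply: (adele_ulim_uniq (adele_ulimM XZ ML)).
rewrite (_ : (fun t => _) = (fun t => M *m X t)); last exact/funext.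
exact: adele_ulimM.
Qed.

(** Only the finitely many places in the support of [N] call for convergence; at the others the
    difference of two integral matrices is integral. *)
Lemma adele_ulim_small X Z N : adele_ulim X Z -> fin_supp N ->
  U [set t | adele_small N (X t - Z)].
Proof.
move=> [X0 Z0 XZ] /finite_seqP [s sE].
have UF : Filter U by exact: _.
have := filter_seq_forall s UF (fun x => XZ x (N x)%:Z).
apply: filterS2 X0 => t X0 Xs x; rewrite map_mxB.
have [/Xs //|xs] := boolP (x \in s).
have -> : N x = 0%N.
  apply/eqP; apply: contraNT xs => xN.
  by have : [set` s] x by rewrite -sE.
move=> i j; rewrite [X in vge _ X]mxE [X in _ + X]mxE.
by apply: vgeB; [exact: X0 | exact: Z0].
Qed.

(** Compactness of K. The matrices and their inverses converge separately, and uniqueness of limits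
    shows that the two limits are inverse to each other. *)
Lemma gl_int_ulim (X : T -> G) : U [set t | gl_int (X t)] -> exists w : G,
  [/\ gl_int w, adele_ulim (fun t => glmx (X t)) (glmx w) &
     adele_ulim (fun t => glinv (X t)) (glinv w)].
Proof.
move=> XI.
have [|Z ZL] := @adele_ulim_exists (fun t => glmx (X t)).
  by apply: filterS XI => t XI x; have [] := (gl_int_vge _).1 XI x.
have [|Z' Z'L] := @adele_ulim_exists (fun t => glinv (X t)).
  by apply: filterS XI => t XI x; have [] := (gl_int_vge _).1 XI x.
have one0 x : mxge 0 (map_mx (@loc F x) (1%:M : 'M[adele F]_n)).
  by move=> i j; rewrite map_mx1 mxE; case: eqP => _; [exact: vge1 | exact: vge0].
have ZV : Z *m Z' = 1%:M.
  apply: (adele_ulim_uniq (adele_ulimM ZL Z'L)).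
  rewrite (_ : (fun t => _) = (fun=> 1%:M)); first exact: adele_ulim_cst.
  by apply/funext => t; rewrite glmxV.
have VZ : Z' *m Z = 1%:M.
  apply: (adele_ulim_uniq (adele_ulimM Z'L ZL)).
  rewrite (_ : (fun t => _) = (fun=> 1%:M)); first exact: adele_ulim_cst.
  by apply/funext => t; rewrite glVmx.
exists (MkGLA ZV VZ); split=> //; apply/gl_int_vge => x.
by have [_ ? _] := ZL; have [_ ? _] := Z'L; split.
Qed.

End UltraLimitsGL.

(** * Compactness of the integral part of the torus *)

Section TorusCompact.
Variables (k : finFieldType) (E : fieldExtType (ratfun k)) (n : nat).
Local Notation F := (ratfun k).
Local Notation G := (GLA F n).
Variables (b b0 : n.-tuple E) (bE : basis_of {:E} b) (b0E : basis_of {:E} b0).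
Hypothesis b0_const :
  forall l i j : 'I_n, exists c : k, coord b0 i (b0`_l * b0`_j) = tofrac c%:P.

Local Notation dg := (map_mx (@diag k)).

Lemma regmx_sum e : regmx b e = \sum_l coord b0 l e *: regmx b b0`_l.
Proof.
apply/matrixP => i j; rewrite !mxE summxE.
rewrite {1}(coord_basis b0E (memvf e)) mulr_suml linear_sum.
by apply: eq_bigr => l _; rewrite !mxE -scalerAl linearZ.
Qed.

(* An element of the centralizer of [E] is determined by its action on 1. *)
Lemma regalg_centralizer (A : 'M[adele F]_n) :
  (forall j : 'I_n, A *m dg (regmx b b0`_j) = dg (regmx b b0`_j) *m A) -> regalg b A.
Proof.
move=> Acomm; have AC e : A *m dg (regmx b e) = dg (regmx b e) *m A.
  rewrite regmx_sum raddf_sum mulmx_sumr mulmx_suml; apply: eq_bigr => l _ /=.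
  by rewrite map_mxZ -scalemxAr -scalemxAl Acomm.
pose v := A *m dg (coordc b 1).
pose A' := \sum_l v l ord0 *: dg (regmx b b`_l).
have A'R : regalg b A' by exists (fun l => v l ord0).
have coordb (l : 'I_n) : coordc b b`_l = delta_mx l ord0.
  apply/colP => i; rewrite !mxE coord_free ?(basis_free bE) // andbT.
  by rewrite eq_sym.
have A'1 : A' *m dg (coordc b 1) = v.
  rewrite mulmx_suml; apply/colP => i; rewrite summxE (bigD1 i) //= big1 ?addr0.
    rewrite -scalemxAl -map_mxM regmx_coordc // mulr1 coordb map_delta_mx.
    by rewrite !mxE !eqxx mulr1.
  move=> l li; rewrite -scalemxAl -map_mxM regmx_coordc // mulr1 coordb map_delta_mx.
  by rewrite !mxE [i == l]eq_sym (negPf li) mulr0.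
suff -> : A = A' by [].
have key e : A *m dg (coordc b e) = A' *m dg (coordc b e).
  have -> : coordc b e = regmx b e *m coordc b 1 by rewrite regmx_coordc // mulr1.
  by rewrite map_mxM !mulmxA AC regalg_comm // -!mulmxA A'1.
apply/matrixP => i j; have := congr1 (fun M : 'cV_n => M i ord0) (key b`_j).
by rewrite /= coordb map_delta_mx -!colE !mxE.
Qed.

Section Conjugation.
Variable p : G.
Hypothesis pE : forall e, dg (regmx b e) *m glmx p = glmx p *m dg (regmx b0 e).

Lemma conj_regmx (A : 'M[adele F]_n) e :
  (glmx p *m A *m glinv p) *m dg (regmx b e) =
    dg (regmx b e) *m (glmx p *m A *m glinv p) <->
  A *m dg (regmx b0 e) = dg (regmx b0 e) *m A.
Proof.
move: (pE e); move: (dg (regmx b e)) (dg (regmx b0 e)) => D D0 DP.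
have PD : glinv p *m D = D0 *m glinv p.
  rewrite -[LHS]mulmx1 -(glmxV p) -(mulmxA (glinv p)) (mulmxA _ (glmx p)) DP.
  by rewrite !mulmxA glVmx mul1mx.
have -> : (glmx p *m A *m glinv p) *m D = glmx p *m (A *m D0) *m glinv p.
  by rewrite -!mulmxA PD.
have -> : D *m (glmx p *m A *m glinv p) = glmx p *m (D0 *m A) *m glinv p.
  by rewrite !mulmxA DP.
move: (A *m D0) (D0 *m A) => B B'.
split=> [|->//] /(congr1 (fun M => glinv p *m M *m glmx p)).
by rewrite -!mulmxA glVmx !mulmx1 !mulmxA glVmx !mul1mx.
Qed.

Lemma conj_mxK (A : 'M[adele F]_n) : glmx p *m (glinv p *m A *m glmx p) *m glinv p = A.
Proof. by rewrite -!mulmxA glmxV mulmx1 mulmxA glmxV mul1mx. Qed.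

Lemma glmx_conj (u : G) : glmx (p^-1 * u * p)%g = glinv p *m glmx u *m glmx p.
Proof. by []. Qed.

Lemma glinv_conj (u : G) : glinv (p^-1 * u * p)%g = glinv p *m glinv u *m glmx p.
Proof. by rewrite [LHS]glinvM [X in _ *m X]glinvM mulmxA. Qed.

Lemma glmx_conjV (u : G) : glmx (p * u * p^-1)%g = glmx p *m glmx u *m glinv p.
Proof. by []. Qed.

Lemma glinv_conjV (u : G) : glinv (p * u * p^-1)%g = glmx p *m glinv u *m glinv p.
Proof. by rewrite [LHS]glinvM [X in _ *m X]glinvM mulmxA. Qed.

Lemma torus_conj_comm (u : G) e : torus_pts b u ->
  glmx (p^-1 * u * p)%g *m dg (regmx b0 e) = dg (regmx b0 e) *m glmx (p^-1 * u * p)%g /\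
  glinv (p^-1 * u * p)%g *m dg (regmx b0 e) = dg (regmx b0 e) *m glinv (p^-1 * u * p)%g.
Proof.
move=> [u1 u2]; rewrite glmx_conj glinv_conj.
move: (glmx u) (glinv u) u1 u2 => M M' M1 M2; split.
  by apply: (conj_regmx (glinv p *m M *m glmx p) e).1; rewrite conj_mxK (regalg_comm bE e M1).
by apply: (conj_regmx (glinv p *m M' *m glmx p) e).1; rewrite conj_mxK (regalg_comm bE e M2).
Qed.

Lemma torus_conj_regalg (A : 'M[adele F]_n) :
  (forall j : 'I_n, A *m dg (regmx b0 b0`_j) = dg (regmx b0 b0`_j) *m A) ->
  regalg b (glmx p *m A *m glinv p).
Proof. by move=> AC; apply: regalg_centralizer => j; apply/conj_regmx. Qed.

(** The conjugates by [p^-1] lie in K, so they have a limit [w] there. It comes from the torus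
    because T(A) is the centralizer of [E], and commuting with the integral matrices of the [b0_j]
    passes to the limit. *)
Lemma torus_int_compact :
  compact [set s : sgtype (torus bE) | gl_int (p^-1 * sgval s * p)%g].
Proof.
rewrite compact_ultra => U UU UV.
have [w [wI wL w'L]] := gl_int_ulim UU UV; have [s0 s0E] : exists s0, s0 = (p * w * p^-1)%g by exists (p * w * p^-1)%g.
have B0 x (j : 'I_n) : mxge 0 (map_mx (loc x) (dg (regmx b0 b0`_j))).
  move=> i l; rewrite !mxE; have [c ->] := b0_const j i l; apply/vge_emb.
  have [->|c0] := eqVneq c 0; first by rewrite polyC0 tofrac0 pval0 leey.
  by rewrite poly_valC.
have sT : torus_pts b s0.
  have tC (t : sgtype (torus bE)) e := torus_conj_comm e (set_valP t).
  rewrite s0E; split; rewrite ?glmx_conjV ?glinv_conjV; apply: torus_conj_regalg => j.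
    by apply: (adele_ulim_comm UU wL (B0^~ j)) => t; have [] := tC t b0`_j.
  by apply: (adele_ulim_comm UU w'L (B0^~ j)) => t; have [] := tC t b0`_j.
pose s : sgtype (torus bE) := exist _ s0 (mem_set sT).
have sE : sgval s = s0 by [].
exists s; split.
  by change (gl_int (p^-1 * s0 * p)%g); rewrite s0E !mulgA mulVg mul1g mulgKV.
clearbody s; move=> W /sg_nbhsP [W1 + W1W]; rewrite sE => /gl_nbhsP [N NF NW].
have [N' N'F N'P] := adele_small_mul (glmx p) (glinv p) NF.
have := adele_ulim_small UU w'L N'F; have := adele_ulim_small UU wL N'F.
apply: filterS2 => t Ht H't; apply: W1W; apply: NW.
  have -> : glmx (sgval t) - glmx s0 =
      glmx p *m (glmx (p^-1 * sgval t * p)%g - glmx w) *m glinv p.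
    by rewrite s0E mulmxBr mulmxBl glmx_conj glmx_conjV conj_mxK.
  exact: N'P Ht.
have -> : glinv (sgval t) - glinv s0 =
    glmx p *m (glinv (p^-1 * sgval t * p)%g - glinv w) *m glinv p.
  by rewrite s0E mulmxBr mulmxBl glinv_conj glinv_conjV conj_mxK.
exact: N'P H't.
Qed.

End Conjugation.

End TorusCompact.

(** * Quotient measures *)

Lemma integral_if (d : measure_display) (T : measurableType d) (R : realType)
    (mu : {measure set T -> \bar R}) (D : set T) (r : \bar R) : measurable D ->
  (\int[mu]_c (if c \in D then r else 0) = r * mu D)%E.
Proof.
move=> Dm; rewrite -(integral_cst mu Dm r) [RHS]integral_mkcond.
by apply: eq_integral => c _; rewrite /patch; case: ifP.
Qed.

(** As 0 * oo = 0 for extended reals, a product of nonnegative factors that is positive and finite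
    has no zero or infinite factor. *)
Lemma factor_fin (R : realType) (a u : \bar R) : (0 <= a -> 0 <= u ->
  0 < a * u -> a * u < +oo -> 0 < u < +oo)%E.
Proof.
case: u => [u| |] //; case: a => [w| |] //.
- rewrite !lee_fin -EFinM !lte_fin => w0 u0 wu _; rewrite ltry andbT.
  by rewrite lt_neqAle u0 andbT; apply: contraTneq wu => <-; rewrite mulr0 ltxx.
- rewrite lee_fin => _; rewrite le_eqVlt => /orP[/eqP <-|u0 _].
    by rewrite mule0 ltxx.
  by rewrite gt0_mulye ?lte_fin // ltxx.
- rewrite lee_fin le_eqVlt => /orP[/eqP <- _|w0 _]; first by rewrite mul0e ltxx.
  by rewrite gt0_muley ?lte_fin // ltxx.
Qed.

Section WeilFormula.
Variables (R : realType) (F : fieldType) (n : nat) (H S : subgroup F n).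
Local Notation G := (GLA F n).
Variables (muS : {measure set (borel (sgtype S)) -> \bar R})
  (muH : {measure set (borel (sgtype H)) -> \bar R})
  (mu : {measure set (borel (sgquot H S)) -> \bar R}).
Hypotheses (haarS : is_haar muS) (haarH : is_haar muH)
  (quot : is_quotient_measure muS muH mu).
Hypotheses (HS : forall g, sgset H g -> sgset S g)
  (Hcomm : forall g h, sgset H g -> sgset H h -> (g * h = h * g)%g).

Lemma borel_open (T : ptopologicalType) (B : set (borel T)) :
  @open T B -> measurable B.
Proof. exact: sub_sigma_algebra. Qed.

Lemma sgrepr_coset (c : sgquot H S) t : sgquot_set c = sgcoset H t ->
  exists2 h, sgset H h & sgrepr c = (h * t)%g.
Proof.
move=> cE; have : sgquot_set c (sgrepr c).
  by apply: xgetPex; exists t; rewrite cE; exists 1%g; [exact: sg1 | rewrite mul1g].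
by rewrite {1}cE => -[h Hh ht]; exists h.
Qed.

Lemma sgreprP (c : sgquot H S) : sgset S (sgrepr c).
Proof.
have [t St cE] := sgquot_setP c; have [h Hh ->] := sgrepr_coset cE.
by apply: sgM => //; exact: HS.
Qed.

Lemma indic_continuous (T : topologicalType) (B : set T) :
  open B -> open (~` B) -> continuous (\1_B : T -> R).
Proof.
move=> Bo Bco s; apply: cvg_near_cst.
have [sB|sB] := pselect (B s).
  have : nbhs s B by apply: open_nbhs_nbhs.
  by apply: filterS => t tB; rewrite !indicE !mem_set.
have : nbhs s (~` B) by apply: open_nbhs_nbhs.
by apply: filterS => t tB; rewrite !indicE !memNset.
Qed.

Lemma sgval_open (S' : subgroup F n) (B : set G) :
  open B -> open (@sgval F n S' @^-1` B).
Proof. by move=> Bo; apply: open_comp => // s _; exact: sgval_continuous. Qed.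

Variables V X : set G.
Hypotheses (V_open : forall g, open [set h | V (g * h)%g]) (VC_open : open (~` V))
  (VM : forall g h, V g -> V h -> V (g * h)%g) (VV : forall g, V g -> V (g^-1)%g)
  (V_compact : compact [set s : sgtype S | V (sgval s)])
  (V_cover : forall s, sgset S s -> exists2 h, sgset H h & V (h * s)%g).
Hypotheses (X_open : open X) (XC_open : open (~` X))
  (XH : forall h g, sgset H h -> X (h * g)%g <-> X g)
  (V1 : V 1%g) (X1 : X 1%g).

Let U := [set c : sgquot H S | X (sgrepr c)].

(** [X] is stable under [H] on the left, so membership does not depend on the representative, and
    the preimage of [U] in [S] is the trace of the open set [X]. *)
Lemma quotient_set_measurable : measurable (U : set (borel (sgquot H S))).
Proof.
apply: borel_open; change (open (@sgproj F n H S @^-1` U)).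
rewrite (_ : _ @^-1` _ = @sgval F n S @^-1` X); first exact: sgval_open.
apply/seteqP; split=> s /=; rewrite /U /=;
have [h Hh ->] := @sgrepr_coset (sgproj H s) (sgval s) erefl; by rewrite XH.
Qed.

(* Weil's formula for the indicator of [V `&` X]: the fibres over [U] are
   translates of [V `&` H]. *)
Lemma quotient_set_measure : (0 < mu U < +oo)%E.
Proof.
pose VX := V `&` X.
have V1_open : open V.
  by have := V_open 1%g; congr open; apply/seteqP; split=> h /=; rewrite mul1g.
have VX_open : open VX by exact: openI.
have VXC_open : open (~` VX) by rewrite setCI; exact: openU.
pose B : set (sgtype S) := @sgval F n S @^-1` VX.
have B_open : open B by exact: sgval_open.
have B_closed : closed B.
  by rewrite -[B]setCK; apply: open_closedC; rewrite preimage_setC; exact: sgval_open.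
have B_compact : compact B.
  rewrite (_ : B = [set s : sgtype S | V (sgval s)] `&` B).
    exact: compact_closedI.
  by apply/seteqP; split=> s; [move=> [? ?]; split | move=> []].
have phiE (s : sgtype S) : (\1_VX (sgval s) : R) = \1_B s.
  by rewrite !indicE; congr (_%:R); apply/idP/idP; rewrite !inE.
have weil : (\int[muS]_s (\1_VX (sgval s))%:E =
    \int[mu]_c \int[muH]_h (\1_VX (sgval h * sgrepr c)%g)%:E)%E.
  apply: quot; last first.
    rewrite (_ : [set s : sgtype S | _] = B); first by rewrite -(closure_id B).1.
    apply/seteqP; split=> s /=; rewrite phiE indicE.
      by case: (boolP (s \in B)) => [/set_mem //|_]; rewrite eqxx.
    by move=> Bs; rewrite mem_set // oner_neq0.
  move=> s; apply: continuous_comp; first exact: sgval_continuous.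
  exact: indic_continuous.
pose W : set (borel (sgtype H)) := [set h : sgtype H | V (sgval h)].
have Wm : measurable W by apply: borel_open; exact: (@sgval_open H V V1_open).
have Hc (h : sgtype H) : sgset H (sgval h) := set_valP h.
have inner (c : sgquot H S) :
    (\int[muH]_h (\1_VX (sgval h * sgrepr c)%g)%:E)%E = (if c \in U then muH W else 0%E).
  case: ifPn => [/set_mem Uc|/negP Uc].
    (* With [h0 * c] in the group [V] and [H] commutative, [h * c] lies in [V] exactly when
       [h0^-1 * h] does: the fibre is [h0] times [W], and invariance gives it the measure of [W]. *)
    have [h0 Hh0 Vh0] := V_cover (sgreprP c).
    have [Hinv _ _] := haarH; rewrite -(Hinv h0 W Hh0 Wm).
    set W' := [set t | _]; have W'E (h : sgtype H) :
        (W' h : Prop) <-> VX (sgval h * sgrepr c)%g.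
      have hE : (sgval h * sgrepr c)%g = (h0^-1 * sgval h * (h0 * sgrepr c))%g.
        by rewrite (Hcomm (sgV Hh0) (Hc h)) -!mulgA mulKg.
      split=> [[w Ww wE]|[Vh _]].
        split; last by rewrite XH.
        by rewrite hE; apply: VM => //; rewrite wE mulKg.
      have Hh : sgset H (h0^-1 * sgval h)%g by apply: sgM => //; exact: sgV.
      exists (exist _ (h0^-1 * sgval h)%g (mem_set Hh) : sgtype H).
        change (V (h0^-1 * sgval h)%g).
        have -> : (h0^-1 * sgval h = (sgval h * sgrepr c) * (h0 * sgrepr c)^-1)%g.
          by rewrite hE mulgK.
        by apply: VM => //; exact: VV.
      by change (sgval h = h0 * (h0^-1 * sgval h))%g; rewrite mulKVg.
    have W'm : measurable (W' : set (borel (sgtype H))).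
      apply: borel_open; have := @sgval_open H _ (V_open (h0^-1)%g); congr open.
      apply/seteqP; split=> h /= Vh.
        have Hh : sgset H (h0^-1 * sgval h)%g by apply: sgM => //; exact: sgV.
        exists (exist _ (h0^-1 * sgval h)%g (mem_set Hh) : sgtype H) => //.
        by change (sgval h = h0 * (h0^-1 * sgval h))%g; rewrite mulKVg.
      by have [w Ww ->] := Vh; rewrite mulKg.
    rewrite -[W']setIT -integral_indic //; apply: eq_integral => h _.
    congr EFin; rewrite !indicE; congr ((nat_of_bool _)%:R).
    by apply/idP/idP => /set_mem /W'E H'; apply/mem_set.
  rewrite (_ : (fun h => _) = cst 0%E) ?integral0 //; apply/funext => h.
  rewrite indicE memNset // => -[_]; rewrite XH // => Xc.
  by apply: Uc; apply/mem_set.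
have Um := quotient_set_measurable.
have BE : (\int[muS]_s (\1_VX (sgval s))%:E = muS (B : set (borel (sgtype S))))%E.
  have := integral_indic muS measurableT (borel_open B_open); rewrite setIT => <-.
  by apply: eq_integral => s _; rewrite phiE.
move: weil; rewrite BE => BWU.
have {}BWU : (muS (B : set (borel (sgtype S))) = muH W * mu U)%E.
  by rewrite BWU -(integral_if mu _ Um); apply: eq_integral => c _; exact: inner.
have [_ Sfin Spos] := haarS.
have B0 : (0 < muS (B : set (borel (sgtype S))))%E.
  apply: Spos => //; exists (exist _ 1%g (mem_set (sg1 S)) : sgtype S).
  by split.
have Bfin : (muS (B : set (borel (sgtype S))) < +oo)%E by exact: Sfin.
move: B0 Bfin; rewrite BWU.
exact: factor_fin (measure_ge0 muH W) (measure_ge0 mu U).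
Qed.

End WeilFormula.

(** * Toroidal integrals *)

Section ConstantExtension.
Variables (R : realType) (k : finFieldType) (n : nat) (E : fieldExtType (ratfun k)).
Local Notation F := (ratfun k).
Local Notation G := (GLA F n).
Local Notation dg := (map_mx (@diag k)).
Variables (b : n.-tuple E) (bE : basis_of {:E} b).

Lemma gl_intM (g h : G) : gl_int g -> gl_int h -> gl_int (g * h)%g.
Proof.
move=> /gl_int_vge gI /gl_int_vge hI; apply/gl_int_vge => x.
have [g1 g2] := gI x; have [h1 h2] := hI x.
by rewrite glmxM glinvM !map_mxM -[0]addr0; split; apply: mxgeM.
Qed.

Lemma torus_cent_scalar (h : G) : torus_rat_center b h ->
  exists a e, e != 0 /\ glmx h = a *: dg (regmx b e).
Proof.
move=> [t [e e0 tE] [z [a zE] <-]]; exists a, e; split=> //.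
by rewrite glmxM tE zE mul_mx_scalar.
Qed.

Lemma torus_cent_sub (h : G) : torus_rat_center b h -> torus_pts b h.
Proof.
have half g : torus_rat_center b g -> regalg b (glmx g).
  by move=> /torus_cent_scalar [a [e [_ ->]]]; apply: regalgZ; exact: regalg_diag.
by move=> hH; split; [exact: half | exact: half (torus_rat_centerV bE hH)].
Qed.

Lemma torus_cent_comm (g h : G) : torus_rat_center b g -> torus_rat_center b h ->
  (g * h = h * g)%g.
Proof.
move=> /torus_cent_scalar [a [e [_ gE]]] /torus_cent_scalar [c [d [_ hE]]].
apply: glmx_inj; rewrite 2!glmxM gE hE -!scalemxAl -!scalemxAr !scalerA mulrC.
by rewrite -!map_mxM -!regmxM // [e * d]mulrC.
Qed.

Lemma f_torus_cent (f : G -> R[i]) (h g : G) : pgl_invariant f ->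
  torus_rat_center b h -> f (h * g)%g = f g.
Proof.
move=> f_inv [t [e e0 tE] [z zC <-]]; rewrite -mulgA.
have tR : gl_rat t by exists (regmx b e); [exact: regmx_unit | exact: tE].
by rewrite (f_ratl f_inv _ tR) (f_centerl f_inv _ zC).
Qed.

(** [p] is the change from the arbitrary basis [b] of the torus to a basis with constant structure
    constants. *)
Lemma torus_conjugator : (0 < n)%N -> const_ext n E -> exists p : G,
  [/\ gl_rat p,
    forall u, torus_pts b u -> exists h w : G,
      [/\ torus_rat_center b h, gl_int w & (u * p = h * (p * w))%g] &
    compact [set s : sgtype (torus bE) | gl_int (p^-1 * sgval s * p)%g]].
Proof.
move=> n0 /constant_basis [b0 [b0E b0_const]].
exists (rat_pt (basis_change_unit bE b0E)); split; first exact: rat_ptP.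
  by move=> u; exact: torus_decomposition.
apply: (torus_int_compact b0E) => // e.
by rewrite -!map_mxM regmx_basis_change.
Qed.

End ConstantExtension.

Section Toroidal.
Variables (R : realType) (k : finFieldType) (n : nat) (E : fieldExtType (ratfun k)).
Local Notation F := (ratfun k).
Local Notation G := (GLA F n).
Hypotheses (n_gt0 : (0 < n)%N) (E_const : const_ext n E).
Variables (D : torus_datum R n E) (f : G -> R[i]).
Hypotheses (f_inv : pgl_invariant f) (f_tor : forall g, toroidal_integral D f g = 0).

Lemma open_int_coset (p : G) (X : set G) :
  (forall g v, X g -> gl_int (p^-1 * v * p)%g -> X (g * v)%g) -> open X.
Proof.
move=> Xp; apply: (@open_coset_union _ _ p) => g v Xg v1 v2; apply: Xp => //.
by apply/gl_int_vge => x; split; [exact: v1 | exact: v2].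
Qed.

Lemma conj_groupM (p g h : G) : (p^-1 * (g * h) * p = (p^-1 * g * p) * (p^-1 * h * p))%g.
Proof. by rewrite !mulgA mulgK. Qed.

Lemma conj_groupV (p g : G) : (p^-1 * g^-1 * p = (p^-1 * g * p)^-1)%g.
Proof. by rewrite !invgM invgK mulgA. Qed.

Lemma toroidal_vanishing (lam : 'I_n -> int) :
  (forall t : G, gl_int t -> f (t * twist_pt k lam)%g = 0 \/
     f (t * twist_pt k lam)%g = f (twist_pt k lam)) ->
  f (twist_pt k lam) = 0.
Proof.
move=> f_vals; apply/eqP/negPn/negP => f0.
have [p [pR p_dec p_compact]] := torus_conjugator (td_basisP D) n_gt0 E_const.
have [g0 g0E] : exists g0, g0 = (p * twist_pt k lam)%g by exists (p * twist_pt k lam)%g.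
have fg0 : f g0 = f (twist_pt k lam) by rewrite g0E; exact: f_ratl.
pose V : set G := [set v | gl_int (p^-1 * v * p)%g].
pose X : set G := [set g | f (g * g0)%g != 0].
have V_compact : compact [set s : sgtype (torus (td_basisP D)) | V (sgval s)] := p_compact.
have V_int v : V v -> gl_int (p^-1 * v * p)%g by [].
have int_V v : gl_int (p^-1 * v * p)%g -> V v by [].
have X_f g : X g -> f (g * g0)%g != 0 by [].
have f_X g : f (g * g0)%g != 0 -> X g by [].
clearbody V X.
have VM g h : V g -> V h -> V (g * h)%g.
  move=> /V_int gV /V_int hV; apply: int_V; rewrite (conj_groupM p g h).
  exact: gl_intM gV hV.
have VV g : V g -> V (g^-1)%g.
  by move=> /V_int gV; apply: int_V; rewrite (conj_groupV p g); exact: gl_intV gV.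
have V1 : V 1%g by apply: int_V; rewrite mulg1 mulVg; exact: gl_int1.
have V_open g : open [set h | V (g * h)%g].
  apply: (@open_int_coset p) => h v gh /int_V pv.
  by change (V (g * (h * v))%g); rewrite mulgA; apply: VM.
have VC_open : open (~` V).
  apply: (@open_int_coset p) => h v Vh /int_V pv Vhv; apply: Vh.
  by rewrite -(mulgK v h); apply: VM => //; exact: VV.
(* Right invariance of [f] under K becomes invariance of [f (_ * g0)] under the open subgroup g0 K
   g0^-1; hence [X] and its complement are both open. *)
have fK g v : gl_int (g0^-1 * v * g0)%g -> f (g * v * g0)%g = f (g * g0)%g.
  move=> vI; rewrite -(f_intr f_inv (g * g0)%g vI); congr f.
  by rewrite !mulgA mulgK.
have X_open : open X.
  by apply: (@open_int_coset g0) => g v /X_f Xg gv; apply: f_X; rewrite (fK _ _ gv).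
have XC_open : open (~` X).
  by apply: (@open_int_coset g0) => g v Xg gv /X_f; rewrite (fK _ _ gv) => /f_X.
have XH h g : sgset (torus_cent (td_basisP D)) h -> X (h * g)%g <-> X g.
  have E' := f_torus_cent (td_basisP D) (g * g0)%g f_inv.
  move=> /E' hgE; split=> /X_f fX; apply: (f_X); move: fX; rewrite -mulgA hgE; exact.
have X1 : X 1%g by apply: f_X; rewrite mul1g fg0.
have V_cover s : sgset (torus (td_basisP D)) s ->
    exists2 h, sgset (torus_cent (td_basisP D)) h & V (h * s)%g.
  move=> /p_dec [h [w [hH wI sp]]]; exists (h^-1)%g; first exact: sgV.
  by apply: int_V; rewrite -!mulgA sp !mulKg.
pose U := [set c : sgquot (torus_cent (td_basisP D)) (torus (td_basisP D)) | X (sgrepr c)].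
have Um : measurable (U : set (borel (sgquot _ _))).
  by apply: quotient_set_measurable.
have HS g := @torus_cent_sub _ _ _ _ (td_basisP D) g.
have Hcomm g h := @torus_cent_comm _ _ _ _ (td_basisP D) g h.
have /andP[mu0 mufin] := quotient_set_measure (td_haarTP D) (td_haarZP D) (@td_muP _ _ _ _ D)
  HS Hcomm V_open VC_open VM VV V_compact V_cover X_open XC_open XH V1 X1.
have fU c : f (sgrepr c * g0)%g = if c \in U then f (twist_pt k lam) else 0.
  case: ifPn => [/set_mem Uc|/negP cU].
    (* The representative times [p] equals [h * (p * w)]; the factors [h] and [p] drop out by
       invariance, and [f] is evaluated at [w * twist_pt k lam], where [f_vals] applies. *)
    have /p_dec [h [w [hH wI rp]]] :=
      @sgreprP _ _ (torus_cent (td_basisP D)) (torus (td_basisP D)) HS c.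
    move: Uc => /X_f; rewrite g0E mulgA rp -mulgA (f_torus_cent (td_basisP D)) // -mulgA.
    by rewrite (f_ratl f_inv _ pR); have [->|->] := f_vals w wI; rewrite ?eqxx.
  by apply/eqP/negPn/negP => /f_X fc; apply: cU; apply/mem_set.
have := f_tor g0; rewrite /toroidal_integral /Rintegral.
(* Stated for a general [r] so as to serve for both the real and the imaginary part. *)
have int_if (r : R[i] -> R) : r 0 = 0 ->
    fine (\int[td_mu D]_c (r (f (sgrepr c * g0)%g))%:E)%E =
    r (f (twist_pt k lam)) * fine (td_mu D U).
  move=> r0; transitivity (fine ((r (f (twist_pt k lam)))%:E * td_mu D U)%E).
    congr fine; rewrite -(integral_if (td_mu D) _ Um); apply: eq_integral => c _.
    by rewrite fU; case: ifP; rewrite ?r0.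
  by rewrite fineM // ge0_fin_numE // ltW.
rewrite !int_if // => /eqP; rewrite eq_complex /= !mulf_eq0.
have m0 : fine (td_mu D U) == 0 = false.
  by rewrite gt_eqF // fine_gt0 // mu0.
rewrite m0 !orbF => /andP[/eqP re0 /eqP im0]; move: f0.
by rewrite eq_complex re0 im0 !eqxx.
Qed.

Lemma toroidal_zero : f = (fun=> 0).
Proof. exact: (vanishing f_inv toroidal_vanishing). Qed.

End Toroidal.

(** * Existence of constant extensions *)

(** A nonzero [r] would be coprime to [p], and a Bezout relation evaluated at [z] would read 0 =
    1. *)
Lemma root_small_irreducible (K L : fieldType) (iota : {rmorphism K -> L})
    (p r : {poly K}) (z : L) :
  irreducible_poly p -> root (map_poly iota p) z -> root (map_poly iota r) z ->
  (size r < size p)%N -> r = 0.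
Proof.
move=> p_irr pz rz rp; apply/eqP; apply: contraLR rp => r0; rewrite -leqNgt.
apply: contraT; rewrite -ltnNge => rp.
have /Bezout_eq1_coprimepP [[u w] /= E] : coprimep p r.
  rewrite irreducible_poly_coprime //; apply: contraL rp => /(dvdp_leq r0).
  by rewrite leqNgt.
have := congr1 (fun q => (map_poly iota q).[z]) E.
rewrite rmorphD !rmorphM /= hornerD !hornerM (eqP pz) (eqP rz) !mulr0 addr0.
by rewrite rmorph1 hornerC => /eqP; rewrite eq_sym oner_eq0.
Qed.

Lemma frac_poly_clear (A : idomainType) (q : {poly {fraction A}}) :
  exists d (Q : {poly A}), d != 0 /\ map_poly (@tofrac A) Q = tofrac d *: q.
Proof.
elim/poly_ind: q => [|q c [d [Q [d0 dQ]]]].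
  by exists 1, 0; rewrite oner_neq0 rmorph0 scaler0.
have [m [e [e0 ce]]] := frac_numden c.
exists (d * e), (e%:P * Q * 'X + (d * m)%:P); split; first by rewrite mulf_neq0.
rewrite rmorphD !rmorphM /= !map_polyC map_polyX dQ /= -ce.
rewrite scalerDr -!mul_polyC; rewrite !(tofracM, polyCM); ring.
Qed.

(* Reduce a factorization over k[X] modulo p, in L[X] where L = k[z]/p(z). *)
Lemma irreducible_map_tofrac (K : fieldType) (p : {poly K}) :
  irreducible_poly p ->
  irreducible_poly (map_poly (@tofrac {poly K} \o polyC) p).
Proof.
move=> p_irr; have [p1 _] := p_irr; have p0 : p != 0 by rewrite -size_poly_gt0 ltnW.
have [L _ [z pz _]] := irredp_FAdjoin p_irr.
pose psi : {rmorphism {poly K} -> {poly L}} := map_poly (in_alg L).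
pose phi (G : {poly {poly K}}) := (map_poly psi G).[z%:P].
(* [phi] substitutes [z] for the outer variable. For each power of X, the coefficients of [G] at
   that power form a polynomial over [K] of size less than [size p] that vanishes at [z], hence is
   0. *)
have phi0 G : phi G = 0 -> (size G < size p)%N -> G = 0.
  move=> G0 Gp; apply/polyP => j; rewrite coef0; apply/polyP => i; rewrite coef0.
  suff H : \poly_(j < size G) G`_j`_i = 0.
    have := congr1 (fun q : {poly K} => q`_j) H; rewrite coef_poly coef0.
    by case: ltnP => // /(nth_default 0) ->; rewrite coef0.
  apply: root_small_irreducible p_irr pz _ _; last exact: leq_ltn_trans (size_poly _ _) Gp.
  have /(congr1 (fun q : {poly L} => q`_i)) := G0; rewrite coef0 /phi => Gi.
  apply/eqP; rewrite -[RHS]Gi.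
  rewrite (@horner_coef_wide _ (size G)); last first.
    by rewrite size_map_poly size_poly.
  rewrite (@horner_coef_wide _ (size G)); last exact: size_poly.
  rewrite coef_sum; apply: eq_bigr => l _.
  by rewrite !coef_map coef_poly ltn_ord -rmorphXn /= coefMC coef_map.
split; first by rewrite size_map_poly.
move=> q q1 /dvdpP [r pE].
set P := map_poly _ p in pE *.
have P0 : P != 0 by rewrite map_poly_eq0.
have q0 : q != 0 by apply: contraNneq P0 => q0; rewrite pE q0 mulr0.
have r0 : r != 0 by apply: contraNneq P0 => r0; rewrite pE r0 mul0r.
have [d [Q [d0 dQ]]] := frac_poly_clear q.
have [e [S [e0 eS]]] := frac_poly_clear r.
have tf_inj : injective (@tofrac {poly K}).
  by move=> f g /eqP; rewrite tofrac_eq => /eqP.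
have td0 : tofrac d != 0 by rewrite tofrac_eq0.
have te0 : tofrac e != 0 by rewrite tofrac_eq0.
have sQ : size Q = size q.
  by rewrite -(size_scale q td0) -dQ size_map_inj_poly.
have sS : size S = size r.
  by rewrite -(size_scale r te0) -eS size_map_inj_poly.
have sP : size P = size p by rewrite size_map_poly.
have QS : S * Q = (e * d) *: map_poly polyC p.
  apply: (map_inj_poly tf_inj); first exact: tofrac0.
  rewrite rmorphM /= dQ eS -scalerAl -scalerAr -pE scalerA -tofracM.
  by rewrite map_polyZ /= -map_poly_comp.
(* [S * Q] is a multiple of [p], which vanishes at [z]. Since [{poly L}] is a domain, one factor is
   killed by [phi], and [phi0] excludes this for a factor of size less than [size p]. *)
have : phi S * phi Q = 0.
  rewrite /phi -hornerM -rmorphM QS -mul_polyC rmorphM /= hornerM.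
  rewrite -map_poly_comp (eq_map_poly (_ : _ =1 polyC \o in_alg L)); last first.
    by move=> c; rewrite /= map_polyC.
  by rewrite map_poly_comp horner_map /= (eqP pz) mulr0.
have sE : size p = (size r + size q).-1 by rewrite -sP pE size_mul.
have r1 : (0 < size r)%N by rewrite size_poly_gt0.
have q2 : (0 < size q)%N by rewrite size_poly_gt0.
move/eqP; rewrite mulf_eq0 => /orP[] /eqP /phi0.
  rewrite sS => H; have : S = 0 by apply: H; lia.
  by move=> S0; move: r1; rewrite -sS S0 size_poly0.
rewrite sQ => H; have [rs|rs] := leqP (size r) 1.
  have r_1 : size r = 1 by apply/eqP; rewrite eqn_leq rs r1.
  have qP : q %| P by rewrite pE dvdp_mull.
  by rewrite -(dvdp_size_eqp qP) sP sE r_1.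
have : Q = 0 by apply: H; lia.
by move=> Q0; move: q2; rewrite -sQ Q0 size_poly0.
Qed.

Lemma size_uniq_full (k : finFieldType) (L : fieldExtType k) (s : seq L) :
  uniq s -> (forall z, z \in s) -> size s = (#|k| ^ \dim {:L})%N.
Proof.
move=> s_uniq s_full; rewrite -(@card_vspace k (finvect_type L) _ fullv).
rewrite -(card_uniqP (s_uniq : uniq (s : seq (finvect_type L)))).
by apply: eq_card => z; rewrite s_full [RHS]memvf.
Qed.

(** Take the splitting field of X^m - X with m = q^n. The derivative is -1, so there are m distinct
    roots; they form the fixed field of the n-th power of Frobenius, and as they generate [L] they
    exhaust it. Counting gives the dimension. *)
Lemma finite_extension_exists (k : finFieldType) (n : nat) : (0 < n)%N ->
  exists L : splittingFieldType k, \dim {:L} = n.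
Proof.
move=> n0; pose m := (#|k| ^ n)%N.
have k1 := finNzRing_gt1 k.
have m1 : (1 < m)%N by rewrite -(expn0 #|k|) ltn_exp2l.
have m_gt0 := ltnW m1.
pose q (R : nzRingType) : {poly R} := 'X^m - 'X.
have sq (R : nzRingType) : size (q R) = m.+1.
  by rewrite size_polyDl size_polyXn // size_polyN size_polyX.
have /FinSplittingFieldFor [L] : q k != 0 by rewrite -size_poly_gt0 sq.
rewrite rmorphB rmorphXn /= map_polyX -/(q L) => -[zs qE zsL].
have mL : m%:R = 0 :> L.
  have -> : m%:R = in_alg L (m%:R) by rewrite rmorph_nat.
  suff k0 : #|k|%:R = 0 :> k by rewrite natrX k0 expr0n gtn_eqF // rmorph0.
  (* Translation by 1 permutes [k]; comparing the two sums shows that #|k| is 0 in [k]. *)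
  have /eqP : \sum_(x : k) x = \sum_(x : k) (x + 1) by exact: reindex_inj (addIr 1).
  by rewrite big_split sumr_const -[X in X == _]addr0 (inj_eq (addrI _)) => /eqP.
have Uzs : uniq zs.
  rewrite -separable_prod_XsubC -(eqp_separable qE) unlock derivB derivXn derivX.
  rewrite -mulr_natr -polyC_natr mL mulr0 sub0r.
  by rewrite -scaleN1r coprimepZr ?oppr_eq0 ?oner_eq0 // coprimep1.
have szs : size zs = m.
  by apply: succn_inj; rewrite -(size_prod_XsubC _ id) -(eqp_size qE) sq.
exists L.
have [a _ aP] := finField_galois_generator (sub1v {:L}).
rewrite /= dimv1 expn1 in aP.
have aXE i x : (a ^+ i)%g x = x ^+ (#|k| ^ i).
  elim: i => [|i IHi]; first by rewrite gal_id.
  by rewrite expgSr galM ?memvf // aP ?memvf // IHi expnSr exprM.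
have in_zs : zs =i fixedSpace (a ^+ n)%g.
  move=> z; rewrite -root_prod_XsubC -(eqp_root qE) (sameP fixedSpaceP eqP).
  by rewrite aXE rootE /q !hornerE subr_eq0.
have Lzs z : z \in zs.
  rewrite in_zs; apply: (subvP _ z (memvf z)); rewrite -zsL.
  rewrite -[fixedSpace _]subfield_closed agenvS // subv_add sub1v.
  by apply/span_subvP => y; rewrite in_zs.
apply/eqP; rewrite -(eqn_exp2l _ _ k1) -(size_uniq_full Uzs Lzs).
by apply/eqP.
Qed.

(** The minimal polynomial of a primitive element of the extension of degree [n]. *)
Lemma monic_irreducible_exists (k : finFieldType) (n : nat) : (0 < n)%N ->
  exists p : {poly k}, monic_irreducible_poly p /\ size p = n.+1.
Proof.
move=> n0; have [L dimL] := finite_extension_exists k n0.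
have sepL : separable 1 {:L} by have /and3P[] := finField_galois (sub1v {:L}).
have genL := eq_adjoin_separable_generator sepL (sub1v _).
set z := separable_generator _ _ in genL.
have /polyOver1P [p pE] := minPolyOver 1 z.
have sp : size p = n.+1.
  rewrite -(size_map_poly (in_alg L)) -pE size_minPoly adjoin_degreeE -genL.
  by rewrite dimv1 divn1 dimL.
exists p; split=> //; split; last by rewrite -(map_monic (in_alg L)) -pE monic_minPoly.
split=> [|q q1 qp]; first by rewrite sp ltnS.
have /minPoly_irr : map_poly (in_alg L) q \is a polyOver 1%VS.
  by apply/polyOver1P; exists q.
move=> /(_ z); rewrite pE dvdp_map eqp_map => /(_ qp) => /orP[//|].
by rewrite -size_poly_eq1 size_map_poly (negPf q1).
Qed.

Lemma separable_Xcard (K : finFieldType) (L : fieldType) (iota : {rmorphism K -> L}) :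
  separable_poly ('X^#|K| - 'X : {poly L}).
Proof.
rewrite (_ : 'X^#|K| - 'X = map_poly iota ('X^#|K| - 'X)); last first.
  by rewrite rmorphB /= map_polyXn map_polyX.
rewrite separable_map finField_genPoly separable_prod_XsubC.
exact: index_enum_uniq.
Qed.

(** Guarantees that a constant extension occurs in the intersection defining [A_tor]. An irreducible
    [p] over [k] stays irreducible over k(X); adjoining a root [z] gives [E], and evaluation at [z]
    embeds L = k[X]/(p). *)
Lemma constant_extension_exists (k : finFieldType) (n : nat) : (2 <= n)%N ->
  exists E : fieldExtType (ratfun k), const_ext n E /\ separable 1 {:E}.
Proof.
move=> n2; have [p [p_mi sp]] := monic_irreducible_exists k (ltnW n2).
pose kappa : {rmorphism k -> ratfun k} := @tofrac {poly k} \o polyC.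
have [E dimE [z pz genE]] := irredp_FAdjoin (irreducible_map_tofrac p_mi.1).
have sdim : \dim {:E} = n by rewrite dimE size_map_poly sp.
pose iota0 : {rmorphism k -> E} := in_alg E \o kappa.
have pz0 : (map_poly iota0 p).[z] = 0.
  by rewrite map_poly_comp; exact/eqP.
pose L := {poly %/ p with p_mi}.
pose iota (a : L) : E := (map_poly iota0 (a : {poly k})).[z].
(* Products in the quotient ring are reduced modulo [p], which evaluation at the root [z] does not
   see. *)
have rmodE c : (map_poly iota0 (Pdiv.Ring.rmodp c (mk_monic p))).[z] =
    (map_poly iota0 c).[z].
  rewrite (mk_monicE p_mi) {2}[c](Pdiv.RingMonic.rdivp_eq p_mi.2).
  by rewrite rmorphD rmorphM /= hornerD hornerM pz0 mulr0 add0r.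
have iotaB : zmod_morphism iota.
  by move=> a b; rewrite /iota -hornerN -hornerD -rmorphB.
have iotaM : monoid_morphism iota.
  split=> [|a b]; first by rewrite /iota (qpolyCE p 1) rmorph1 hornerC.
  by rewrite /iota poly_of_qpolyM rmodE rmorphM hornerM.
pose iotaf := GRing.isZmodMorphism.Build _ _ iota iotaB.
pose iotag := GRing.isMonoidMorphism.Build _ _ iota iotaM.
pose io : {rmorphism L -> E} := HB.pack iota iotaf iotag.
have cardL : #|L| = (#|k| ^ n)%N by rewrite card_qfpoly sp.
have iX : iota 'qX = z.
  by rewrite /iota qpolyXE ?sp ?ltnS //= ?p_mi.2 // map_polyX hornerX.
exists E; split.
  split=> //; exists L, io; split=> //.
  apply/eqP; rewrite eqEsubv subvf -genE; apply/FadjoinP; split; first exact: subv_adjoin_seq.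
  by rewrite -iX; apply: seqv_sub_adjoin; apply/mapP; exists 'qX; rewrite ?mem_enum.
(* [E] is generated by [z], so it suffices that [z] be separable: it comes from [L], hence is a root
   of the separable polynomial ['X^#|L| - 'X]. *)
apply/separableP => y _; have : y \in <<1; z>>%VS by rewrite genE memvf.
apply/adjoin_separableP/separable_elementP.
exists ('X^#|L| - 'X); split.
- by rewrite rpredB ?rpredX ?polyOverX.
- by rewrite /root !hornerE -iX -[iota]/(io : L -> E) -rmorphXn /= expf_card subrr.
- exact: (separable_Xcard io).
Qed.

(** * The zero form and the conclusion *)

Section ZeroForm.
Variables (R : realType) (k : finFieldType) (n : nat).

Lemma automorphic0 : @automorphic R k n (fun=> 0).
Proof.
split; first by [].
- by exists 0, 0%N => g; rewrite normr0 mul0r.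
- exists 0%N, (fun _ _ => 0) => Phi _; exists (fun=> 0) => g.
  by rewrite big_ord0 /hecke_act fsbig1 // => C _; rewrite mulr0.
Qed.

Lemma toroidal_integral0 (E : fieldExtType (ratfun k)) (D : torus_datum R n E) g :
  toroidal_integral D (fun=> 0) g = 0.
Proof. by rewrite /toroidal_integral /= /Rintegral integral0. Qed.

End ZeroForm.

Lemma A_tor_ext0 (R : realType) (k : finFieldType) (n : nat)
    (E : fieldExtType (ratfun k)) (D : torus_datum R n E) :
  A_tor_ext D (fun=> 0).
Proof. by split=> [|g]; [exact: automorphic0 | exact: toroidal_integral0]. Qed.

Lemma A_tor_ext_const (R : realType) (k : finFieldType) (n : nat)
    (E : fieldExtType (ratfun k)) (D : torus_datum R n E) :
  (0 < n)%N -> const_ext n E -> A_tor_ext D = [set (fun=> 0)].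
Proof.
move=> n0 E_const; apply/seteqP; split=> [f [[f_inv _ _] f_tor]|f ->].
  exact: (toroidal_zero n0 E_const f_inv f_tor).
exact: A_tor_ext0.
Qed.

Theorem theorem6p12 (R : realType) (k : finFieldType) (n : nat)
    (n_ge2 : (2 <= n)%N) :
  (forall E : fieldExtType (ratfun k), const_ext n E ->
     forall D : torus_datum R n E, A_tor_ext D = [set (fun=> 0)]) /\
  (forall D : torus_data R k n, A_tor D = [set (fun=> 0)]).
Proof.
split=> [E E_const D|D]; first exact: A_tor_ext_const (ltnW n_ge2) E_const.
apply/seteqP; split=> [f f_tor|f -> E sepE dimE]; last exact: A_tor_ext0.
have [E [E_const E_sep]] := constant_extension_exists k n_ge2.
have := f_tor E E_sep E_const.1.
by rewrite (A_tor_ext_const _ (ltnW n_ge2) E_const).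
Qed.
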